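(* Let $\psi(\mathcal{X})=\mathcal{X}$ be an inflation functional equation that has a primitive subdivision matrix $S=[|\mathcal{D}_{ij}|]_{1\le i,j\le n}$ that satisfies the Perron eigenvalue condition $\lambda(S)=|\det(A)|$. Then the following conditions are equivalent: (i) For some $N>0$ there exists a nonempty weakly uniformly discrete multiset family $\hat{\mathcal{X}}$ such that $\psi^N(\hat{\mathcal{X}})=\hat{\mathcal{X}}$. (ii) For some $N>0$ there exists a nonempty uniformly discrete multiset family $\hat{\mathcal{X}}$ such that $\psi^N(\hat{\mathcal{X}})=\hat{\mathcal{X}}$. (iii) For some $N>0$ there exists a self-replicating multi-tiling family $\hat{\mathcal{X}}$ with $\psi^N(\hat{\mathcal{X}})=\hat{\mathcal{X}}$. (iv) The unique compact solution $(T_1,\dots,T_n)$ of the associated multi-tile functional equation consists of sets $T_i$ that have positive Lebesgue measure, $1\le i\le n$.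
   Context: Fix integers $d,n\ge 1$, an expanding real $d\times d$ matrix $A$ (all eigenvalues, real or complex, have absolute value $>1$), and finite, possibly empty, sets $\mathcal{D}_{ij}\subset\mathbb{R}^d$ for $1\le i,j\le n$. A multiset $X$ in $\mathbb{R}^d$ is a set $\underline{X}\subset\mathbb{R}^d$ (the underlying set) with a multiplicity function $m_X:\underline{X}\to\mathbb{Z}_{>0}$, extended by $0$ off $\underline{X}$. The multiset union $X\vee Y$ has multiplicity function $m_X+m_Y$. $A(X)$ has multiplicity $m_X(A^{-1}\mathbf{x})$ at $\mathbf{x}$, and $X+\mathcal{D}=\bigvee_{\mathbf{d}\in\mathcal{D}}(X+\mathbf{d})$ (with multiplicity if $\mathcal{D}$ is a multiset). A multiset family is a vector $\mathcal{X}=(X_1,\dots,X_n)$ of multisets in $\mathbb{R}^d$, nonempty if some $X_i$ is nonempty. The inflation operator is $\psi(\mathcal{X})=(X_1',\dots,X_n')$ with $X_i'=\bigvee_{j=1}^n(A(X_j)+\mathcal{D}_{ij})$; $\psi^N$ is its $N$-fold composition, which is the inflation operator with matrix $A^N$ and digit multisets $$\mathcal{D}_{ij}^{N}=\bigvee_{j_1,\dots,j_{N-1}=1}^n(\mathcal{D}_{ij_{N-1}}+A\mathcal{D}_{j_{N-1}j_{N-2}}+\cdots+A^{N-1}\mathcal{D}_{j_1j}).$$ A nonnegative real square matrix is primitive if some power has all entries strictly positive; its Perron eigenvalue $\lambda(\cdot)$ is its positive real simple eigenvalue equal to its spectral radius. The associated multi-tile functional equation is $A(T_i)=\bigcup_{j=1}^n(T_j+\mathcal{D}_{ji})$,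 $1\le i\le n$ (ordinary set union). When $S$ is primitive it has a unique nonempty solution $(T_1,\dots,T_n)$ with all $T_i$ compact, and then all $T_i$ are nonempty; this is ''the unique compact solution''. The multi-tile equation associated with $\psi^N$ is $A^N(T_i)=\bigcup_{j=1}^n(T_j+\underline{\mathcal{D}}_{ji}^N)$. A multiset $X$ is weakly uniformly discrete if there are $r>0$ and a finite $m\ge1$ such that any open ball of radius $r$ contains at most $m$ points of $X$ counted with multiplicity; uniformly discrete if this holds with $m=1$ for some $r>0$; relatively dense if for some finite $R>0$ each closed ball of radius $R$ contains a point of $X$; a Delone set if it is uniformly discrete (hence an ordinary set) and relatively dense. A multiset family is weakly uniformly discrete (resp. uniformly discrete) if each $X_i$ is. A multiset family $\mathcal{X}$ with $\psi^N(\mathcal{X})=\mathcal{X}$ is a self-replicating multi-tiling family (for $\psi^N$) if: (a) each $X_i$ is a Delone set; (b) the multi-tile equation associated with $\psi^N$ has a unique (nonempty compact) solution $(T_1,\dots,T_n)$, and each $T_i$ has positive Lebesgue measure; (c) the sets $\{T_i+\mathbf{x}_i:1\le i\le n,\ \mathbf{x}_i\in X_i\}$ tile $\mathbb{R}^d$, i.e. they cover $\mathbb{R}^d$ and any two of them with distinct indices $(i,\mathbf{x}_i)$ intersect in a set of Lebesgue measure zero. *)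

(* Defs.v *)
From HB Require Import structures.
From mathcomp Require Import all_boot all_order all_algebra finmap.
From mathcomp Require Import complex.
From mathcomp Require Import all_classical all_reals all_analysis.

Set Implicit Arguments.
Unset Strict Implicit.
Unset Printing Implicit Defensive.

Import Order.TTheory GRing.Theory Num.Theory.
Import numFieldNormedType.Exports.

Local Open Scope classical_set_scope.
Local Open Scope ring_scope.

Section Matrices.
Context {R : realType}.

Definition complex_eigenvalues n (M : 'M[R]_n) : set R[i] :=
  [set z | eigenvalue (map_mx (real_complex R) M) z].

Definition expanding d (A : 'M[R]_d) : Prop :=
  forall z : R[i], complex_eigenvalues A z -> 1 < `|z|.

(* The exponent is positive: for n = 1 the zero matrix is not primitive. *)
Definition primitive n (M : 'M[R]_n) : Prop :=
  (forall i j, 0 <= M i j) /\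
  exists2 k, (0 < k)%N & forall i j, 0 < (M ^+ k) i j.

Definition spectral_radius n (M : 'M[R]_n) : R :=
  sup [set complex.Re `|z| | z in complex_eigenvalues M].

(* [mup l (char_poly M) = 1] says that l is a simple eigenvalue. *)
Definition is_perron_eigenvalue n (M : 'M[R]_n) (l : R) : Prop :=
  [/\ 0 < l, eigenvalue M l, mup l (char_poly M) = 1%N &
      l = spectral_radius M].

End Matrices.

Section Euclidean.
Context {R : realType} {d : nat}.
Notation V := 'cV[R]_d.

(* The library norm on 'cV[R]_d is the sup norm; balls are Euclidean here. *)
Definition enorm (x : V) : R := Num.sqrt (\sum_i x i 0 ^+ 2).

Definition eball (c : V) (r : R) : set V := [set x | enorm (x - c) < r].

Definition eclosed_ball (c : V) (r : R) : set V := [set x | enorm (x - c) <= r].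

Definition minkowski (X Y : set V) : set V := [set x + y | x in X & y in Y].

Definition translate (X : set V) (v : V) : set V := [set x + v | x in X].

Definition box (a b : V) : set V :=
  [set x | forall i, a i 0 <= x i 0 <= b i 0].

Definition box_cover (X : set V) : set (nat -> V * V) :=
  [set F : nat -> V * V | (forall k i, (F k).1 i 0 <= (F k).2 i 0) /\
           X `<=` \bigcup_k box (F k).1 (F k).2].

(* Lebesgue outer measure on R^d (d > 0), defined on all sets. It is only
   evaluated below on compact sets, where it is the Lebesgue measure. *)
Definition lebesgue_vol (X : set V) : \bar R :=
  ereal_inf
    [set (\sum_(0 <= k <oo) (\prod_i ((F k).2 i 0 - (F k).1 i 0))%:E)%E
       | F in box_cover X].

End Euclidean.

Section Multisets.
Context {R : realType} {d : nat}.
Notation V := 'cV[R]_d.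

(* A multiset in R^d is encoded by its multiplicity function extended by 0. *)
Definition multiset := V -> nat.

Definition underlying (X : multiset) : set V := [set x | (0 < X x)%N].

(* Number of points of X in B, counted with multiplicity. *)
Definition mcount (X : multiset) (B : set V) : \bar R :=
  \esum_(x in B) (X x)%:R%:E.

Definition weakly_uniformly_discrete (X : multiset) : Prop :=
  exists r : R, exists m : nat, [/\ 0 < r, (0 < m)%N &
    forall c : V, (mcount X (eball c r) <= m%:R%:E)%E].

Definition uniformly_discrete (X : multiset) : Prop :=
  exists2 r : R, 0 < r & forall c : V, (mcount X (eball c r) <= 1)%E.

Definition relatively_dense (X : multiset) : Prop :=
  exists2 r : R, 0 < r &
    forall c : V, underlying X `&` eclosed_ball c r !=set0.

Definition delone (X : multiset) : Prop :=
  uniformly_discrete X /\ relatively_dense X.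

Definition mset_image (A : 'M[R]_d) (X : multiset) : multiset :=
  fun x => X (invmx A *m x).

(* X + D, where the finite multiset D is listed with multiplicity. *)
Definition mset_add_digits (X : multiset) (D : seq V) : multiset :=
  fun x => (\sum_(v <- D) X (x - v)%R)%N.

End Multisets.

Arguments multiset : clear implicits.

Section Inflation.
Context {R : realType} {d n : nat}.
Notation V := 'cV[R]_d.

Definition multiset_family := 'I_n -> multiset R d.

Definition nonempty_family (X : multiset_family) : Prop :=
  exists i, underlying (X i) !=set0.

Variables (A : 'M[R]_d) (D : 'I_n -> 'I_n -> {fset V}).

Definition subdivision_matrix : 'M[R]_n := \matrix_(i, j) #|` D i j|%:R.

Definition inflation (X : multiset_family) : multiset_family :=
  fun i x => (\sum_j mset_add_digits (mset_image A (X j)) (D i j) x)%N.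

(* The digit multisets of the N-th iterate, as sequences listed with
   multiplicity: p = (i, j_(N-1), ..., j_1, j) in the formula
   \/_(j_1, ..., j_(N-1)) (D_(i j_(N-1)) + A D_(j_(N-1) j_(N-2)) + ...
                             + A^(N-1) D_(j_1 j)). *)
Definition iter_digits (N : nat) (i j : 'I_n) : seq V :=
  \big[cat/[::]]_(p : {ffun 'I_N.+1 -> 'I_n} |
                  (p ord0 == i) && (p ord_max == j))
   \big[(fun s t => [seq x + y | x <- s, y <- t])/[:: 0]]_(k < N)
     [seq A ^+ k *m x | x <- D (p (widen_ord (leqnSn N) k)) (p (lift ord0 k))].

(* The case N = 1 is the equation associated with the inflation itself; it is
   stated for an arbitrary matrix B and digit sets E to cover the iterates. *)
Definition multi_tile_equation (B : 'M[R]_d) (E : 'I_n -> 'I_n -> set V)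
    (T : 'I_n -> set V) : Prop :=
  forall i, [set B *m x | x in T i] = \bigcup_j minkowski (T j) (E j i).

Definition compact_solution (B : 'M[R]_d) (E : 'I_n -> 'I_n -> set V)
    (T : 'I_n -> set V) : Prop :=
  [/\ multi_tile_equation B E T, exists i, T i !=set0 &
      forall i, compact (T i)].

Definition unique_compact_solution (B : 'M[R]_d) (E : 'I_n -> 'I_n -> set V)
    (T : 'I_n -> set V) : Prop :=
  compact_solution B E T /\ forall T', compact_solution B E T' -> T' = T.

Definition digit_sets : 'I_n -> 'I_n -> set V := fun i j => [set` D i j].

Definition iter_digit_sets (N : nat) : 'I_n -> 'I_n -> set V :=
  fun i j => [set` iter_digits N i j].

Definition tiling (T : 'I_n -> set V) (X : multiset_family) : Prop :=
  (\bigcup_i \bigcup_(x in underlying (X i)) translate (T i) x = setT) /\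
  forall (i j : 'I_n) (x y : V),
    underlying (X i) x -> underlying (X j) y -> (i, x) <> (j, y) ->
    lebesgue_vol (translate (T i) x `&` translate (T j) y) = 0%E.

Definition self_replicating_multi_tiling (N : nat) (X : multiset_family)
    : Prop :=
  [/\ iter N inflation X = X,
      forall i, delone (X i) &
      exists T : 'I_n -> set V,
        [/\ unique_compact_solution (A ^+ N) (iter_digit_sets N) T,
            forall i, (0 < lebesgue_vol (T i))%E &
            tiling T X]].

End Inflation.

Arguments multiset_family : clear implicits.

(* Main.v *)
Require Import Defs.
From HB Require Import structures.
From mathcomp Require Import fingroup perm complex.
From mathcomp Require Import all_boot all_order all_algebra finmap.
From mathcomp Require Import all_classical all_reals all_analysis.
From mathcomp Require Import ring lra zify.

Set Implicit Arguments.
Unset Strict Implicit.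
Unset Printing Implicit Defensive.

Import Order.TTheory GRing.Theory Num.Theory.
Import numFieldNormedType.Exports.

Local Open Scope classical_set_scope.
Local Open Scope ring_scope.

(** Write q = |det A| and S for the subdivision matrix.  Perron-Frobenius
    theory provides positive left and right eigenvectors w and v of S for the
    eigenvalue q ([perron_eigenvectors]); expansion provides an adapted norm
    contracted by the inverse of A ([expanding_contracting_gauge]), hence a
    unique compact solution T ([compact_solution_exists]).

    Points of a multiset family are treated as tiles: a pair (i, x) stands for
    the set T_i + x.  The inflation acts on finite lists of tiles by a
    substitution [subst]; applied N times to one tile (j, x) it produces a
    list whose union is A^N (T_j + x) ([patch_iter_subst]) and whose weight
    with respect to w is q^N w_j ([weight_iter_subst]).

    From (i) to (iv): if a weakly uniformly discrete family X fixed by an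
    iterate of the inflation contains (j, x), it contains all the lists
    generated by that tile.  About q^N points without accumulation meet about
    q^N cells of a lattice; shrinking by A^-N gives sets of volume bounded
    below that converge to T_j + x, and the volume is upper semicontinuous on
    neighbourhoods of a compact set ([weakly_uniformly_discrete_vol_gt0]).

    From (iv) to (iii): the volumes mu of the tiles satisfy q mu <= mu S, and
    pairing with v turns this into an equality ([tile_volumes_eigen]).  Hence
    the tiles of a generated list overlap in null sets only; such lists are
    called packed.  A packing argument shows that the tiles have interior
    ([tiles_have_interior]): otherwise every union of boundedly many tiles
    would leave holes of a fixed size in all unit cells, which contradicts the
    fact that a thin neighbourhood of T_j has almost the volume of T_j.  A
    periodic point in the interior of T_j then yields a tile (j, x) that
    contains the origin in its interior and belongs to the list that it
    generates in N steps ([exists_seed]).  The increasing union of the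
    generated lists is a self-replicating multi-tiling, since A^(kN) (T_j + x)
    exhausts the space ([exists_self_replicating_multi_tiling]).

    The implications from (iii) to (ii) and from (ii) to (i) are immediate.

    Volumes are outer measures.  The linear change of variables
    ([lebesgue_vol_linear]) comes from a decomposition of matrices into shears,
    diagonal matrices and permutations; additivity comes from the criterion of
    Caratheodory, which half-spaces, hence compact sets, satisfy. *)

(** * Lebesgue outer measure *)
Section Volume.
Context {R : realType} {d : nat}.
Notation V := 'cV[R]_d.+1.
Notation vol := (@lebesgue_vol R d.+1).
Implicit Types (X Y : set V) (a b : V).

Definition box_vol (p : V * V) : R := \prod_i (p.2 i 0 - p.1 i 0).

Definition proper_box (p : V * V) : Prop := forall i, p.1 i 0 <= p.2 i 0.

Lemma box_vol_ge0 p : proper_box p -> 0 <= box_vol p.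
Proof. by move=> pp; apply: prodr_ge0 => i _; rewrite subr_ge0. Qed.

Lemma lebesgue_vol_ge0 X : (0 <= vol X)%E.
Proof.
apply: le_ereal_inf_tmp => _ [F [F1 _] <-].
by apply: nneseries_ge0 => k _ _; rewrite lee_fin; exact: (box_vol_ge0 (F1 k)).
Qed.

Lemma lebesgue_vol_le_cover X (F : nat -> V * V) :
  (forall k, proper_box (F k)) -> X `<=` \bigcup_k box (F k).1 (F k).2 ->
  (vol X <= \sum_(0 <= k <oo) (box_vol (F k))%:E)%E.
Proof. by move=> pF XF; apply: ereal_inf_lbound; exists F. Qed.

Lemma box_vol_diag a : box_vol (a, a) = 0.
Proof. by rewrite /box_vol big_ord_recl /= subrr mul0r. Qed.

(** Degenerate boxes have volume zero because the dimension is positive. *)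
Lemma lebesgue_vol0 : vol set0 = 0%E.
Proof.
apply/eqP; rewrite eq_le lebesgue_vol_ge0 andbT.
have pF (k : nat) : proper_box ((fun=> (0, 0)) k) by [].
apply: le_trans (lebesgue_vol_le_cover pF (@sub0set _ _)) _.
by rewrite eseries0// => k _ _; rewrite box_vol_diag.
Qed.

Lemma lebesgue_vol_cover_lt X (e : R) : 0 < e -> vol X \is a fin_num ->
  exists F : nat -> V * V, [/\ forall k, proper_box (F k),
    X `<=` \bigcup_k box (F k).1 (F k).2 &
    (\sum_(0 <= k <oo) (box_vol (F k))%:E < vol X + e%:E)%E].
Proof.
move=> e0 fX; have [_ [F [pF XF] <-] lt] := lb_ereal_inf_adherent e0 fX.
by exists F; split.
Qed.

(** Covers of the [F n] that are optimal up to [e / 2 ^ n.+1] are merged into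
    one along a bijection between pairs of indices and indices. *)
Lemma lebesgue_vol_subadditive X (F : (set V)^nat) :
  subset_sigma_subadditive vol X F.
Proof.
move=> XF; have [[i ioo]|] := pselect (exists i, vol (F i) = +oo%E).
  rewrite (eseries_pinfty _ _ ioo) ?leey// => n _.
  by rewrite -ltNye (lt_le_trans _ (lebesgue_vol_ge0 _)).
rewrite -forallNE => Aoo.
have finF n : vol (F n) \is a fin_num.
  by rewrite ge0_fin_numE ?lebesgue_vol_ge0// ltey; apply/eqP/Aoo.
apply/lee_addgt0Pr => e e0.
rewrite (le_trans _ (epsilon_trick _ _ (ltW e0)))//; last first.
  by move=> n; exact: lebesgue_vol_ge0.
pose P n (B : nat -> V * V) := [/\ forall k, proper_box (B k),
    F n `<=` \bigcup_k box (B k).1 (B k).2 &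
    (\sum_(0 <= k <oo) (box_vol (B k))%:E <= vol (F n) + (e / (2 ^ n.+1)%:R)%:E)%E].
have [G PG] : {G : nat -> nat -> V * V & forall n, P n (G n)}.
  apply: (@choice _ _ P) => n; rewrite /P.
  have en1 : 0 < e / (2 ^ n.+1)%:R by rewrite divr_gt0// ltr0n expn_gt0.
  have [B [B1 B2 B3]] := lebesgue_vol_cover_lt en1 (finF n).
  by exists B; split => //; exact: ltW.
pose g (ij : nat * nat) := (box_vol (G ij.1 ij.2))%:E.
have g_ge0 ij : (0 <= g ij)%E.
  by rewrite lee_fin; apply: box_vol_ge0; case: (PG ij.1).
apply: (@le_trans _ _ (\esum_(i in setT) g i)).
  have /card_esym/ppcard_eqP[f] := card_nat2.
  have := @lebesgue_vol_le_cover X (fun k => G (f k).1 (f k).2).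
  have -> : (\sum_(0 <= k <oo) (box_vol (G (f k).1 (f k).2))%:E =
             \esum_(i in setT) g i)%E.
    by rewrite -(esum_pred_image g f xpredT) ?[fun=> _]set_true// image_eq.
  apply; first by move=> k; case: (PG (f k).1).
  move=> t /XF [i _ Fit]; have [_ + _] := PG i.
  move=> /(_ _ Fit) [j _ ?]; exists (f^-1%FUN (i, j)) => //=.
  by rewrite invK ?inE.
rewrite (_ : esum _ _ = \sum_(0 <= i <oo) \sum_(0 <= j <oo) g (i, j))%E; last first.
  pose J : nat -> set (nat * nat) := fun i => [set (i, j) | j in setT].
  rewrite (_ : setT = \bigcup_k J k); last first.
    by rewrite predeqE => -[a b]; split => // _; exists a => //; exists b.
  rewrite esum_bigcupT /=; last 2 first.
    - apply/trivIsetP => i j _ _ ij.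
      rewrite predeqE => -[n m] /=; split => //= -[] [_] _ [<-{n} _].
      by move=> [m' _] [] /esym/eqP; rewrite (negbTE ij).
    - by move=> /= [n m].
  rewrite -(image_id [set: nat]) -fun_true esum_pred_image//; last first.
    by move=> n _; exact: esum_ge0.
  apply: eq_eseriesr => /= j _.
  rewrite -(esum_pred_image g (pair j) predT)//=; last first.
    by move=> ? ? _ _; exact: (@can_inj _ _ _ snd).
  by congr esum; rewrite predeqE => -[a b]; split; move=> [i _ <-]; exists i.
apply: lee_nneseries => [i _ _|i _]; first exact: nneseries_ge0.
by case: (PG i).
Qed.

HB.instance Definition _ := isSubsetOuterMeasure.Build R V (@lebesgue_vol R d.+1)
  lebesgue_vol0 lebesgue_vol_ge0 lebesgue_vol_subadditive.

End Volume.

(** * Volume of linear images *)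
Section LinearImage.
Context {R : realType} {d : nat}.
Notation V := 'cV[R]_d.+1.
Notation vol := (@lebesgue_vol R d.+1).
Implicit Types (X Y : set V) (a b : V) (A : 'M[R]_d.+1).

Lemma lebesgue_vol_box_le (p : V * V) : proper_box p ->
  (vol (box p.1 p.2) <= (box_vol p)%:E)%E.
Proof.
move=> pp; pose F (k : nat) : V * V := if k is 0%N return V * V then p else (0, 0).
have pF k : proper_box (F k) by rewrite /F; case: k => [|k]; [exact: pp | move=> i /=].
have := @lebesgue_vol_le_cover _ _ (box p.1 p.2) F pF.
have -> : (\sum_(0 <= k <oo) (box_vol (F k))%:E = (box_vol p)%:E)%E.
  rewrite nneseries_recl//; last by move=> k _; rewrite lee_fin box_vol_ge0.
  rewrite eseries_cond/= eseries0 ?adde0// => -[|]//= k _ _.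
  by rewrite box_vol_diag.
by move=> h; apply: h => x xp; exists 0%N.
Qed.

Lemma lebesgue_vol_bigU (I : Type) (s : seq I) (F : I -> set V) :
  (vol (\big[setU/set0]_(i <- s) F i) <= \sum_(i <- s) vol (F i))%E.
Proof.
elim: s => [|i s IH]; first by rewrite !big_nil outer_measure0.
rewrite !big_cons; apply: le_trans (outer_measureU2 _ _ _) _.
exact: leeD.
Qed.

(** The images of the boxes of a cover form a cover of the image, so that it is
    enough to look at boxes. *)
Lemma lebesgue_vol_image_le (f : V -> V) (c : R) : 0 < c ->
  (forall p, proper_box p ->
    (vol [set f x | x in box p.1 p.2] <= (c * box_vol p)%:E)%E) ->
  forall X, (vol [set f x | x in X] <= c%:E * vol X)%E.
Proof.
move=> c0 fc X; have [Xoo|/eqP Xfin] := eqVneq (vol X) +oo%E.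
  by rewrite Xoo gt0_muley ?lte_fin// leey.
have {}Xfin : vol X \is a fin_num.
  by rewrite ge0_fin_numE ?lebesgue_vol_ge0// ltey; exact/eqP.
apply/lee_addgt0Pr => e e0.
have ec0 : 0 < e / c by rewrite divr_gt0.
have [F [pF XF lt]] := lebesgue_vol_cover_lt ec0 Xfin.
apply: (@le_trans _ _ (c%:E * \sum_(0 <= k <oo) (box_vol (F k))%:E)%E).
  rewrite -nneseriesZl; last by move=> k _; rewrite lee_fin box_vol_ge0.
  apply: (@le_trans _ _ (\sum_(0 <= k <oo)
      vol [set f x | x in box (F k).1 (F k).2])%E).
    apply: lebesgue_vol_subadditive => _ [x /XF [k _ Fkx] <-].
    by exists k => //; exists x.
  apply: lee_nneseries => [k _ _|k _]; first exact: lebesgue_vol_ge0.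
  by rewrite -EFinM fc.
apply: (@le_trans _ _ (c%:E * (vol X + (e / c)%:E))%E).
  by apply: lee_wpmul2l; rewrite ?lee_fin ?ltW.
rewrite -(fineK Xfin) -EFinD -!EFinM -EFinD lee_fin mulrDr.
by rewrite [c * (e / c)]mulrC divfK// gt_eqF.
Qed.

(** The factor is kept positive so that factors multiply under composition even
    on sets of infinite volume. *)
Definition scales_vol (c : R) (f : V -> V) :=
  0 < c /\ forall X, (vol [set f x | x in X] <= c%:E * vol X)%E.

Lemma scales_vol_comp c e f g :
  scales_vol c f -> scales_vol e g -> scales_vol (c * e) (f \o g).
Proof.
move=> [c0 hf] [e0 hg]; split; first exact: mulr_gt0.
move=> X; rewrite -[X in vol X](image_comp g f).
by apply: le_trans (hf _) _; rewrite EFinM -muleA lee_wpmul2l// lee_fin ltW.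
Qed.

Lemma scales_volM c e A B : scales_vol c (mulmx A) ->
  scales_vol e (mulmx B) -> scales_vol (c * e) (mulmx (A *m B) : V -> V).
Proof.
move=> hA hB; have := scales_vol_comp hA hB.
by congr (scales_vol _ _); apply/funext => x /=; rewrite mulmxA.
Qed.

Lemma lebesgue_vol_sub_box_le X (p : V * V) (c : R) : proper_box p ->
  X `<=` box p.1 p.2 -> box_vol p <= c -> (vol X <= c%:E)%E.
Proof.
move=> pp Xp pc; apply: le_trans (le_outer_measure vol _ _ Xp) _.
by apply: le_trans (lebesgue_vol_box_le pp) _; rewrite lee_fin.
Qed.

Lemma scales_vol_translate v : scales_vol 1 (fun x : V => x + v).
Proof.
split => // X; apply: lebesgue_vol_image_le => // p pp.
apply: (@lebesgue_vol_sub_box_le _ (p.1 + v, p.2 + v)).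
- by move=> i; rewrite !mxE lerD2r.
- by move=> _ [x px <-] i; rewrite !mxE !lerD2r; exact: px.
rewrite mul1r /box_vol le_eqVlt; apply/orP; left; apply/eqP.
by apply: eq_bigr => i _; rewrite !mxE/=; ring.
Qed.

Lemma scales_vol_diag (r : 'rV[R]_d.+1) : (forall i, r 0 i != 0) ->
  scales_vol (\prod_i `|r 0 i|) (mulmx (diag_mx r) : V -> V).
Proof.
move=> r0; have c0 : 0 < \prod_i `|r 0 i|.
  by apply: prodr_gt0 => i _; rewrite normr_gt0.
split => // X; apply: lebesgue_vol_image_le => // p pp.
pose lo : V := \col_i Num.min (r 0 i * p.1 i 0) (r 0 i * p.2 i 0).
pose hi : V := \col_i Num.max (r 0 i * p.1 i 0) (r 0 i * p.2 i 0).
apply: (@lebesgue_vol_sub_box_le _ (lo, hi)).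
- by move=> i; rewrite !mxE ge_min !le_max lexx.
- move=> _ [x px <-] i; rewrite mul_diag_mx !mxE /= ge_min le_max.
  have /andP[l u] := px i.
  have [ri|ri] := leP 0 (r 0 i).
    by apply/andP; split; apply/orP; [left|right]; rewrite ler_wpM2l.
  by apply/andP; split; apply/orP; [right|left]; rewrite ler_wnM2l// ltW.
rewrite /box_vol -big_split/= ler_prod// => i _; rewrite !mxE/=.
have := pp i; have [ri|ri] := leP 0 (r 0 i) => ab.
  rewrite max_r ?min_l ?ler_wpM2l// -mulrBr ger0_norm// lexx andbT.
  by rewrite mulr_ge0// subr_ge0.
rewrite max_l ?min_r ?ler_wnM2l ?(ltW ri)// -mulrBr ltr0_norm// mulNr -mulrN opprB.
by rewrite lexx andbT mulr_le0 ?subr_le0// ltW.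
Qed.

Lemma scales_vol_perm s : scales_vol 1 (mulmx (perm_mx s) : V -> V).
Proof.
split => // X; apply: lebesgue_vol_image_le => // p pp.
have E (x : V) i : (perm_mx s *m x) i 0 = x (s i) 0.
  by rewrite -row_permE mxE.
apply: (@lebesgue_vol_sub_box_le _ (perm_mx s *m p.1, perm_mx s *m p.2)).
- by move=> i; rewrite !E.
- by move=> _ [x px <-] i; rewrite !E; exact: px.
rewrite mul1r /box_vol [leRHS](reindex_inj (@perm_inj _ s))/=.
by under eq_bigr do rewrite !E.
Qed.

Lemma unit_grid_cell (M : nat) (y : R) : 0 <= y <= M.+1%:R ->
  exists2 p, (p < M.+1)%N & p%:R <= y <= p.+1%:R.
Proof.
elim: M => [|M IH] /andP[y0 yM]; first by exists 0%N => //; rewrite y0.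
have [yM'|/ltW yM'] := leP y M.+1%:R; last by exists M.+1 => //; rewrite yM'.
by have [|p pM py] := IH; [rewrite y0 | exists p => //; exact: ltnW].
Qed.

Definition shear (k j : 'I_d.+1) (t : R) : 'M[R]_d.+1 := 1%:M + t *: delta_mx k j.

Lemma shearE k j t (x : V) i :
  (shear k j t *m x) i 0 = x i 0 + (i == k)%:R * (t * x j 0).
Proof.
rewrite mulmxDl mul1mx -scalemxAl 2!mxE; congr (_ + _).
rewrite mxE (bigD1 j)//= big1 ?addr0; last first.
  by move=> l lj; rewrite mxE (negbTE lj) andbF mul0r.
by rewrite mxE eqxx andbT; ring.
Qed.

(** The sheared box is cut into slabs orthogonal to the j-th axis; along the
    k-th axis a slab of width w sticks out of a box by at most a multiple of
    w, so that the excess volume vanishes as the slabs get thinner. *)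
Lemma scales_vol_shear k j t : k != j -> scales_vol 1 (mulmx (shear k j t) : V -> V).
Proof.
move=> kj; split => // X; apply: lebesgue_vol_image_le => // p pp; rewrite mul1r.
pose s i := p.2 i 0 - p.1 i 0.
have s0 i : 0 <= s i by rewrite subr_ge0.
(* [C / M] is the excess volume of the boxes around M sheared slabs. *)
pose C := 2 * `|t| * s j * s j * \prod_(i | (i != j) && (i != k)) s i.
have C0 : 0 <= C by rewrite !mulr_ge0// prodr_ge0.
have bvE : box_vol p = s j * (s k * \prod_(i | (i != j) && (i != k)) s i).
  by rewrite /box_vol (bigD1 j)//= (bigD1 k)// kj.
suff H (M : nat) :
    (vol [set shear k j t *m x | x in box p.1 p.2] <= (box_vol p + C / M.+1%:R)%:E)%E.
  apply/lee_addgt0Pr => e e0; have [M CM] : exists M : nat, C / e < M%:R.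
    by exists (Num.truncn (C / e)).+1; rewrite truncnS_gt.
  apply: le_trans (H M) _; rewrite -EFinD lee_fin lerD2l.
  rewrite ler_pdivrMr ?ltr0n// mulrC -ler_pdivrMr//.
  by apply: ltW; apply: lt_trans CM _; rewrite ltr_nat.
have M0 : 0 < M.+1%:R :> R by rewrite ltr0n.
pose w := s j / M.+1%:R.
have w0 : 0 <= w by rewrite divr_ge0// ltW.
pose c (q : nat) := p.1 j 0 + q%:R * w.
(* The q-th slab is [c q, c q + w] along the j-th axis; its image is shifted
   by [t * c q] along the k-th axis, up to an error of [`|t| * w]. *)
pose lo (q : nat) : V := \col_i
  if i == j then c q else if i == k then p.1 k 0 + t * c q - `|t| * w else p.1 i 0.
pose hi (q : nat) : V := \col_i
  if i == j then c q + w else if i == k then p.2 k 0 + t * c q + `|t| * w else p.2 i 0.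
have sk q : box_vol (lo q, hi q) = (box_vol p + C / M.+1%:R) / M.+1%:R.
  rewrite [LHS](bigD1 j)//= (bigD1 k)//= !mxE eqxx (negbTE kj) eqxx.
  rewrite (eq_bigr s); last first.
    by move=> i /andP[/negbTE ij /negbTE ik]; rewrite !mxE ij ik.
  rewrite bvE /C; set Q := \prod_(i | _) _; rewrite /w /s.
  by move: M0; move: (M.+1%:R : R) => m M0; field; rewrite gt_eqF.
have sub : [set shear k j t *m x | x in box p.1 p.2] `<=`
    \big[setU/set0]_(q <- iota 0 M.+1) box (lo q) (hi q).
  move=> _ [x px <-].
  have [q qM xq] : exists2 q, (q < M.+1)%N & c q <= x j 0 <= c q + w.
    have /andP[l u] := px j.
    have [sj0|sj0] := eqVneq (s j) 0.
      exists 0%N => //; rewrite /c /w sj0 ?(mul0r, mulr0, addr0); move: sj0; rewrite /s => sj0.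
      by apply/andP; split; lra.
    have sjp : 0 < s j by rewrite lt_def sj0 s0.
    have wp : 0 < w by rewrite divr_gt0.
    have [|q qM /andP[ql qu]] := @unit_grid_cell M ((x j 0 - p.1 j 0) / w).
      apply/andP; split; first by rewrite divr_ge0 ?subr_ge0// ltW.
      rewrite ler_pdivrMr// /w mulrCA divff ?gt_eqF// mulr1.
      by rewrite lerD2r.
    exists q => //; rewrite /c.
    rewrite ler_pdivlMr// in ql; rewrite ler_pdivrMr// -natr1 in qu.
    by apply/andP; split; lra.
  have qi : q \in iota 0 M.+1 by rewrite mem_iota.
  rewrite -bigcup_seq; exists q; first exact: qi.
  move=> i; rewrite shearE !mxE; have /andP[l u] := px i.
  have [->|ij] := eqVneq i j; first by rewrite eq_sym (negbTE kj) mul0r addr0.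
  have [ik|ik] := eqVneq i k; last by rewrite mul0r addr0 l.
  rewrite ik mul1r in l u *.
  have tb : `|t * (x j 0 - c q)| <= `|t| * w.
    rewrite normrM ler_wpM2l//; have /andP[? ?] := xq.
    by rewrite ger0_norm; lra.
  by move: tb; rewrite ler_norml => /andP[? ?]; apply/andP; split; lra.
apply: le_trans (le_outer_measure vol _ _ sub) _.
apply: le_trans (lebesgue_vol_bigU _ _) _.
apply: (@le_trans _ _ (\sum_(q <- iota 0 M.+1)
    ((box_vol p + C / M.+1%:R) / M.+1%:R)%:E)%E).
  apply: lee_sum => q _; rewrite -(sk q); apply: (@lebesgue_vol_box_le (lo q, hi q)) => i.
  rewrite !mxE; case: ifP => _; first by rewrite lerDl.
  case: ifP => _ //; have := pp k.
  have : 0 <= `|t| * w by rewrite mulr_ge0.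
  by rewrite /=; lra.
rewrite sumEFin lee_fin big_const_seq count_predT size_iota iter_addr_0.
by rewrite -[leLHS]mulr_natr divfK ?pnatr_eq0.
Qed.

Lemma scales_vol_row_operation k (r : 'I_d.+1 -> R) (s : seq 'I_d.+1) :
  k \notin s ->
  scales_vol 1 (mulmx (1%:M + \sum_(l <- s) r l *: delta_mx k l) : V -> V).
Proof.
elim: s => [_|j s IH].
  rewrite big_nil addr0 (_ : mulmx _ = id); last first.
    by apply/funext => x; rewrite mul1mx.
  by split => // X; rewrite image_id mul1e.
rewrite inE negb_or => /andP[kj ks].
have := scales_volM (scales_vol_shear (r j) kj) (IH ks).
rewrite mulr1; congr (scales_vol _ (mulmx _)); rewrite /shear mulmxDl mul1mx mulmxDr mulmx1.
rewrite mulmx_sumr [X in _ + (_ + X)]big1; last first.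
  move=> l _; rewrite -scalemxAl -scalemxAr mul_delta_mx_cond eq_sym (negbTE kj).
  by rewrite mulr0n !scaler0.
by rewrite addr0 big_cons -!addrA; congr (_ + _); rewrite addrC.
Qed.

(** A unipotent triangular matrix is a product of row operations, one for
    each row; [s] lists the rows in the order in which they are applied. *)
Lemma scales_vol_unipotent_rows A (s : seq 'I_d.+1) :
  (forall k, A k k = 1) -> pairwise (fun k l => A k l == 0) s -> uniq s ->
  scales_vol 1 (mulmx (\matrix_(i, j)
    if i \in s then A i j else (i == j)%:R) : V -> V).
Proof.
move=> A1; elim: s => [_ _|k s IH].
  rewrite (_ : mulmx _ = id); last first.
    by apply/funext => x; rewrite -[RHS]mul1mx; congr (_ *m _); apply/matrixP => i j; rewrite !mxE.
  by split => // X; rewrite image_id mul1e.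
rewrite /= => /andP[/allP ks ps] /andP[kns us].
have kn : k \notin [seq l <- enum 'I_d.+1 | l != k] by rewrite mem_filter eqxx.
have := scales_volM (scales_vol_row_operation (A k) kn) (IH ps us).
rewrite mulr1; congr (scales_vol _ (mulmx _)); apply/matrixP => i j.
rewrite mulmxDl mul1mx mulmx_suml big_filter big_enum_cond/= !mxE summxE.
under eq_bigr => l lk do rewrite -scalemxAl !mxE.
under eq_bigr => l lk.
  rewrite (bigD1 l)//= big1 ?addr0; last first.
    by move=> m ml; rewrite !mxE (negbTE ml) andbF mul0r.
  rewrite !mxE eqxx andbT.
  over.
rewrite inE; have [->|ik] := eqVneq i k; last first.
  by rewrite big1 ?addr0// => l _; rewrite mul0r mulr0.
rewrite (negbTE kns)/=; under eq_bigr do rewrite mul1r.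
rewrite [RHS](_ : _ = \sum_l A k l * (l == j)%:R); last first.
  rewrite (bigD1 j)//= eqxx mulr1 big1 ?addr0// => l lj.
  by rewrite (negbTE lj) mulr0.
rewrite [RHS](bigD1 k)//= A1 mul1r; congr (_ + _); apply: eq_bigr => l lk.
by case: ifPn => // /ks /eqP ->; rewrite !mul0r.
Qed.

Lemma scales_vol_unipotent A (s : seq 'I_d.+1) : (forall k, A k k = 1) ->
  pairwise (fun k l => A k l == 0) s -> uniq s -> (forall k, k \in s) ->
  scales_vol 1 (mulmx A : V -> V).
Proof.
move=> A1 ps us sP; have := scales_vol_unipotent_rows A1 ps us.
by congr (scales_vol _ (mulmx _)); apply/matrixP => i j; rewrite mxE sP.
Qed.

Lemma enum_ord_sorted : sorted (fun i j : 'I_d.+1 => (i < j)%N) (enum 'I_d.+1).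
Proof. by have := iota_ltn_sorted 0 d.+1; rewrite -val_enum_ord sorted_map. Qed.

(** In the LUP decomposition the permutation and the unipotent factors preserve
    volumes; the determinant comes from the diagonal of the upper factor. *)
Lemma scales_vol_unitmx A : A \in unitmx -> scales_vol `|\det A| (mulmx A : V -> V).
Proof.
move=> uA; have := cormen_lup_correct A; have := cormen_lup_perm A.
have := cormen_lup_detL A; have := cormen_lup_lower A; have := cormen_lup_upper A.
case: (cormen_lup A) => -[P L] U /= hU hL dL /is_perm_mxP[s ->] PA.
have {}PA : perm_mx s *m A = L *m U := PA.
have AE : A = perm_mx s^-1 *m (L *m U).
  by rewrite -PA mulmxA -perm_mxM mulVg perm_mx1 mul1mx.
have dU : \det U = \prod_i U i i.
  rewrite -det_tr det_trig; first by apply: eq_bigr => i _; rewrite mxE.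
  by apply/is_trig_mxP => i j ij; rewrite mxE hU.
have dA : `|\det A| = \prod_i `|U i i|.
  by rewrite AE !det_mulmx det_perm dL mul1r normrM normr_sign mul1r dU normr_prod.
have U0 i : U i i != 0.
  move: uA; rewrite unitmxE unitfE -normr_eq0 dA => /prodf_neq0/(_ i isT).
  by rewrite normr_eq0.
pose D : 'rV[R]_d.+1 := \row_i U i i.
pose U' := \matrix_(i, j) (U i j / U i i).
have UE : U = diag_mx D *m U'.
  by apply/matrixP => i j; rewrite mul_diag_mx !mxE mulrC divfK.
have hD : scales_vol (\prod_i `|U i i|) (mulmx (diag_mx D) : V -> V).
  have := @scales_vol_diag D; rewrite (eq_bigr (fun i => `|U i i|)); last first.
    by move=> i _; rewrite mxE.
  by apply => i; rewrite mxE.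
have hL' : scales_vol 1 (mulmx L : V -> V).
  apply: (@scales_vol_unipotent _ (enum 'I_d.+1)).
  - by move=> k; rewrite hL ?eqxx.
  - have := enum_ord_sorted; rewrite sorted_pairwise; last first.
      by move=> j i k; exact: ltn_trans.
    apply: sub_pairwise => i j ij.
    by rewrite hL ?(ltnW ij)// -val_eqE/= ltn_eqF.
  - exact: enum_uniq.
  - by move=> k; rewrite mem_enum.
have hU' : scales_vol 1 (mulmx U' : V -> V).
  apply: (@scales_vol_unipotent _ (rev (enum 'I_d.+1))).
  - by move=> k; rewrite mxE divff.
  - have := enum_ord_sorted; rewrite -[X in sorted _ X]revK rev_sorted sorted_pairwise; last first.
      by move=> j i k /= ij jk; exact: ltn_trans jk ij.
    apply: sub_pairwise => i j ij.
    by rewrite mxE hU// mul0r.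
  - by rewrite rev_uniq enum_uniq.
  - by move=> k; rewrite mem_rev mem_enum.
have := scales_volM (scales_vol_perm s^-1) (scales_volM hL' (scales_volM hD hU')).
by rewrite !mul1r mulr1 -dA -UE -AE.
Qed.

(** Both inequalities come from [scales_vol_unitmx], for [A] and its inverse. *)
Theorem lebesgue_vol_linear A X : A \in unitmx ->
  vol [set A *m x | x in X] = (`|\det A|%:E * vol X)%E.
Proof.
move=> uA; have [d0 hA] := scales_vol_unitmx uA.
apply/eqP; rewrite eq_le hA/=.
have [_ hV] : scales_vol `|\det (invmx A)| (mulmx (invmx A) : V -> V).
  by apply: scales_vol_unitmx; rewrite unitmx_inv.
have := hV [set A *m x | x in X].
rewrite (_ : [set _ | _ in _] = X); last first.
  rewrite image_comp -[RHS]image_id; apply: eq_imagel => x _ /=.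
  by rewrite mulKmx.
rewrite det_inv normfV => h.
apply: (@le_trans _ _ (`|\det A|%:E * (`|\det A|^-1%:E *
    vol [set A *m x | x in X]))%E).
  by apply: lee_wpmul2l => //; rewrite lee_fin ltW.
by rewrite muleA -EFinM divff ?gt_eqF// mul1e.
Qed.

Lemma lebesgue_vol_translate X v : vol (translate X v) = vol X.
Proof.
apply/eqP; rewrite eq_le; apply/andP; split.
  by have [_ /(_ X)] := scales_vol_translate v; rewrite mul1e.
have [_ /(_ (translate X v))] := scales_vol_translate (- v).
rewrite mul1e (_ : [set _ | _ in _] = X)// image_comp -[RHS]image_id.
by apply: eq_imagel => x _ /=; rewrite addrK.
Qed.

End LinearImage.

(** * The sup norm on column vectors *)
Section SupNorm.
Context {R : realType}.

Lemma coord_le_norm m n (x : 'M[R]_(m, n)) i j : `|x i j| <= `|x|.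
Proof.
rewrite [leRHS]/Num.norm /= mx_normrE.
by apply/bigmax_geP; right => /=; exists (i, j).
Qed.

Lemma norm_le_coord m n (x : 'M[R]_(m, n)) (r : R) : 0 <= r ->
  (forall i j, `|x i j| <= r) -> `|x| <= r.
Proof.
move=> r0 xr; rewrite [leLHS]/Num.norm /= mx_normrE.
by apply/bigmax_leP; split => // -[i j] _; exact: xr.
Qed.

Definition entry_sum m n (A : 'M[R]_(m, n)) : R := \sum_i \sum_j `|A i j|.

Lemma entry_sum_ge0 m n (A : 'M[R]_(m, n)) : 0 <= entry_sum A.
Proof. by apply: sumr_ge0 => i _; apply: sumr_ge0. Qed.

Lemma det_exprmx n (A : 'M[R]_n) k : \det (A ^+ k) = \det A ^+ k.
Proof. by elim: k => [|k IH]; rewrite ?det1// !exprS [LHS]det_mulmx IH. Qed.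

Lemma norm_mulmx_le m n p (A : 'M[R]_(m, n)) (x : 'M[R]_(n, p)) :
  `|A *m x| <= entry_sum A * `|x|.
Proof.
apply: norm_le_coord => [|i k]; first by rewrite mulr_ge0// entry_sum_ge0.
rewrite mxE; apply: le_trans (ler_norm_sum _ _ _) _.
apply: (@le_trans _ _ (\sum_j `|A i j| * `|x|)).
  by apply: ler_sum => j _; rewrite normrM ler_wpM2l// coord_le_norm.
rewrite -mulr_suml ler_wpM2r// /entry_sum (bigD1 i)//= lerDl.
by apply: sumr_ge0 => l _; apply: sumr_ge0.
Qed.

Lemma lipschitz_continuous (U W : normedModType R) (f : U -> W) (C : R) :
  (forall x y, `|f x - f y| <= C * `|x - y|) -> continuous f.
Proof.
move=> h x; apply/cvgrPdist_lt => e e0.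
have C0 : 0 < `|C| + 1 by rewrite ltr_wpDl.
near=> y; apply: le_lt_trans (h _ _) _.
apply: (@le_lt_trans _ _ ((`|C| + 1) * `|x - y|)).
  by rewrite ler_wpM2r// ler_wpDr// ler_norm.
rewrite mulrC -ltr_pdivlMr//; near: y.
by apply: (@cvgr_dist_lt _ _ _ (nbhs x) _ id) => //; rewrite divr_gt0.
Unshelve. all: by end_near. Qed.

Lemma mulmx_continuous m n p (A : 'M[R]_(m, n)) :
  continuous (mulmx A : 'M[R]_(n, p) -> 'M[R]_(m, p)).
Proof.
apply: (@lipschitz_continuous _ _ _ (entry_sum A)) => x y.
by rewrite -mulmxBr norm_mulmx_le.
Qed.

Lemma trmx_continuous m n : continuous (trmx : 'M[R]_(m, n) -> 'M[R]_(n, m)).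
Proof.
apply: (@lipschitz_continuous _ _ _ 1) => x y; rewrite mul1r -linearB/=.
by apply: norm_le_coord => // i j; rewrite mxE coord_le_norm.
Qed.

Lemma cV_bounded_closed_compact n (X : set 'cV[R]_n) (r : R) :
  (forall x, X x -> `|x| <= r) -> closed X -> compact X.
Proof.
move=> Xr cX; have -> : X = trmx @` (trmx @^-1` X).
  apply/seteqP; split => [x Xx|_ [y Xy <-]//].
  by exists x^T; rewrite /= trmxK.
apply: continuous_compact; first by apply: continuous_subspaceT; exact: trmx_continuous.
apply: bounded_closed_compact; last first.
  by apply: closed_comp cX => x _; exact: trmx_continuous.
exists r; split; first exact: num_real.
move=> s rs x /= /Xr xr; apply: le_trans (ltW rs); apply: le_trans xr.
apply: norm_le_coord => // i j.
have -> : x i j = x^T j i by rewrite mxE.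
exact: coord_le_norm.
Qed.

Lemma compact_norm_bounded n (X : set 'cV[R]_n) : compact X ->
  exists2 r, 0 < r & forall x, X x -> `|x| <= r.
Proof.
move=> /compact_bounded [M [_ h]]; exists (`|M| + 1); first by rewrite ltr_wpDl.
by apply: h; rewrite (le_lt_trans (ler_norm M))// ltrDl.
Qed.

Lemma closed_approx n (X : set 'cV[R]_n) x : closed X ->
  (forall e, 0 < e -> exists2 y, X y & `|x - y| < e) -> X x.
Proof.
move=> cX h; apply: cX => B /nbhs_ballP[e /= e0 eB].
have [y Xy xy] := h _ e0; exists y; split => //; apply: eB.
by rewrite -ball_normE.
Qed.

Lemma box_compact n (a b : 'cV[R]_n) : compact (box a b).
Proof.
have e0 : 0 <= entry_sum a + entry_sum b by rewrite addr_ge0// entry_sum_ge0.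
have ent (c : 'cV[R]_n) i : `|c i 0| <= entry_sum c.
  rewrite /entry_sum (bigD1 i)//= big_ord1 lerDl.
  by apply: sumr_ge0 => l _; apply: sumr_ge0.
apply: (@cV_bounded_closed_compact _ _ (entry_sum a + entry_sum b)) => [x xab|].
  apply: norm_le_coord => // i j; rewrite (ord1 j).
  have := xab i; have := ent a i; have := ent b i.
  have := entry_sum_ge0 a; have := entry_sum_ge0 b.
  by rewrite !ler_norml => ? ? /andP[? ?] /andP[? ?] /andP[? ?]; apply/andP; split; lra.
have -> : box a b = \bigcap_i ((fun x : 'cV[R]_n => x i 0) @^-1` `[a i 0, b i 0]).
  apply/seteqP; split => x h i; first by move=> _; rewrite /= in_itv/= h.
  by have := h i I; rewrite /= in_itv.
apply: closed_bigI => i _; apply: closed_comp; last exact: itv_closed.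
by move=> x _; exact: coord_continuous.
Qed.

End SupNorm.

(** * Caratheodory measurability and lattice cells *)
Section Measurability.
Context {R : realType} {d : nat}.
Notation V := 'cV[R]_d.+1.
Notation vol := (@lebesgue_vol R d.+1).
Implicit Types (X Y H : set V) (a b x : V).

(** Each box of a cover is cut in two along the hyperplane, at no cost in
    volume since the two pieces are boxes sharing a face. *)
Lemma halfspace_caratheodory i (c : R) H :
  [set x : V | x i 0 < c] `<=` H -> H `<=` [set x : V | x i 0 <= c] ->
  vol.-caratheodory H.
Proof.
move=> cH Hc; apply: le_caratheodory_measurable => X.
change (vol (X `&` H) + vol (X `&` ~` H) <= vol X)%E.
have [->|/eqP Xfin] := eqVneq (vol X) +oo%E; first by rewrite leey.
have {}Xfin : vol X \is a fin_num.
  by rewrite ge0_fin_numE ?lebesgue_vol_ge0// ltey; exact/eqP.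
apply/lee_addgt0Pr => e e0; have [F [pF XF lt]] := lebesgue_vol_cover_lt e0 Xfin.
apply: le_trans (ltW lt).
pose cl k := Num.max ((F k).1 i 0) (Num.min ((F k).2 i 0) c).
pose F1 k : V * V := ((F k).1, \col_j if j == i then cl k else (F k).2 j 0).
pose F2 k : V * V := (\col_j if j == i then cl k else (F k).1 j 0, (F k).2).
have acl k : (F k).1 i 0 <= cl k by rewrite le_max lexx.
have clb k : cl k <= (F k).2 i 0.
  by rewrite ge_max (pF k i)/= ge_min lexx.
have pF1 k : proper_box (F1 k).
  by move=> j; rewrite !mxE; case: eqP => [->|_]; [exact: acl | exact: pF].
have pF2 k : proper_box (F2 k).
  by move=> j; rewrite !mxE; case: eqP => [->|_]; [exact: clb | exact: pF].
have FE k : box_vol (F k) = box_vol (F1 k) + box_vol (F2 k).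
  rewrite /box_vol !(bigD1 i (P := xpredT))//= !mxE eqxx.
  under [X in _ = _ * X + _]eq_bigr => j /negbTE ji do rewrite mxE ji.
  under [X in _ = _ + _ * X]eq_bigr => j /negbTE ji do rewrite mxE ji.
  by rewrite -mulrDl; congr (_ * _); ring.
under eq_eseriesr do rewrite FE EFinD.
rewrite nneseriesD; [|by move=> k _ _; rewrite lee_fin box_vol_ge0..].
apply: leeD; apply: lebesgue_vol_le_cover => // x [/XF [k _ xk] Hx]; exists k => //.
  move=> j; have /andP[l u] := xk j; rewrite !mxE l/=; case: eqP => // ji.
  have {}Hx : x i 0 <= c by exact: Hc.
  by rewrite ji in l u *; rewrite le_max le_min u Hx orbT.
move=> j; have /andP[l u] := xk j; rewrite !mxE u andbT; case: eqP => // ji.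
have {}Hx : c <= x i 0 by rewrite leNgt; apply/negP => xc; apply: Hx; exact: cH.
by rewrite ji in l u *; rewrite ge_max l ge_min Hx orbT.
Qed.

(** Half-open, so that the cells of a given mesh partition the space. *)
Definition cell (s : R) (z : 'cV[int]_d.+1) : set V :=
  [set x | forall i, s * (z i 0)%:~R <= x i 0 < s * (z i 0 + 1)%:~R].

Definition cell_index (s : R) (x : V) : 'cV[int]_d.+1 :=
  \col_i Num.floor (x i 0 / s).

Lemma cellP s z x : 0 < s -> cell s z x <-> z = cell_index s x.
Proof.
move=> s0; have E i : (s * (z i 0)%:~R <= x i 0 < s * (z i 0 + 1)%:~R) =
    (Num.floor (x i 0 / s) == z i 0).
  by rewrite floor_eq ler_pdivlMr// ltr_pdivrMr// ![s * _]mulrC.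
split=> [h|zE i]; last by rewrite E zE mxE.
by apply/colP => i; rewrite mxE; apply/esym/eqP; rewrite -E h.
Qed.

Lemma cell_diam s z x y : 0 < s -> cell s z x -> cell s z y -> `|x - y| <= s.
Proof.
move=> s0 hx hy; apply: norm_le_coord => [|i j]; first exact: ltW.
rewrite !mxE (ord1 j); have := hx i; have := hy i.
rewrite intrD mulrDr mulr1 => /andP[? ?] /andP[? ?].
by rewrite ler_norml; apply/andP; split; lra.
Qed.

Lemma caratheodory_bigI (I : Type) (s : seq I) (F : I -> set V) :
  (forall i, vol.-caratheodory (F i)) ->
  vol.-caratheodory (\big[setI/setT]_(i <- s) F i).
Proof.
move=> mF; elim/big_ind : _ => //; last exact: caratheodory_measurable_setI.
by rewrite -setC0; apply: caratheodory_measurable_setC; exact: caratheodory_measurable_set0.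
Qed.

Lemma caratheodory_bigU (I : Type) (s : seq I) (F : I -> set V) :
  (forall i, vol.-caratheodory (F i)) ->
  vol.-caratheodory (\big[setU/set0]_(i <- s) F i).
Proof.
move=> mF; elim/big_ind : _ => //; last exact: caratheodory_measurable_setU.
exact: caratheodory_measurable_set0.
Qed.

Lemma cell_caratheodory s z : vol.-caratheodory (cell s z).
Proof.
have -> : cell s z = \big[setI/setT]_(i <- enum 'I_d.+1)
    ((~` [set x : V | x i 0 < s * (z i 0)%:~R]) `&`
     [set x : V | x i 0 < s * (z i 0 + 1)%:~R]).
  rewrite -bigcap_seq; apply/seteqP; split => x h i.
    by move=> _; have /andP[l u] := h i; split => //=; apply/negP; rewrite -leNgt.
  have [|l u] := h i; first by rewrite /= mem_enum.
  by rewrite leNgt; apply/andP; split => //; exact/negP.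
apply: caratheodory_bigI => i; apply: caratheodory_measurable_setI.
  apply: caratheodory_measurable_setC; apply: (@halfspace_caratheodory i (s * (z i 0)%:~R)) => // x.
  by move=> /= /ltW.
by apply: (@halfspace_caratheodory i (s * (z i 0 + 1)%:~R)) => // x /= /ltW.
Qed.

(** A closed set is the intersection over m of the union of the cells of mesh
    1/m that meet it. *)
Lemma closed_caratheodory X : closed X -> vol.-caratheodory X.
Proof.
move=> cX.
pose G (m n : nat) : set V := if choice.unpickle n is Some z then
  (if `[< X `&` cell m.+1%:R^-1 z !=set0 >] then cell m.+1%:R^-1 z else set0)
  else set0.
have mG m n : vol.-caratheodory (G m n).
  rewrite /G; case: choice.unpickle => [z|]; last exact: caratheodory_measurable_set0.
  case: ifP => _; first exact: cell_caratheodory.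
  exact: caratheodory_measurable_set0.
have -> : X = ~` (\bigcup_m ~` \bigcup_n G m n).
  rewrite setC_bigcup; apply/seteqP; split => x.
    move=> Xx m _; rewrite setCK; exists (choice.pickle (cell_index m.+1%:R^-1 x)) => //.
    have xc : cell m.+1%:R^-1 (cell_index m.+1%:R^-1 x) x.
      by apply/cellP => //; rewrite invr_gt0 ltr0n.
    rewrite /G choice.pickleK; case: asboolP => // -[]; by exists x.
  move=> h; apply: closed_approx => // e e0.
  have [m me] : exists m : nat, e^-1 < m.+1%:R.
    by exists (Num.truncn e^-1); rewrite truncnS_gt.
  have := h m I; rewrite setCK => -[n _]; rewrite /G; case: choice.unpickle => // z.
  case: asboolP => // -[y [Xy yz]] xz; exists y => //.
  apply: le_lt_trans (cell_diam _ xz yz) _; rewrite ?invr_gt0 ?ltr0n//.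
  by rewrite invf_plt ?posrE ?ltr0n.
apply: caratheodory_measurable_setC; apply: caratheodory_measurable_bigcup => m.
by apply: caratheodory_measurable_setC; exact: caratheodory_measurable_bigcup.
Qed.

Lemma compact_caratheodory X : compact X -> vol.-caratheodory X.
Proof. by move=> cX; apply: closed_caratheodory; exact: compact_closed. Qed.

Lemma cells_additive s (Z : seq 'cV[int]_d.+1) X : 0 < s -> uniq Z ->
  vol (X `&` \big[setU/set0]_(z <- Z) cell s z) =
  (\sum_(z <- Z) vol (X `&` cell s z))%E.
Proof.
move=> s0; elim: Z => [_|z Z IH /= /andP[zZ uZ]].
  by rewrite !big_nil setI0 outer_measure0.
have dj : [disjoint cell s z & \big[setU/set0]_(w <- Z) cell s w].
  rewrite -bigcup_seq; apply/eqP; rewrite -subset0 => x [/(cellP _ _ s0) zx [w wZ]].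
  by move=> /(cellP _ _ s0) wx; move: zZ; rewrite zx -wx (wZ : w \in Z).
have mU : vol.-caratheodory (\big[setU/set0]_(w <- Z) cell s w).
  by apply: caratheodory_bigU => w; exact: cell_caratheodory.
rewrite !big_cons (disjoint_caratheodoryIU (cell_caratheodory s z) mU _ dj).
by congr (_ + _)%E; exact: IH.
Qed.

Definition unit_cell_vol := vol (cell 1 0).

(** A cell is a translate of a dilation of the unit cell. *)
Lemma cell_vol s z : 0 < s -> vol (cell s z) = ((s ^+ d.+1)%:E * unit_cell_vol)%E.
Proof.
move=> s0; have su : (s%:M : 'M[R]_d.+1) \in unitmx.
  by rewrite unitmxE det_scalar unitfE expf_neq0// gt_eqF.
have := lebesgue_vol_linear (cell 1 0) su.
rewrite det_scalar ger0_norm ?exprn_ge0 ?(ltW s0)// => <-.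
pose v : V := \col_i (s * (z i 0)%:~R).
rewrite -[RHS](lebesgue_vol_translate _ v); congr (vol _).
apply/seteqP; split => x h.
  have shc : s%:M *m (s^-1 *: (x - v)) = x - v.
    by rewrite mul_scalar_mx scalerA divff ?gt_eqF// scale1r.
  exists (x - v); last by rewrite subrK.
  exists (s^-1 *: (x - v)); last exact: shc.
  move=> i; rewrite !mxE mulr0 add0r mul1r.
  have := h i; rewrite intrD mulrDr mulr1 => /andP[l u].
  by rewrite mulr_ge0 ?invr_ge0 ?subr_ge0 ?(ltW s0)//= mulrC ltr_pdivrMr// mul1r ltrBlDl.
move: h => [_ [y yc <-] <-] i; rewrite mul_scalar_mx !mxE.
have := yc i; rewrite !mxE add0r mulr0 mulr1 => /andP[l u].
rewrite intrD mulrDr lerDr mulr_ge0 ?(ltW s0)//= addrC ltrD2l.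
by rewrite mulr1 -[ltRHS]mulr1 ltr_pM2l.
Qed.

End Measurability.

(** * Positivity and outer regularity of the volume *)
Section Regularity.
Context {R : realType} {d : nat}.
Notation V := 'cV[R]_d.+1.
Notation vol := (@lebesgue_vol R d.+1).
Implicit Types (X Y H K : set V) (a b x : V).

(** The volume of a box enlarged by t is a polynomial in t; this lemma lets
    enlargements cost arbitrarily little volume. *)
Lemma poly_lt_near0 (p : {poly R}) (c : R) : p.[0] < c ->
  exists2 h, 0 < h & forall t, 0 <= t <= h -> p.[t] < c.
Proof.
rewrite -subr_gt0 => hc; have := @continuous_horner R p 0.
move=> /cvgrPdist_lt/(_ _ hc)/nbhs_ballP [e /= e0 he].
exists (e / 2); first by rewrite divr_gt0.
move=> t /andP[t0 te]; have : `|p.[0] - p.[t]| < c - p.[0].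
  apply: he; rewrite -ball_normE /= sub0r normrN ger0_norm//.
  by apply: le_lt_trans te _; rewrite ltr_pdivrMr// ltr_pMr// ltr1n.
by rewrite ltr_distlC subrKC => /andP[].
Qed.

Definition open_box (p : V * V) : set V :=
  [set x | forall i, p.1 i 0 < x i 0 < p.2 i 0].

Lemma open_box_open p : open (open_box p).
Proof.
have -> : open_box p = \big[setI/setT]_(i <- enum 'I_d.+1)
    ((fun x : V => x i 0) @^-1` `]p.1 i 0, p.2 i 0[%classic).
  rewrite -bigcap_seq; apply/seteqP; split => x h i.
    by move=> _; rewrite /= in_itv/=; exact: h.
  by have := h i; rewrite /= mem_enum in_itv/=; exact.
elim/big_ind : _ => [|A B|i _]; [exact: openT|exact: openI|].
apply: open_comp; last exact: itv_open.
by move=> x _; exact: coord_continuous.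
Qed.

Lemma box_enlarge (p : V * V) (e : R) : 0 < e -> exists q : V * V,
  [/\ proper_box p -> proper_box q, box p.1 p.2 `<=` open_box q &
      box_vol q <= box_vol p + e].
Proof.
move=> e0; pose P : {poly R} := \prod_i ('X *+ 2 + (p.2 i 0 - p.1 i 0)%:P).
have PE t : P.[t] = \prod_i (t *+ 2 + (p.2 i 0 - p.1 i 0)).
  by rewrite /P horner_prod; apply: eq_bigr => i _; rewrite !hornerE.
have [|h h0 /(_ h)] := @poly_lt_near0 P (box_vol p + e).
  rewrite PE /box_vol; under eq_bigr do rewrite mul0rn add0r.
  by rewrite ltrDl.
rewrite lexx (ltW h0) => /(_ isT) hP.
exists (p.1 - const_mx h, p.2 + const_mx h); split.
- by move=> pp i; have := pp i; rewrite !mxE/=; lra.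
- by move=> x xp i; have := xp i; rewrite !mxE/= => /andP[? ?]; apply/andP; split; lra.
apply: ltW; apply: le_lt_trans hP; rewrite PE le_eqVlt; apply/orP; left; apply/eqP.
by apply: eq_bigr => i _; rewrite !mxE/=; ring.
Qed.

(** Enlarging the k-th box of a cover at a cost of [e / 2 ^ k.+1] makes the
    cover open, which gives access to compactness. *)
Lemma lebesgue_vol_open_cover X (c : R) : (vol X < c%:E)%E ->
  exists F : nat -> V * V, [/\ forall k, proper_box (F k),
    X `<=` \bigcup_k open_box (F k) &
    (\sum_(0 <= k <oo) (box_vol (F k))%:E < c%:E)%E].
Proof.
move=> Xc; have Xfin : vol X \is a fin_num.
  by rewrite ge0_fin_numE ?lebesgue_vol_ge0// (lt_trans Xc) ?ltry.
have [r rE] : exists r : R, vol X = r%:E by exists (fine (vol X)); rewrite fineK.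
pose e := (c - r) / 2; have e0 : 0 < e.
  by rewrite divr_gt0// subr_gt0 -lte_fin -rE.
have [F [pF XF lt]] := lebesgue_vol_cover_lt e0 Xfin.
have ek k : 0 < e / (2 ^ k.+1)%:R by rewrite divr_gt0// ltr0n expn_gt0.
have [G hG] := choice (fun k => box_enlarge (F k) (ek k)).
exists G; split.
- by move=> k; have [h _ _] := hG k; exact: h.
- by move=> x /XF [k _ xk]; exists k => //; have [_ h _] := hG k; exact: h.
have bF k : (0 <= (box_vol (F k))%:E)%E by rewrite lee_fin box_vol_ge0.
apply: (@le_lt_trans _ _ (\sum_(0 <= k <oo) ((box_vol (F k))%:E + (e / (2 ^ k.+1)%:R)%:E))%E).
  apply: lee_nneseries => k _; last by rewrite -EFinD lee_fin; have [] := hG k.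
  by move=> _; rewrite lee_fin box_vol_ge0//; have [h _ _] := hG k; exact: h.
apply: le_lt_trans (epsilon_trick xpredT bF (ltW e0)) _.
apply: (@lt_le_trans _ _ (vol X + e%:E + e%:E)%E).
  by rewrite lteD2rE.
by rewrite rE -!EFinD lee_fin /e; lra.
Qed.

(** The integers counted lie between the least and the greatest of them. *)
Lemma card_ord_in_itv (M : nat) (u v : R) : u <= v ->
  (\sum_(p < M) (u <= p%:R <= v)%R)%N%:R <= v - u + 1 :> R.
Proof.
move=> uv; rewrite -big_mkcond/= sum1_card.
set P := (X in #|X|).
case: (pickP P) => [p0 Pp0|P0]; last first.
  by rewrite eq_card0// addr_ge0// subr_ge0.
case: (@arg_minnP _ p0 P (fun p => p : nat) Pp0) => a Pa amin.
case: (@arg_maxnP _ p0 P (fun p => p : nat) Pp0) => b Pb bmax.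
have /andP[ua _] : u <= (a : nat)%:R <= v by [].
have /andP[_ bv] : u <= (b : nat)%:R <= v by [].
have ab : (a <= b)%N by exact: amin.
have : (#|P| <= (b - a).+1)%N.
  rewrite cardE -(size_map (@nat_of_ord M)) -(size_iota a (b - a).+1).
  apply: uniq_leq_size; first by rewrite map_inj_uniq ?enum_uniq//; exact: val_inj.
  move=> _ /mapP[p + ->]; rewrite mem_enum => Pp.
  have pb : (p <= b)%N := bmax _ Pp.
  by rewrite mem_iota addnS subnKC// ltnS amin.
rewrite -(ler_nat R) => /le_trans; apply.
by rewrite -natr1 natrB//; lra.
Qed.

(** The cube contains [M ^ d] points of the lattice of mesh 1/M, and a box of
    sides s_i contains at most the product of the [M s_i + 1]; let M grow. *)
Lemma unit_box_cover_vol (N : nat) (F : nat -> V * V) :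
  (forall k, proper_box (F k)) ->
  box 0 (const_mx 1) `<=` \bigcup_(k < N) box (F k).1 (F k).2 ->
  1 <= \sum_(k < N) box_vol (F k).
Proof.
move=> pF UF; rewrite leNgt; apply/negP => lt1.
pose P : {poly R} := \sum_(k < N) \prod_i ('X + ((F k).2 i 0 - (F k).1 i 0)%:P).
have PE t : P.[t] = \sum_(k < N) \prod_i (t + ((F k).2 i 0 - (F k).1 i 0)).
  rewrite /P horner_sum; apply: eq_bigr => k _; rewrite horner_prod.
  by apply: eq_bigr => i _; rewrite !hornerE.
have [|h h0 hP] := @poly_lt_near0 P 1.
  by rewrite PE; under eq_bigr do under eq_bigr do rewrite add0r.
pose M := (Num.truncn h^-1).+1.
have M0 : 0 < M%:R :> R by rewrite ltr0n.
have := hP M%:R^-1; rewrite invr_ge0 (ltW M0)/= => /(_ _)/wrap[].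
  rewrite -[leRHS]invrK lef_pV2 ?posrE ?invr_gt0//.
  by apply: ltW; exact: truncnS_gt.
rewrite PE ltNge => /negP; apply.
have inside (f : {ffun 'I_d.+1 -> 'I_M}) : 1 <=
    \sum_(k < N) \prod_i ((M%:R * (F k).1 i 0 <= (f i : nat)%:R <= M%:R * (F k).2 i 0)%R%:R : R).
  have [|k kN xk] := UF (\col_i ((f i : nat)%:R / M%:R)).
    move=> i; rewrite !mxE divr_ge0//= ler_pdivrMr// mul1r ler_nat.
    exact: ltnW.
  rewrite (bigD1 (Ordinal kN))//= big1 ?lerDl; last first.
    move=> i _; have := xk i; rewrite mxE ler_pdivlMr// ler_pdivrMr//.
    by rewrite ![M%:R * _]mulrC => ->.
  by apply: sumr_ge0 => l _; apply: prodr_ge0 => i _; rewrite ler0n.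
have : (M ^ d.+1)%:R <= \sum_(k < N) \prod_i (M%:R * ((F k).2 i 0 - (F k).1 i 0) + 1) :> R.
  apply: (@le_trans _ _ (\sum_(f : {ffun 'I_d.+1 -> 'I_M}) (1 : R))).
    by rewrite sumr_const card_ffun !card_ord.
  apply: le_trans (ler_sum _ (fun f _ => inside f)) _.
  rewrite exchange_big/=; apply: ler_sum => k _.
  rewrite -(bigA_distr_bigA (fun i (p : 'I_M) => 
    ((M%:R * (F k).1 i 0 <= (p : nat)%:R <= M%:R * (F k).2 i 0)%R%:R : R))).
  apply: ler_prod => i _; apply/andP; split; first exact: sumr_ge0.
  rewrite -natr_sum mulrBr; apply: card_ord_in_itv.
  by rewrite ler_wpM2l ?(ltW M0)//; exact: pF.
have -> : \sum_(k < N) \prod_i (M%:R * ((F k).2 i 0 - (F k).1 i 0) + 1) =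
   M%:R ^+ d.+1 * \sum_(k < N) \prod_i (M%:R^-1 + ((F k).2 i 0 - (F k).1 i 0)) :> R.
  rewrite mulr_sumr; apply: eq_bigr => k _.
  rewrite -[X in _ ^+ X]card_ord -prodr_const -big_split/=; apply: eq_bigr => i _.
  by rewrite [RHS]mulrDr divff ?gt_eqF// addrC.
by rewrite natrX -[leLHS]mulr1 ler_pM2l// exprn_gt0.
Qed.

(** By compactness a countable open cover of the cube contains a finite one. *)
Lemma unit_box_vol_ge1 : (1%:E <= vol (box 0%R (const_mx 1%R)))%E.
Proof.
rewrite leNgt; apply/negP => /lebesgue_vol_open_cover [F [pF UF lt]].
have := @box_compact R d.+1 0 (const_mx 1); rewrite compact_cover.
move=> /(_ nat setT (fun k => open_box (F k))) [|//|D' _ UD].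
  by move=> k _; exact: open_box_open.
pose N := (\max_(k <- D') k).+1.
have : 1 <= \sum_(k < N) box_vol (F k).
  apply: unit_box_cover_vol => // x /UD [k /= kD xk]; exists k; last by move=> i; have /andP[? ?] := xk i; rewrite !ltW.
  by rewrite /= /N ltnS; apply: (@leq_bigmax_seq _ _ xpredT id).
apply/negP; rewrite -ltNge -lte_fin; apply: le_lt_trans lt.
rewrite -sumEFin -(big_mkord xpredT (fun k => (box_vol (F k))%:E)).
by apply: nneseries_lim_ge => k _ _; rewrite lee_fin box_vol_ge0.
Qed.

Lemma bounded_vol_fin X (r : R) : (forall x, X x -> `|x| <= r) -> vol X \is a fin_num.
Proof.
move=> Xr; rewrite ge0_fin_numE ?lebesgue_vol_ge0//.
have r0 : 0 <= `|r| by [].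
pose p : V * V := (const_mx (- `|r|), const_mx `|r|).
have pp : proper_box p by move=> i; rewrite !mxE; lra.
have Xp : X `<=` box p.1 p.2.
  move=> x /Xr xr i; rewrite !mxE -ler_norml.
  by apply: le_trans (coord_le_norm _ _ _) _; apply: le_trans xr (ler_norm r).
apply: le_lt_trans (le_outer_measure vol _ _ Xp) _.
by apply: le_lt_trans (lebesgue_vol_box_le pp) _; exact: ltry.
Qed.

Lemma cell_bounded s z : 0 < s ->
  forall x, cell s z x -> `|x| <= s + `|s *: map_mx intr z : V|.
Proof.
move=> s0 x xz; rewrite -[x](subrK (s *: map_mx intr z)).
apply: le_trans (ler_normD _ _) _; rewrite lerD2r.
apply: (cell_diam s0 xz) => i; rewrite !mxE lexx ltr_pM2l// ltr_int.
by rewrite ltrDl.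
Qed.

Lemma unit_cell_vol_fin : @unit_cell_vol R d \is a fin_num.
Proof. apply: bounded_vol_fin; exact: (cell_bounded (z := 0) ltr01). Qed.

Lemma unit_cell_vol_gt0 : (0 < @unit_cell_vol R d)%E.
Proof.
rewrite lt_def lebesgue_vol_ge0 andbT; apply/negP => /eqP u0.
have : (1%:E <= vol (cell 2 0))%E.
  apply: le_trans unit_box_vol_ge1 _; apply: le_outer_measure => x h i.
  have := h i; rewrite !mxE/= mulr0 add0r mulr1 => /andP[-> /le_lt_trans ->]//.
  by rewrite ltr1n.
by rewrite cell_vol// u0 mule0 lee_fin ler10.
Qed.

(** Outer regularity: the open cover of a compact set by boxes also covers a
    uniform neighbourhood of it. *)
Lemma compact_vol_neighborhood K (c : R) : compact K -> (vol K < c%:E)%E ->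
  exists2 e, 0 < e & forall Y,
    (forall y, Y y -> exists2 x, K x & `|x - y| < e) -> (vol Y < c%:E)%E.
Proof.
move=> cK /lebesgue_vol_open_cover [F [pF KF lt]].
pose U := \bigcup_k open_box (F k).
have oU : open U by apply: bigcup_open => k _; exact: open_box_open.
have /compact_near_coveringP/(_ R (nbhs (0 : R)^'+) (fun e x => ball x e `<=` U)) := cK.
case => [x Kx|].
  have /nbhs_ballP [e /= e0 eU] : nbhs x U by apply: open_nbhs_nbhs; split => //; exact: KF.
  exists (ball x (e / 2), [set t | t < e / 2]).
    split; first by apply: nbhsx_ballx; rewrite divr_gt0.
    by apply: nbhs_right_lt; rewrite divr_gt0.
  move=> [y t] [/= xy te] z yz; apply: eU.
  by rewrite [e]splitr; apply: ball_triangle xy _; apply: le_ball yz; exact: ltW.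
move=> e /= e0 he; exists (e / 2); first by rewrite divr_gt0.
move=> Y YK; apply: le_lt_trans lt.
apply: (@le_trans _ _ (vol U)).
  apply: le_outer_measure => y /YK [x Kx xy].
  have e2 : `|0 - e / 2| < e.
    rewrite sub0r normrN ger0_norm ?divr_ge0 ?(ltW e0)//.
    by rewrite ltr_pdivrMr// ltr_pMr// ltr1n.
  have e20 : 0 < e / 2 by rewrite divr_gt0.
  by apply: (he _ e2 e20 x Kx); rewrite -ball_normE.
apply: lebesgue_vol_le_cover => // x [k _ xk]; exists k => // i.
by have /andP[? ?] := xk i; rewrite !ltW.
Qed.

End Regularity.

(** * Perron-Frobenius theory *)
Section ComplexModulus.
Context {R : realType}.
Implicit Types z : R[i].

(** A real-valued modulus: the norm of a complex number is itself complex. *)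
Definition modulus z : R := complex.Re `|z|.

Lemma norm_modulus z : `|z| = (real_complex R (modulus z)).
Proof. by rewrite /modulus normc_def. Qed.

Lemma real_complex_inj : injective (real_complex R).
Proof. by move=> x y []. Qed.

Lemma modulus_ge0 z : 0 <= modulus z.
Proof. by have := normr_ge0 z; rewrite norm_modulus lecR. Qed.

Lemma modulusM x y : modulus (x * y) = modulus x * modulus y.
Proof. by apply: real_complex_inj; rewrite rmorphM/= -!norm_modulus normrM. Qed.

Lemma modulusD_le x y : modulus (x + y) <= modulus x + modulus y.
Proof. by have := ler_normD x y; rewrite !norm_modulus -rmorphD/= lecR. Qed.

Lemma modulus_sum_le (I : Type) (s : seq I) (F : I -> R[i]) :
  modulus (\sum_(i <- s) F i) <= \sum_(i <- s) modulus (F i).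
Proof.
elim: s => [|i s IH]; first by rewrite !big_nil /modulus normr0.
by rewrite !big_cons; apply: le_trans (modulusD_le _ _) _; rewrite lerD2l.
Qed.

Lemma modulus_eq0 z : (modulus z == 0) = (z == 0).
Proof.
rewrite -[RHS]normr_eq0 norm_modulus; apply/eqP/eqP => [->//|].
by move=> /(congr1 (@complex.Re R)).
Qed.

Lemma modulus_real (x : R) : modulus (real_complex R x) = `|x|.
Proof.
rewrite /modulus normc_def /= expr0n/= addr0 sqrtr_sqr//.
Qed.

Lemma gt1_modulus z : ((1 : R[i]) < `|z|) = (1 < modulus z).
Proof. by rewrite norm_modulus -[1 : R[i]]/(real_complex R 1) ltcR. Qed.

End ComplexModulus.

Section PerronFrobenius.
Context {R : realType} {n : nat}.
Implicit Types (M : 'M[R]_n) (w v : 'rV[R]_n).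

Lemma primitive_trmx M : primitive M -> primitive M^T.
Proof.
move=> [M0 [k k0 Mk]]; split=> [i j|]; first by rewrite mxE.
exists k => // i j; suff -> : M^T ^+ k = (M ^+ k)^T by rewrite mxE.
elim: k {k0 Mk} => [|k IH]; first by rewrite !expr0 trmx1.
by rewrite exprS exprSr IH; apply/esym; exact: trmx_mul.
Qed.

Lemma mulmx_entry_gt0 (M N : 'M[R]_n) i j :
  (forall i j, 0 <= M i j) -> (forall i j, 0 <= N i j) ->
  0 < (M *m N) i j -> exists l, 0 < M i l /\ 0 < N l j.
Proof.
move=> M0 N0 MN; apply/not_existsP => h; move: MN; apply/negP; rewrite -leNgt mxE.
apply: sumr_le0 => l _; rewrite leNgt; apply/negP => MNl; apply: (h l).
have Ml : M i l != 0 by apply: contraTneq MNl => ->; rewrite mul0r ltxx.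
have Nl : N l j != 0 by apply: contraTneq MNl => ->; rewrite mulr0 ltxx.
by rewrite !lt_def Ml Nl M0 N0.
Qed.

Lemma exprmx_ge0 M k : (forall i j, 0 <= M i j) -> forall i j, 0 <= (M ^+ k) i j.
Proof.
move=> M0; elim: k => [|k IH] i j; first by rewrite expr0 mxE ler0n.
by rewrite exprS mxE; apply: sumr_ge0 => l _; rewrite mulr_ge0.
Qed.

Lemma mulmx_pos_gt0 (P : 'M[R]_n) w : (forall i j, 0 < P i j) ->
  (forall i, 0 <= w 0 i) -> (exists i, 0 < w 0 i) -> forall j, 0 < (w *m P) 0 j.
Proof.
move=> P0 w0 [i wi] j; rewrite mxE (bigD1 i)//= ltr_pwDl ?mulr_gt0//.
by apply: sumr_ge0 => l _; rewrite mulr_ge0 //; exact: ltW.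
Qed.

Lemma mulmxX_comm w M k : w *m M *m (M ^+ k) = w *m (M ^+ k) *m M.
Proof.
by rewrite -!mulmxA; congr (_ *m _); rewrite -[LHS]exprS -[RHS]exprSr.
Qed.

(** Maximise [t] over the compact set of pairs of a probability vector [w]
    and a real [t >= 0] with [t w <= w M].  Were a maximal pair not an
    eigenpair, multiplying it by a positive power of [M] would make the
    inequality strict in each coordinate, and [t] could be increased. *)
Theorem perron_frobenius M : (0 < n)%N -> primitive M ->
  exists w (r : R), [/\ forall i, 0 < w 0 i, 0 < r & w *m M = r *: w].
Proof.
move=> n0 [M0 [k k0 Mk]].
pose W := [set w : 'rV[R]_n | forall i, `[0, 1]%classic (w ord0 i)].
pose C := (W `*` `[0, entry_sum M]%classic) `&`
  [set p : 'rV[R]_n * R | \sum_i p.1 0 i = 1 /\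
     forall j, p.2 * p.1 0 j <= \sum_i p.1 0 i * M i j].
have c1 i : continuous (fun p : 'rV[R]_n * R => p.1 0 i).
  move=> p; apply: (@continuous_comp _ _ _ fst (fun w : 'rV[R]_n => w 0 i)).
    exact: cvg_fst.
  exact: coord_continuous.
have cs (F : 'I_n -> 'rV[R]_n * R -> R) : (forall i, continuous (F i)) ->
    continuous (fun p => \sum_i F i p).
  by move=> cF; apply: continuous_big => //; exact: add_continuous.
have cC : compact C.
  have -> : C = (W `*` `[0, entry_sum M]%classic) `&`
    (((fun p : 'rV[R]_n * R => \sum_i p.1 0 i) @^-1` [set 1]) `&`
     \bigcap_j ((fun p : 'rV[R]_n * R => \sum_i p.1 0 i * M i j - p.2 * p.1 0 j)
        @^-1` [set x | 0 <= x])).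
    apply/seteqP; split => -[w t] [p1 [/= p2 p3]]; split => //; split => // j.
      by move=> _ /=; rewrite subr_ge0.
    by have := p3 j I; rewrite /= subr_ge0.
  apply: compact_closedI.
    apply: compact_setX; last exact: segment_compact.
    have := @rV_compact R n (fun=> `[0, 1]%classic); apply => i; exact: segment_compact.
  apply: closedI.
    apply: closed_comp; last exact: closed_eq.
    by move=> p _; apply: cs => i; exact: c1.
  apply: closed_bigI => j _; apply: closed_comp; last exact: closed_ge.
  move=> p _; apply: (@cvgB _ _ _ (nbhs p)).
    apply: cs => i {}p; apply: (@cvgM _ _ (nbhs p)).
      exact: c1.
    exact: cvg_cst.
  apply: (@cvgM _ _ (nbhs p)); last exact: c1.
  exact: cvg_snd.
pose i0 := Ordinal n0.
have C0 : C !=set0.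
  exists (delta_mx 0 i0, 0); split; first split.
  - by move=> i; rewrite /= in_itv/= mxE eqxx/= ler0n lern1 leq_b1.
  - by rewrite /= in_itv/= lexx entry_sum_ge0.
  split => [|j] /=.
    by rewrite (bigD1 i0)//= big1 ?mxE ?eqxx ?addr0// => i /negbTE ii; rewrite mxE ii.
  by rewrite mul0r; apply: sumr_ge0 => i _; rewrite mulr_ge0// mxE ler0n.
have [[w r] /set_mem[[/= wW]]] := @compact_EVT_max _ _ (fun p : 'rV[R]_n * R => p.2) C C0 cC
  (continuous_subspaceT (fun p => cvg_snd)).
rewrite in_itv/= => /andP[r0 _] [w1 wr] rmax.
have w0 i : 0 <= w 0 i by have := wW i; rewrite /= in_itv/= => /andP[].
have wpos : exists i, 0 < w 0 i.
  apply/not_existsP => wn; suff : \sum_i w 0 i = 0.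
    by move/eqP; rewrite w1 oner_eq0.
  by apply: big1 => i _; apply/le_anti; rewrite w0 andbT leNgt; apply/negP.
have E : w *m M = r *: w.
  apply: contrapT => wMr.
  pose u := w *m M - r *: w.
  have u0 i : 0 <= u 0 i by rewrite !mxE subr_ge0.
  have upos : exists i, 0 < u 0 i.
    apply/not_existsP => un; apply: wMr; apply/eqP; rewrite -subr_eq0; apply/eqP.
    apply/rowP => i; rewrite [RHS]mxE; apply/le_anti.
    by rewrite u0 andbT leNgt; apply/negP.
  pose w' := w *m (M ^+ k).
  have w'0 : forall j, 0 < w' 0 j by apply: mulmx_pos_gt0.
  have uk : forall j, 0 < (u *m (M ^+ k)) 0 j by apply: mulmx_pos_gt0.
  have ukE : u *m (M ^+ k) = w' *m M - r *: w'.
    by rewrite mulmxBl -scalemxAl mulmxX_comm.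
  clearbody w'; pose s := \sum_j w' 0 j.
  have s0 : 0 < s by rewrite /s (bigD1 i0)//= ltr_pwDl// sumr_ge0// => *; exact: ltW.
  have [j jmin] : exists j, forall i, (u *m (M ^+ k)) 0 j <= (u *m (M ^+ k)) 0 i.
    case: (@arg_minP _ _ _ i0 xpredT (fun i => (u *m (M ^+ k)) 0 i)) => // j _ h.
    by exists j => i; exact: h.
  (* [w'] is positive and at most [s], so that [t] exceeds [r] while the slack
     [u *m M ^+ k] still absorbs [(t - r) w']. *)
  pose t := r + (u *m (M ^+ k)) 0 j / s.
  have w's i : w' 0 i <= s by rewrite /s (bigD1 i)//= lerDl sumr_ge0// => *; exact: ltW.
  have tw' i : t * w' 0 i <= (w' *m M) 0 i.
    rewrite /t mulrDl -lerBrDl; apply: (@le_trans _ _ ((u *m (M ^+ k)) 0 i)); last first.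
      by rewrite ukE !mxE.
    apply: le_trans (jmin i); rewrite mulrAC ler_pdivrMr//.
    by rewrite ler_pM2l.
  have t0 : 0 <= t by rewrite addr_ge0// divr_ge0// ltW.
  have := rmax (s^-1 *: w', t); rewrite /= => h.
  have : t <= r.
    apply: h; apply/mem_set.
    have sum1 : \sum_i (s^-1 *: w') 0 i = 1.
      under eq_bigr do rewrite mxE.
      by rewrite -mulr_sumr mulVf// gt_eqF.
    have tw'' i : t * (s^-1 *: w') 0 i <= \sum_j (s^-1 *: w') 0 j * M j i.
      rewrite mxE mulrCA; have := tw' i; rewrite mxE => twi.
      under eq_bigr do rewrite mxE -mulrA.
      by rewrite -mulr_sumr ler_pM2l// invr_gt0.
    have le1 i : (s^-1 *: w') 0 i <= 1 by rewrite mxE mulrC ler_pdivrMr// mul1r.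
    have ge0 i : 0 <= (s^-1 *: w') 0 i.
      by rewrite mxE mulr_ge0// ?invr_ge0 ltW.
    split; last by [].
    split; first by move=> i; rewrite /= in_itv/= ge0 le1.
    rewrite /= in_itv/= t0/=.
    rewrite -[t]mulr1 -sum1 mulr_sumr; apply: le_trans (ler_sum _ (fun i _ => tw'' i)) _.
    rewrite exchange_big/=; apply: ler_sum => l _; apply: ler_sum => i _.
    by rewrite (le_trans (ler_norm _))// normrM ler_piMl// ger0_norm.
  by rewrite gerDl leNgt divr_gt0.
have Ek (m : nat) : w *m (M ^+ m) = r ^+ m *: w.
  elim: m => [|m IH]; first by rewrite !expr0 mulmx1 scale1r.
  by rewrite exprSr mulmxA IH -scalemxAl E scalerA -exprSr.
have rk i : 0 < r ^+ k * w 0 i.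
  have := mulmx_pos_gt0 Mk w0 wpos i; rewrite Ek mxE//.
have rp : 0 < r.
  rewrite lt_def r0 andbT; apply/eqP => rz; have := rk i0.
  by rewrite rz expr0n gtn_eqF// mul0r ltxx.
by exists w, r; split => // i; have := rk i; rewrite pmulr_rgt0// exprn_gt0.
Qed.

(** Pairing left and right positive eigenvectors shows that they belong to
    the same eigenvalue, and that it dominates all the others. *)
Theorem perron_eigenvectors M (q : R) : (0 < n)%N -> primitive M ->
  is_perron_eigenvalue M q ->
  (exists2 w : 'rV[R]_n, forall i, 0 < w 0 i & w *m M = q *: w) /\
  (exists2 v : 'cV[R]_n, forall i, 0 < v i 0 & M *m v = q *: v).
Proof.
move=> n0 pM [_ _ _ qE].
have [w [r [w0 r0 wE]]] := perron_frobenius n0 pM.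
have [v' [r' [v0 r'0 vE]]] := perron_frobenius n0 (primitive_trmx pM).
have [v {}v0 {}vE] : exists2 v : 'cV[R]_n, forall i, 0 < v i 0 & M *m v = r' *: v.
  exists v'^T; first by move=> i; rewrite mxE.
  by rewrite -[M]trmxK -trmx_mul vE linearZ.
have wv0 : 0 < (w *m v) 0 0.
  rewrite mxE (bigD1 (Ordinal n0))//= ltr_pwDl ?mulr_gt0//.
  by apply: sumr_ge0 => i _; rewrite mulr_ge0 //; exact: ltW.
have rr' : r' = r.
  have : (w *m M *m v) 0 0 = (w *m M *m v) 0 0 by [].
  rewrite {1}wE -mulmxA vE -scalemxAl -scalemxAr [LHS]mxE [RHS]mxE.
  by move/(mulIf (lt0r_neq0 wv0)).
rewrite rr' in vE.
suff -> : q = r by split; [exists w | exists v].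
rewrite qE /spectral_radius; apply/eqP; rewrite eq_le.
have M0 i j : 0 <= M i j by case: pM.
have rev : [set complex.Re `|z| | z in complex_eigenvalues M] r.
  exists (real_complex R r); last by rewrite -[LHS]/(modulus _) modulus_real ger0_norm// ltW.
  apply/eigenvalueP; exists (map_mx (real_complex R) w).
    by rewrite -map_mxM/= wE map_mxZ.
  apply/eqP => /rowP/(_ (Ordinal n0)); rewrite !mxE => /real_complex_inj/eqP.
  by rewrite gt_eqF.
have ub : ubound [set complex.Re `|z| | z in complex_eigenvalues M] r.
  move=> _ [z /eigenvalueP[x xM x0] <-]; rewrite -/(modulus z).
  have xj j : modulus z * modulus (x 0 j) <= \sum_i modulus (x 0 i) * M i j.
    rewrite -modulusM.
    have -> : z * x 0 j = (x *m map_mx (real_complex R) M) 0 j by rewrite xM mxE.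
    rewrite mxE; apply: le_trans (modulus_sum_le _ _) _; apply: ler_sum => i _.
    by rewrite mxE modulusM modulus_real ger0_norm.
  pose s := \sum_j modulus (x 0 j) * v j 0.
  have s0 : 0 < s.
    have [j xj0] : exists j, x 0 j != 0.
      apply/not_existsP => h; move/eqP: x0; apply; apply/rowP => j.
      by have /negP := h j; rewrite negbK mxE => /eqP.
    rewrite /s (bigD1 j)//= ltr_pwDl//.
      by rewrite mulr_gt0// lt_def modulus_eq0 xj0 modulus_ge0.
    by apply: sumr_ge0 => i _; rewrite mulr_ge0 ?modulus_ge0// ltW.
  rewrite -(ler_pM2r s0) /s !mulr_sumr.
  apply: (@le_trans _ _ (\sum_j (\sum_i modulus (x 0 i) * M i j) * v j 0)).
    by apply: ler_sum => j _; rewrite mulrA ler_wpM2r// ltW.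
  under eq_bigr do rewrite mulr_suml.
  rewrite exchange_big/=; apply: ler_sum => i _.
  under eq_bigr do rewrite -mulrA.
  rewrite -mulr_sumr mulrCA ler_wpM2l ?modulus_ge0//.
  by have /colP/(_ i) := vE; rewrite !mxE => ->.
apply/andP; split; first by apply: ge_sup => //; exists r.
by apply: ub_le_sup => //; exists r.
Qed.

End PerronFrobenius.

(** * Expanding matrices and contracting gauges *)
Section Expanding.
Context {R : realType}.

(** Beyond an index from which [b] is below [e / 2 * (1 - rho)], the sequence [a]
    is bounded by a geometric one plus [e / 2]. *)
Lemma geometric_recursion_null (rho : R) (a b : nat -> R) :
  0 <= rho < 1 -> (forall k, 0 <= a k) ->
  (forall k, a k.+1 <= rho * a k + b k) ->
  (forall e, 0 < e -> exists K, forall k, (K <= k)%N -> b k < e) ->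
  forall e, 0 < e -> exists K, forall k, (K <= k)%N -> a k < e.
Proof.
move=> /andP[r0 r1] a0 ab bnull e e0.
have r1' : 0 < 1 - rho by rewrite subr_gt0.
have [|K bK] := bnull (e / 2 * (1 - rho)); first by rewrite mulr_gt0// divr_gt0.
have aK m : a (K + m)%N <= rho ^+ m * a K + e / 2.
  elim: m => [|m IH]; first by rewrite addn0 expr0 mul1r lerDl divr_ge0// ltW.
  rewrite addnS; apply: le_trans (ab _) _.
  apply: (@le_trans _ _ (rho * (rho ^+ m * a K + e / 2) + e / 2 * (1 - rho))).
    by rewrite lerD ?ler_wpM2l// ltW// bK// leq_addr.
  by rewrite exprS; lra.
have c0 : 0 < e / 2 / (a K + 1) by rewrite !divr_gt0// ltr_wpDl.
have /cvgrPdist_lt/(_ _ c0)[M _ hM] : rho ^+ m @[m --> \oo] --> (0 : R).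
  by apply: cvg_expr; rewrite ger0_norm.
exists (K + M)%N => k kKM; rewrite -(subnKC (leq_trans (leq_addr M K) kKM)).
apply: le_lt_trans (aK _) _; rewrite [ltRHS]splitr ltrD2r.
have := hM (k - K)%N; rewrite /= sub0r normrN ger0_norm ?exprn_ge0// => h.
have {}h : rho ^+ (k - K) < e / 2 / (a K + 1).
  by apply: h; rewrite leq_subRL// (leq_trans (leq_addr M K)).
move: h; rewrite ltr_pdivlMr ?ltr_wpDl//; apply: le_lt_trans.
by rewrite ler_wpM2l ?exprn_ge0// lerDl.
Qed.

(** Linear recurrences whose characteristic roots lie in the open unit disc
    have only null solutions; the functional [L] evaluates a polynomial in the
    shift operator on a solution. *)
Lemma linear_recurrence_null (s : seq R[i]) (L : {poly R[i]} -> R[i]) :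
  (forall p q, L (p + q) = L p + L q) -> (forall c p, L (c *: p) = c * L p) ->
  (forall z, z \in s -> modulus z < 1) ->
  (forall p, L ((\prod_(z <- s) ('X - z%:P)) * p) = 0) ->
  forall p (e : R), 0 < e ->
    exists K, forall k, (K <= k)%N -> modulus (L ('X^k * p)) < e.
Proof.
elim: s L => [|z s IH] L LD LZ s1 L0 p e e0.
  exists 0%N => k _; have := L0 ('X^k * p); rewrite big_nil mul1r => ->.
  by rewrite /modulus normr0.
pose L' q := L (('X - z%:P) * q).
apply: (geometric_recursion_null (rho := modulus z)
  (b := fun k => modulus (L' ('X^k * p)))) => //.
- by rewrite modulus_ge0 s1// mem_head.
- by move=> k; exact: modulus_ge0.
- move=> k; rewrite -modulusM; apply: le_trans (modulusD_le _ _).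
  rewrite -LZ -LD; set u := (X in _ <= modulus (L X)).
  suff -> : 'X^(k.+1) * p = u by [].
  by rewrite /u -mul_polyC exprS; ring.
apply: IH => [q r|c q|y ys|q].
- by rewrite /L' mulrDr LD.
- by rewrite /L' -scalerAr LZ.
- by apply: s1; rewrite inE ys orbT.
- by rewrite /L'; have := L0 q; rewrite big_cons mulrA.
Qed.

Context {d : nat}.
Notation V := 'cV[R]_d.+1.
Implicit Types A : 'M[R]_d.+1.

(** Otherwise 0 would be an eigenvalue. *)
Lemma expanding_unitmx A : expanding A -> A \in unitmx.
Proof.
move=> hA; rewrite unitmxE unitfE; apply/negP => /det0P[x x0 xA].
have : complex_eigenvalues A 0.
  apply/eigenvalueP; exists (map_mx (real_complex R) x).
    by rewrite -map_mxM xA map_mx0 scale0r.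
  by apply: contra x0 => /eqP /rowP h; apply/eqP/rowP => i; have := h i;
    rewrite !mxE => /real_complex_inj.
by move=> /hA; rewrite normr0 ltr10.
Qed.

(** The entries of the powers of the inverse of [A] satisfy the linear
    recurrence given by the Cayley-Hamilton theorem, whose characteristic
    roots are the inverses of eigenvalues of [A]. *)
Theorem expanding_inverse_null A : expanding A -> forall e : R, 0 < e ->
  exists2 K, (0 < K)%N & entry_sum (invmx A ^+ K) < e.
Proof.
move=> hA e e0; have uA := expanding_unitmx hA.
pose f := real_complex R; pose B := map_mx f (invmx A).
have [s sE] := closed_field_poly_normal (char_poly B).
have lB : lead_coef (char_poly B) = 1 := monicP (char_poly_monic B).
rewrite lB scale1r in sE.
have BA : B *m map_mx f A = 1%:M by rewrite -map_mxM mulVmx// map_mx1.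
have s1 z : z \in s -> modulus z < 1.
  rewrite -(root_prod_XsubC s) -sE -eigenvalue_root_char => /eigenvalueP[x xB x0].
  have xE : x = z *: (x *m map_mx f A).
    by rewrite scalemxAl -xB -mulmxA BA mulmx1.
  have z0 : z != 0 by apply: contra x0 => /eqP z0; rewrite xE z0 scale0r.
  have : complex_eigenvalues A z^-1.
    by apply/eigenvalueP; exists x => //; rewrite {2}xE scalerA mulVf// scale1r.
  move=> /hA; rewrite gt1_modulus => h.
  have : modulus z^-1 * modulus z = 1.
    by rewrite -modulusM mulVf// (_ : 1 = f 1)// modulus_real normr1.
  have z0' : 0 < modulus z by rewrite lt_def modulus_eq0 z0 modulus_ge0.
  by move=> <-; rewrite ltr_pMl.
pose N := (d.+1 * d.+1)%N.
have N0 : 0 < N%:R :> R by rewrite ltr0n.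
have ent (i j : 'I_d.+1) : exists K, forall k, (K <= k)%N -> `|(invmx A ^+ k) i j| < e / N%:R.
  pose L (p : {poly R[i]}) := (horner_mx B p) i j.
  have [| | | |K hK] := @linear_recurrence_null s L _ _ s1 _ 1 (e / N%:R).
  - by move=> p q; rewrite /L rmorphD mxE.
  - by move=> c p; rewrite /L horner_mxZ mxE.
  - by move=> p; rewrite /L rmorphM/= -sE Cayley_Hamilton mul0r mxE.
  - by rewrite divr_gt0.
  exists K => k /hK; rewrite mulr1 /L rmorphXn/= horner_mx_X.
  suff -> : B ^+ k = map_mx f (invmx A ^+ k) by rewrite mxE modulus_real.
  by rewrite rmorphXn.
have [K hK] := choice (fun ij : 'I_d.+1 * 'I_d.+1 => ent ij.1 ij.2).
pose m := (\max_(ij : 'I_d.+1 * 'I_d.+1) K ij).+1.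
exists m => //; rewrite /entry_sum pair_bigA/=.
have -> : e = \sum_(ij : 'I_d.+1 * 'I_d.+1) e / N%:R.
  by rewrite sumr_const card_prod !card_ord -/N -[RHS]mulr_natr divfK// gt_eqF.
apply: ltr_sum => [|ij _]; last by apply: hK; rewrite leqW// leq_bigmax.
by apply/hasP; exists (ord0, ord0); rewrite ?mem_index_enum.
Qed.

Lemma bernoulli_le (h : R) k : 0 <= h <= 1 -> 1 - k%:R * h <= (1 - h) ^+ k.
Proof.
move=> /andP[h0 h1]; elim: k => [|k IH]; first by rewrite mul0r subr0 expr0.
rewrite exprS; apply: (@le_trans _ _ ((1 - h) * (1 - k%:R * h))).
  rewrite -natr1; have : 0 <= k%:R * h * h by rewrite !mulr_ge0.
  lra.
by rewrite ler_wpM2l// subr_ge0.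
Qed.

(** An adapted norm: expansion only makes some power of [invmx A] contract the
    sup norm, whereas the gauge shrinks at each step. *)
Record contracting_gauge A := ContractingGauge {
  gauge :> V -> R;
  gauge_ratio : R;
  gauge_const : R;
  gauge_ratio_itv : 0 < gauge_ratio < 1;
  gauge_const_gt0 : 0 < gauge_const;
  gaugeD_le : forall x y, gauge (x + y) <= gauge x + gauge y;
  gaugeN : forall x, gauge (- x) = gauge x;
  norm_le_gauge : forall x, `|x| <= gauge x;
  gauge_le_norm : forall x, gauge x <= gauge_const * `|x|;
  gauge_contract : forall x, gauge (invmx A *m x) <= gauge_ratio * gauge x }.

(** If [A^-K] halves the norm, then for a ratio [t < 1] with [t ^ K >= 1/2]
    the sum of the norms of the [A^-k x], k < K, weighted by [t ^ -k], is
    multiplied by at most [t] when [x] is replaced by [A^-1 x]. *)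
Theorem expanding_contracting_gauge A : expanding A -> inhabited (contracting_gauge A).
Proof.
move=> hA; have e2 : 0 < 2^-1 :> R by rewrite invr_gt0.
have [K K0 hK] := expanding_inverse_null hA e2.
pose B := invmx A.
have BK x : `|B ^+ K *m x| <= 2^-1 * `|x|.
  by apply: le_trans (norm_mulmx_le _ _) _; rewrite ler_wpM2r// ltW.
have K0' : 0 < K%:R :> R by rewrite ltr0n.
have K1 : 1 <= K%:R :> R by rewrite ler1n.
(* The ratio [1 - h] has a K-th power at least 1/2 by Bernoulli's inequality. *)
pose h : R := (2 * K%:R)^-1.
have hKE : K%:R * h = 2^-1 by rewrite /h invfM mulrCA divff ?mulr1// gt_eqF.
have h0 : 0 < h by rewrite invr_gt0 mulr_gt0.
have h1 : h <= 2^-1 by rewrite -hKE ler_peMl// ltW.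
pose t := 1 - h.
have t0 : 0 < t by rewrite /t; lra.
have tn0 : t != 0 by rewrite gt_eqF.
have tK : 2^-1 <= t ^+ K.
  apply: le_trans (bernoulli_le _ _); last by apply/andP; split; lra.
  by rewrite hKE; lra.
pose N (x : V) := \sum_(k < K) (t ^+ k)^-1 * `|B ^+ k *m x|.
pose C := 1 + \sum_(k < K) (t ^+ k)^-1 * entry_sum (B ^+ k).
have w0 k : 0 <= (t ^+ k)^-1 by rewrite invr_ge0 exprn_ge0// ltW.
have C0 : 0 < C.
  by rewrite ltr_pwDl// sumr_ge0// => k _; rewrite mulr_ge0// entry_sum_ge0.
apply: inhabits; apply: (@ContractingGauge A N t C) => //.
- by rewrite t0 /t gtrDl oppr_lt0.
- move=> x y; rewrite -big_split/=; apply: ler_sum => k _.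
  by rewrite -mulrDr ler_wpM2l// mulmxDr ler_normD.
- by move=> x; apply: eq_bigr => k _; rewrite mulmxN normrN.
- move=> x; rewrite /N -(prednK K0) big_ord_recl/= expr0 invr1 mul1r mul1mx lerDl.
  by apply: sumr_ge0 => k _; rewrite mulr_ge0.
- move=> x; rewrite /C mulrDl mul1r mulr_suml ler_wpDl//; apply: ler_sum => k _.
  by rewrite -mulrA ler_wpM2l// norm_mulmx_le.
move=> x; have -> : N (invmx A *m x) = \sum_(k < K) t * ((t ^+ k.+1)^-1 * `|B ^+ k.+1 *m x|).
  apply: eq_bigr => k _; rewrite mulrA exprS invfM mulrA divff// mul1r.
  by congr (_ * `|_|); rewrite mulmxA; congr (_ *m x); rewrite exprSr.
rewrite -mulr_sumr ler_pM2l//.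
rewrite -(big_mkord xpredT (fun k => (t ^+ k.+1)^-1 * `|B ^+ k.+1 *m x|)).
rewrite -(big_add1 _ _ 0 K.+1 xpredT (fun k => (t ^+ k)^-1 * `|B ^+ k *m x|)).
rewrite big_nat_recr//= /N -(big_mkord xpredT (fun k => (t ^+ k)^-1 * `|B ^+ k *m x|)).
rewrite [leRHS](big_ltn K0) addrC lerD2r expr0 invr1 mul1r mul1mx.
rewrite ler_pdivrMl ?exprn_gt0//. apply: (@le_trans _ _ (2^-1 * `|x|)); first exact: BK.
by rewrite ler_wpM2r.
Qed.

End Expanding.

(** * Substitutions on lists of tiles *)
Section Substitution.
Context {R : realType} {d n : nat}.
Notation V := 'cV[R]_d.+1.
Notation tile := ('I_n * V)%type.
Variables (A : 'M[R]_d.+1) (D : 'I_n -> 'I_n -> {fset V}).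
Implicit Types (s : seq tile) (p q : tile) (T : 'I_n -> set V).

(** The tiles into which the inflation cuts a tile of type [j] placed at the
    origin: one of type [i] for each digit of [D i j]. *)
Definition digit_tiles (j : 'I_n) : seq tile :=
  flatten [seq [seq (i, v) | v <- (D i j : seq V)] | i <- enum 'I_n].

Definition children p : seq tile :=
  [seq (q.1, q.2 + A *m p.2) | q <- digit_tiles p.1].

Definition subst s : seq tile := flatten (map children s).

Definition patch T s : set V := \big[setU/set0]_(p <- s) translate (T p.1) p.2.

(** The multiset family listed by [s]; it turns statements on multiplicities
    into statements on lists. *)
Definition count_family s : multiset_family R d.+1 n :=
  fun i x => count_mem (i, x) s.

Lemma mem_digit_tiles j i v : ((i, v) \in digit_tiles j) = (v \in D i j).
Proof.
apply/flattenP/idP => [[_ /mapP[i' _ ->] /mapP[v' vD [-> ->]]]//|vD].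
exists [seq (i, v) | v <- (D i j : seq V)]; last exact: map_f.
by apply: map_f; rewrite mem_enum.
Qed.

Lemma mem_subst s i x : reflect
  (exists j y v, [/\ (j, y) \in s, v \in D i j & x = v + A *m y])
  ((i, x) \in subst s).
Proof.
apply: (iffP flattenP) => [[_ /mapP[[j y] js ->]]|[j [y [v [js vD ->]]]]].
  by move=> /mapP[[i' v] + [-> ->]]; rewrite mem_digit_tiles; exists j, y, v.
exists (children (j, y)); first exact: map_f.
by apply/mapP; exists (i, v); rewrite ?mem_digit_tiles.
Qed.

Lemma subst_cat s t : subst (s ++ t) = subst s ++ subst t.
Proof. by rewrite /subst map_cat flatten_cat. Qed.

Lemma iter_subst_cat N s t :
  iter N subst (s ++ t) = iter N subst s ++ iter N subst t.
Proof. by elim: N => //= N ->; rewrite subst_cat. Qed.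

Lemma mem_iter_subst N s q :
  reflect (exists2 p, p \in s & q \in iter N subst [:: p]) (q \in iter N subst s).
Proof.
elim: s => [|p s IH].
  have -> : iter N subst [::] = [::] by elim: N => //= N ->.
  by constructor; case.
rewrite -cat1s iter_subst_cat mem_cat; apply: (iffP orP).
  case=> [qp|/IH[p' p's qp']]; first by exists p; rewrite ?mem_cat ?mem_head.
  by exists p' => //; rewrite mem_cat p's orbT.
move=> [p']; rewrite mem_cat inE => /orP[/eqP ->|p's] qp'; [by left|right].
by apply/IH; exists p'.
Qed.

(** The substitution commutes with translations up to the linear map. *)
Lemma iter_subst_shift N i j x y z :
  (i, x) \in iter N subst [:: (j, y)] ->
  (i, x + (A ^+ N) *m z) \in iter N subst [:: (j, y + z)].
Proof.
elim: N i x => [|N IH] i x /=.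
  by rewrite !inE => /eqP[-> ->]; rewrite expr0 mul1mx.
move=> /mem_subst [k [u [v [kN vD ->]]]]; apply/mem_subst.
exists k, (u + A ^+ N *m z), v; split => //; first exact: IH.
by rewrite exprS mulmxDr addrA [A *m (_ *m _)]mulmxA.
Qed.

(** Both sides count the pairs of a tile (j, y) of [s] and a digit v of
    [D i j] such that x = v + A y. *)
Lemma inflation_count_family s : A \in unitmx ->
  inflation A D (count_family s) = count_family (subst s).
Proof.
move=> uA; apply/funext => i; apply/funext => x.
rewrite /count_family /inflation /mset_add_digits /mset_image.
have E p : count_mem (i, x) (children p) =
    (\sum_(v <- (D i p.1 : seq V)) (p.2 == invmx A *m (x - v)))%N.
  rewrite /children /digit_tiles count_map count_flatten sumnE big_map big_map.
  rewrite big_enum (bigD1 i)//= [X in (_ + X)%N]big1 ?addn0; last first.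
    move=> l li; rewrite count_map; apply/eqP; rewrite -leqn0 leqNgt -has_count.
    by apply/negP => /hasP[v _ /= /eqP[li']]; rewrite li' eqxx in li.
  rewrite count_map -sum1_count big_mkcond/=; apply: eq_bigr => v _.
  rewrite -[(_, _) == _]/((i == i) && (_ == x)) eqxx/=.
  have -> : (v + A *m p.2 == x) = (p.2 == invmx A *m (x - v)).
    apply/eqP/eqP => [<-|->]; first by rewrite addrC addKr mulKmx.
    by rewrite mulKVmx// addrC subrK.
  by case: eqP.
rewrite count_flatten sumnE !big_map; under [RHS]eq_bigr do rewrite E.
transitivity (\sum_j \sum_(v <- (D i j : seq V)) \sum_(p <- s)
    (p == (j, (invmx A *m (x - v))%R)))%N.
  apply: eq_bigr => j _; apply: eq_bigr => v _.
  by rewrite -sum1_count big_mkcond/=; apply: eq_bigr => p _; case: eqP.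
under eq_bigr do rewrite exchange_big/=.
rewrite exchange_big/=; apply: eq_bigr => -[j y] _ /=.
rewrite (bigD1 j)//= [X in (_ + X)%N]big1 ?addn0; last first.
  move=> l lj; rewrite big1// => v _; rewrite -[(_, _) == _]/((j == l) && _).
  by rewrite eq_sym (negbTE lj).
by apply: eq_bigr => v _; rewrite -[(_, _) == _]/((j == j) && _) eqxx.
Qed.

Lemma iter_inflation_count_family N s : A \in unitmx ->
  iter N (inflation A D) (count_family s) = count_family (iter N subst s).
Proof. by move=> uA; elim: N => //= N ->; rewrite inflation_count_family. Qed.

Lemma inflation_mono (X Y : multiset_family R d.+1 n) N :
  (forall i x, (X i x <= Y i x)%N) ->
  forall i x, (iter N (inflation A D) X i x <= iter N (inflation A D) Y i x)%N.
Proof.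
move=> XY; elim: N => //= N IH i x.
by apply: leq_sum => j _; apply: leq_sum => v _; exact: IH.
Qed.

Definition weight (w : 'rV[R]_n) s : R := \sum_(p <- s) w 0 p.1.

(** A tile of type j has [S i j] children of type i. *)
Lemma weight_subst w s :
  weight w (subst s) = weight (w *m subdivision_matrix D) s.
Proof.
rewrite /weight /subst big_flatten big_map.
apply: eq_bigr => p _; rewrite /children big_map /digit_tiles big_flatten big_map.
rewrite big_enum/= !mxE; apply: eq_bigr => i _.
rewrite big_map/= !mxE big_const_seq count_predT iter_addr_0.
by rewrite mulr_natr.
Qed.

Lemma weightZ (c : R) w s : weight (c *: w) s = c * weight w s.
Proof. by rewrite /weight mulr_sumr; apply: eq_bigr => p _; rewrite mxE. Qed.

Lemma weight_iter_subst w (q : R) N s : w *m subdivision_matrix D = q *: w ->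
  weight w (iter N subst s) = q ^+ N * weight w s.
Proof.
move=> wS; elim: N => [|N IH]; first by rewrite mul1r.
by rewrite iterS weight_subst wS weightZ IH mulrA exprS.
Qed.

Lemma translate0 (X : set V) : translate X 0 = X.
Proof.
apply/seteqP; split=> [_ [x Xx <-]|x Xx]; first by rewrite addr0.
by exists x => //; rewrite addr0.
Qed.

Lemma patchP T s x :
  patch T s x <-> exists2 p, p \in s & T p.1 (x - p.2).
Proof.
rewrite /patch -bigcup_seq; split=> [[p ps [y Ty <-]]|[p ps Tx]].
  by exists p => //; rewrite addrK.
by exists p => //; exists (x - p.2) => //=; rewrite subrK.
Qed.

(** Pointwise form of the equation, adapted to iteration: a point belongs to
    [T i] when its image belongs to a tile of the inflated [T i]. *)
Lemma multi_tile_equationP T : A \in unitmx ->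
  multi_tile_equation A (digit_sets D) T <->
  forall i x, T i x <-> exists2 q, q \in digit_tiles i & T q.1 (A *m x - q.2).
Proof.
move=> uA; split=> [TE i x|TE i].
  split=> [Tx|[[j v]]].
    have : (\bigcup_j Defs.minkowski (T j) (digit_sets D j i)) (A *m x).
      by rewrite -TE; exists x.
    move=> [j _ [y Ty [v vD vE]]]; exists (j, v); first by rewrite mem_digit_tiles.
    by rewrite -vE/= addrK.
  rewrite mem_digit_tiles => vD /= Tj.
  have : (\bigcup_j Defs.minkowski (T j) (digit_sets D j i)) (A *m x).
    by exists j => //; exists (A *m x - v) => //; exists v => //; rewrite subrK.
  by rewrite -TE => -[y Ty /(can_inj (mulKmx uA)) <-].
apply/seteqP; split=> [y [x /TE [[j v] + + <-]]|x [j _ [y Ty [v vD <-]]]].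
  rewrite mem_digit_tiles => vD Tj; exists j => //.
  by exists (A *m x - v) => //; exists v => //; rewrite subrK.
exists (invmx A *m (y + v)); last by rewrite mulKVmx.
apply/TE; exists (j, v); first by rewrite mem_digit_tiles.
by rewrite mulKVmx//= addrK.
Qed.

Lemma patch_subst T s : A \in unitmx -> multi_tile_equation A (digit_sets D) T ->
  patch T (subst s) = [set A *m x | x in patch T s].
Proof.
move=> uA /(multi_tile_equationP _ uA) TE; apply/seteqP; split => x.
  move=> /patchP[[i y] /mem_subst[j [z [v [js vD ->]]]]] /= Ti.
  exists (invmx A *m x); last by rewrite mulKVmx.
  apply/patchP; exists (j, z) => //=; apply/TE.
  exists (i, v); first by rewrite mem_digit_tiles.
  rewrite /= mulmxBr mulKVmx//; move: Ti; congr (T i _).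
  by rewrite opprD addrA addrAC.
move=> [y /patchP[[j z] js /TE [[i v] + +]] <-]; rewrite mem_digit_tiles /= => vD Ti.
apply/patchP; exists (i, v + A *m z).
  by apply/mem_subst; exists j, z, v.
by rewrite /= (_ : _ - _ = A *m (y - z) - v)// mulmxBr opprD addrA addrAC.
Qed.

Lemma patch_iter_subst T N s : A \in unitmx ->
  multi_tile_equation A (digit_sets D) T ->
  patch T (iter N subst s) = [set A ^+ N *m x | x in patch T s].
Proof.
move=> uA TE; elim: N => [|N IH] /=.
  rewrite (_ : (fun x => _) = id) ?image_id//.
  by apply/funext => x; rewrite expr0 mul1mx.
rewrite patch_subst// IH [LHS](image_comp (mulmx (A ^+ N)) (mulmx A)).
by apply: eq_imagel => x _ /=; rewrite mulmxA exprS.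
Qed.

Lemma patch1 T p : patch T [:: p] = translate (T p.1) p.2.
Proof. by rewrite /patch big_seq1. Qed.

Lemma subdivision_ge0 i j : 0 <= subdivision_matrix D i j.
Proof. by rewrite mxE. Qed.

Lemma subdivision_gt0 i j : 0 < subdivision_matrix D i j -> exists v, v \in D i j.
Proof. by rewrite mxE ltr0n cardfs_gt0 => /fset0Pn. Qed.

(** A positive entry of the k-th power of the subdivision matrix comes from a
    chain of k nonempty digit sets. *)
Lemma iter_subst_reach k i j x : 0 < (subdivision_matrix D ^+ k) i j ->
  exists y, (i, y) \in iter k subst [:: (j, x)].
Proof.
elim: k i => [|k IH] i.
  rewrite expr0 mxE; have [->|] := eqVneq i j; last by rewrite ltxx.
  by exists x; rewrite mem_head.
rewrite exprS => /mulmx_entry_gt0[||l [Sil /IH[y ky]]]; first exact: subdivision_ge0.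
  exact: exprmx_ge0 subdivision_ge0.
have [v vD] := subdivision_gt0 Sil.
by exists (v + A *m y); apply/mem_subst; exists l, y, v.
Qed.

Lemma positive_power_mul (M : 'M[R]_n) k N : (0 < N)%N ->
  (forall i j, 0 < (M ^+ k) i j) -> forall i j, 0 < (M ^+ (k * N)) i j.
Proof.
case: N => // N _ Mk; rewrite exprM; elim: N => [|N IH] i j; first by rewrite expr1.
rewrite exprS mxE (bigD1 i)//= ltr_pwDl ?mulr_gt0//.
by apply: sumr_ge0 => l _; rewrite mulr_ge0 // ltW.
Qed.

End Substitution.

(** * Compact solutions of multi-tile equations *)
Section GaugeFacts.
Context {R : realType} {d : nat}.
Notation V := 'cV[R]_d.+1.
Variables (A : 'M[R]_d.+1) (G : contracting_gauge A).

Lemma gauge_ge0 x : 0 <= G x.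
Proof. exact: le_trans (normr_ge0 x) (norm_le_gauge G x). Qed.

Lemma gauge_ratio_ge0 : 0 <= gauge_ratio G.
Proof. by have /andP[/ltW] := gauge_ratio_itv G. Qed.

Lemma gauge_iter k x : G (invmx A ^+ k *m x) <= gauge_ratio G ^+ k * G x.
Proof.
elim: k => [|k IH]; first by rewrite expr0 mul1mx mul1r.
rewrite !exprS -mulrA -[_ *m x]mulmxA.
by apply: le_trans (gauge_contract _ _) _; rewrite ler_wpM2l// gauge_ratio_ge0.
Qed.

Lemma gauge_ratio_small (e c : R) : 0 < e -> 0 <= c ->
  exists K, forall k, (K <= k)%N -> gauge_ratio G ^+ k * c < e.
Proof.
move=> e0 c0; have ec : 0 < e / (c + 1) by rewrite divr_gt0// ltr_wpDl.
have /andP[r0 r1] := gauge_ratio_itv G.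
have /cvgrPdist_lt/(_ _ ec)[K _ hK] : gauge_ratio G ^+ m @[m --> \oo] --> (0 : R).
  by apply: cvg_expr; rewrite gtr0_norm.
exists K => k Kk; have := hK k Kk.
rewrite /= sub0r normrN ger0_norm ?exprn_ge0 ?gauge_ratio_ge0//.
rewrite ltr_pdivlMr ?ltr_wpDl//; apply: le_lt_trans.
by rewrite ler_wpM2l ?exprn_ge0 ?gauge_ratio_ge0// lerDl.
Qed.

Lemma inverse_iter_small (e r : R) : 0 < e -> 0 <= r ->
  exists K, forall k, (K <= k)%N -> forall x : V, `|x| <= r ->
    `|invmx A ^+ k *m x| < e.
Proof.
move=> e0 r0; have := @gauge_ratio_small e (gauge_const G * r) e0.
have C0 := gauge_const_gt0 G.
case; first by rewrite mulr_ge0// ltW.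
move=> K hK; exists K => k /hK h x xr; apply: le_lt_trans h.
apply: le_trans (norm_le_gauge G _) _; apply: le_trans (gauge_iter k x) _.
rewrite ler_wpM2l ?exprn_ge0 ?gauge_ratio_ge0//.
by apply: le_trans (gauge_le_norm _ _) _; rewrite ler_pM2l.
Qed.

Lemma invmxX k : A \in unitmx -> invmx (A ^+ k) = invmx A ^+ k.
Proof.
move=> uA; have uAk : A ^+ k \in unitmx by rewrite unitrX.
have E : A ^+ k *m (invmx A ^+ k) = 1%:M.
  elim: k {uAk} => [|k IH]; first by rewrite !expr0 mulmx1.
  rewrite [A ^+ k.+1]exprSr exprS mulmxA -[A ^+ k * A *m _]mulmxA mulmxV// mulmx1.
  exact: IH.
by rewrite -[RHS](mulKmx uAk) E mulmx1.
Qed.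

Lemma gauge_power N : A \in unitmx -> (0 < N)%N -> inhabited (contracting_gauge (A ^+ N)).
Proof.
move=> uA N0; apply: inhabits.
apply: (@ContractingGauge _ _ (A ^+ N) G (gauge_ratio G) (gauge_const G)).
- exact: gauge_ratio_itv.
- exact: gauge_const_gt0.
- exact: gaugeD_le.
- exact: gaugeN.
- exact: norm_le_gauge.
- exact: gauge_le_norm.
move=> x; rewrite invmxX//; apply: le_trans (gauge_iter _ _) _.
rewrite ler_wpM2r ?gauge_ge0//; have /andP[/ltW r0 /ltW r1] := gauge_ratio_itv G.
by rewrite -[leRHS]expr1 ler_wiXn2l.
Qed.

End GaugeFacts.

Section Solutions.
Context {R : realType} {d n : nat}.
Notation V := 'cV[R]_d.+1.

Lemma family_bounded (T : 'I_n -> set V) : (forall i, compact (T i)) ->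
  exists2 r, 0 < r & forall i x, T i x -> `|x| <= r.
Proof.
move=> cT; have [r hr] := choice (fun i =>
  let: ex_intro2 r r0 h := compact_norm_bounded (cT i) in
  ex_intro (fun r => 0 <= r /\ forall x, T i x -> `|x| <= r) r (conj (ltW r0) h)).
exists (1 + \sum_i r i).
  by rewrite ltr_pwDl// sumr_ge0// => i _; case: (hr i).
move=> i x /(proj2 (hr i)) xr; apply: le_trans xr _.
rewrite (bigD1 i)//= addrCA lerDl addr_ge0// sumr_ge0// => j _.
by case: (hr j).
Qed.

(** Following the equation inwards m times shows that every point of [T i] is
    within a constant times ratio ^ m of [T' i]. *)
Lemma multi_tile_solution_sub (B : 'M[R]_d.+1) (G : contracting_gauge B)
    (E : 'I_n -> 'I_n -> set V) (T T' : 'I_n -> set V) : B \in unitmx ->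
  multi_tile_equation B E T -> multi_tile_equation B E T' ->
  (forall i, compact (T i)) -> (forall i, compact (T' i)) ->
  (forall i, T' i !=set0) -> forall i, T i `<=` T' i.
Proof.
move=> uB TE T'E cT cT' T'0.
have [r r0 Tr] := family_bounded cT; have [r' r'0 T'r] := family_bounded cT'.
pose C := gauge_const G * (r + r').
have C0 : 0 <= C by rewrite mulr_ge0 ?addr_ge0 ?ltW// gauge_const_gt0.
have approx m i x : T i x -> exists2 y, T' i y & G (x - y) <= gauge_ratio G ^+ m * C.
  elim: m i x => [|m IH] i x Tx.
    have [y Ty] := T'0 i; exists y => //; rewrite mul1r.
    apply: le_trans (gauge_le_norm _ _) _; rewrite ler_pM2l ?gauge_const_gt0//.
    by apply: le_trans (ler_normB _ _) _; rewrite lerD// ?(Tr i)// (T'r i).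
  have : (\bigcup_j Defs.minkowski (T j) (E j i)) (B *m x) by rewrite -TE; exists x.
  move=> [j _ [x' Tx' [v Ev vE]]]; have [y' Ty' xy'] := IH _ _ Tx'.
  have : (\bigcup_j Defs.minkowski (T' j) (E j i)) (y' + v).
    by exists j => //; exists y' => //; exists v.
  rewrite -T'E => -[y Ty yE]; exists y => //.
  have -> : x - y = invmx B *m (x' - y').
    apply: (can_inj (mulKmx uB)); rewrite mulKVmx// mulmxBr yE -vE.
    by rewrite opprD addrACA subrr addr0.
  apply: le_trans (gauge_contract _ _) _; rewrite exprS -mulrA.
  by rewrite ler_wpM2l// gauge_ratio_ge0.
move=> i x Tx; apply: closed_approx => [|e e0].
  by apply: compact_closed => //; exact: norm_hausdorff.
have [K hK] := gauge_ratio_small G e0 C0.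
have [y Ty xy] := approx K i x Tx; exists y => //.
apply: le_lt_trans (norm_le_gauge G _) _.
by apply: le_lt_trans xy _; exact: hK.
Qed.

(** Nonemptiness propagates along the chains of nonempty digit sets, which join
    any two types by primitivity. *)
Lemma multi_tile_solution_nonempty (B : 'M[R]_d.+1) (E : 'I_n -> 'I_n -> set V)
    (M : 'M[R]_n) (T : 'I_n -> set V) : B \in unitmx ->
  multi_tile_equation B E T -> primitive M ->
  (forall i j, 0 < M i j -> E i j !=set0) ->
  (exists i, T i !=set0) -> forall j, T j !=set0.
Proof.
move=> uB TE [M0 [k k0 Mk]] ME [i Ti] j.
suff : forall m l, 0 < (M ^+ m) i l -> T l !=set0 by move=> /(_ k j); apply.
elim=> [|m IH] l; first by rewrite expr0 mxE; case: eqVneq => [<-|_] //; rewrite ltxx.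
rewrite exprSr => /mulmx_entry_gt0[||h [/IH[x Tx] /ME[v Ev]]] //; first exact: exprmx_ge0.
have : (\bigcup_q Defs.minkowski (T q) (E q l)) (x + v).
  by exists h => //; exists x => //; exists v.
by rewrite -TE => -[y Ty _]; exists y.
Qed.

Lemma compact_solution_unique (B : 'M[R]_d.+1) (G : contracting_gauge B)
    (E : 'I_n -> 'I_n -> set V) (M : 'M[R]_n) (T : 'I_n -> set V) :
  B \in unitmx -> primitive M -> (forall i j, 0 < M i j -> E i j !=set0) ->
  compact_solution B E T -> unique_compact_solution B E T.
Proof.
move=> uB pM ME [TE T0 cT]; split => // T' [T'E T'0 cT'].
have nT := multi_tile_solution_nonempty uB TE pM ME T0.
have nT' := multi_tile_solution_nonempty uB T'E pM ME T'0.
by apply/funext => i; apply/seteqP; split;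
  [apply: (multi_tile_solution_sub G uB T'E TE) | apply: (multi_tile_solution_sub G uB TE T'E)].
Qed.

(** Pigeonhole: a choice among finitely many alternatives that can be made at
    each stage can be made once for all stages. *)
Lemma decreasing_has (I : eqType) (s : seq I) (P : nat -> I -> Prop) :
  (forall m q, P m.+1 q -> P m q) -> (forall m, exists2 q, q \in s & P m q) ->
  exists2 q, q \in s & forall m, P m q.
Proof.
move=> decr; have dec m k q : P (m + k)%N q -> P m q.
  by elim: k => [|k IH]; rewrite ?addn0// addnS => /decr.
elim: s => [h|q s IH h]; first by have [q] := h 0%N.
have [allq|/existsNP[m nPm]] := pselect (forall m, P m q).
  by exists q; rewrite ?mem_head.
have [|q' q's Pq'] := IH.
  move=> k; have [q'] := h (m + k)%N; rewrite inE => /orP[/eqP -> /dec //|q's Pq'].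
  by exists q' => //; apply: (dec k m); rewrite addnC.
by exists q' => //; rewrite inE q's orbT.
Qed.

(** A cluster point of a sequence of points [x m] of [F m] lies in each [F m]. *)
Lemma nested_compact_nonempty (F : nat -> set V) : (forall m, compact (F m)) ->
  (forall m, F m !=set0) -> (forall m, F m.+1 `<=` F m) -> (\bigcap_m F m) !=set0.
Proof.
move=> cF F0 dF; have [x Fx] := choice F0.
have dec m k : F (m + k)%N `<=` F m.
  by elim: k => [|k IH]; rewrite ?addn0// addnS; exact: subset_trans (dF _) IH.
have : (x @ \oo) (F 0%N).
  by exists 0%N => // m _; apply: (dec 0%N m); rewrite add0n.
move=> /(cF 0%N (x @ \oo) _) [y [_ cy]]; exists y => m _.
have clm : closed (F m) by apply: compact_closed => //; exact: norm_hausdorff.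
apply: clm => B yB; apply: cy => //.
by exists m => // k mk; rewrite -(subnKC mk) in Fx *; exact: (dec m (k - m)%N) (Fx _).
Qed.

(** The solution is the intersection of the iterates of the contracting
    set-valued operator on a large ball of the gauge, which it maps into
    itself. *)
Theorem compact_solution_exists (A : 'M[R]_d.+1) (G : contracting_gauge A)
    (D : 'I_n -> 'I_n -> {fset V}) : A \in unitmx -> (0 < n)%N ->
  primitive (subdivision_matrix D) ->
  exists T, unique_compact_solution A (digit_sets D) T.
Proof.
move=> uA n0 pS.
suff [T cT] : exists T, compact_solution A (digit_sets D) T.
  exists T; apply: (compact_solution_unique G uA pS) cT => i j /subdivision_gt0 [v vD].
  by exists v.
have /andP[r0 r1] := gauge_ratio_itv G; set r := gauge_ratio G in r0 r1.
have r1' : 0 < 1 - r by rewrite subr_gt0.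
pose delta := \sum_i \sum_(q <- digit_tiles D i) G q.2.
have delta0 : 0 <= delta by do 2![apply: sumr_ge0 => ? _]; exact: gauge_ge0.
have Gdelta i q : q \in digit_tiles D i -> G q.2 <= delta.
  move=> qi; rewrite /delta (bigD1 i)//= (big_rem _ qi)/= -addrA lerDl addr_ge0//.
    by apply: sumr_ge0 => ? _; exact: gauge_ge0.
  by do 2![apply: sumr_ge0 => ? _]; exact: gauge_ge0.
(* The least radius with [r * (rho + delta) <= rho], so that the ball [W] of
   the gauge is mapped into itself. *)
pose rho := r * delta / (1 - r).
have rho0 : 0 <= rho by rewrite divr_ge0 ?mulr_ge0 ?(ltW r0) ?(ltW r1').
have rhoE : r * (rho + delta) = rho.
  by rewrite /rho; field; rewrite gt_eqF.
pose Phi (T : 'I_n -> set V) : 'I_n -> set V := fun i =>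
  [set x | exists2 q, q \in digit_tiles D i & T q.1 (A *m x - q.2)].
pose W : 'I_n -> set V := fun=> [set x | G x <= rho].
pose F m := iter m Phi W.
have Phi_mono T T' : (forall i, T i `<=` T' i) -> forall i, Phi T i `<=` Phi T' i.
  by move=> TT' i x [q qi Tq]; exists q => //; exact: TT'.
have FW : forall i, Phi W i `<=` W i.
  move=> i x [q qi /= Wq]; rewrite /W/= -[x](mulKmx uA).
  apply: le_trans (gauge_contract _ _) _; rewrite -/r -rhoE ler_pM2l//.
  rewrite -[A *m x](subrK q.2); apply: le_trans (gaugeD_le _ _ _) _.
  by rewrite lerD// (Gdelta i).
have Fdec m i : F m.+1 i `<=` F m i.
  elim: m i => [|m IH] i; first exact: FW.
  exact: Phi_mono.
have Ginv (x y : V) : `|G x - G y| <= gauge_const G * `|x - y|.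
  have GB (u v : V) : G u - G v <= gauge_const G * `|u - v|.
    rewrite lerBlDr; apply: le_trans (lerD (gauge_le_norm _ _) (lexx _)).
    by rewrite -{1}[u](subrK v) gaugeD_le.
  by rewrite ler_norml GB andbT lerNl opprB distrC GB.
have Fclosed m i : closed (F m i).
  elim: m i => [|m IH] i.
    apply: (@closed_comp _ _ (G : V -> R) [set t | t <= rho]); last exact: closed_le.
    move=> x _; exact: (lipschitz_continuous Ginv).
  rewrite [F _ _](_ : _ = \bigcup_(q in [set` digit_tiles D i])
      ((fun x => A *m x - q.2) @^-1` F m q.1)); last first.
    by apply/seteqP; split => x [q ? ?]; exists q.
  apply: closed_bigcup => [|q _]; first exact: finite_seq.
  apply: closed_comp; last exact: IH.
  move=> x _; apply: (@cvgB _ _ _ (nbhs x)); last exact: cvg_cst.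
  exact: mulmx_continuous.
have Fcompact m i : compact (F m i).
  apply: (@cV_bounded_closed_compact _ _ _ rho); last exact: Fclosed.
  move=> x Fx; apply: le_trans (norm_le_gauge G x) _.
  suff : forall k, F k i `<=` W i by apply; exact: Fx.
  by elim=> // k IH; exact: subset_trans (Fdec k i) IH.
have succ i : exists q, q \in digit_tiles D i.
  have [S0 [k k0 Sk]] := pS; rewrite -(prednK k0) in Sk.
  have := Sk i i; rewrite exprSr => /mulmx_entry_gt0[||l [_ Sli]] //; first exact: exprmx_ge0.
  by have [v vD] := subdivision_gt0 Sli; exists (l, v); rewrite mem_digit_tiles.
have F0 m i : F m i !=set0.
  elim: m i => [|m IH] i.
    exists 0; rewrite /F/= /W/=; have := gauge_le_norm G 0.
    by rewrite normr0 mulr0 => /le_trans; apply.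
  have [q qi] := succ i; have [x Fx] := IH q.1.
  exists (invmx A *m (x + q.2)); exists q => //.
  by rewrite mulKVmx// addrK.
pose T i := \bigcap_m F m i.
exists T; split.
- apply/(multi_tile_equationP _ _ uA) => i x; split.
    move=> Tx; have [m q|m|q qi hq] := @decreasing_has _ (digit_tiles D i)
        (fun m q => F m q.1 (A *m x - q.2)).
    + exact: Fdec.
    + exact: (Tx m.+1 I).
    + by exists q => // m _.
  move=> [q qi hq] m _; case: m => [|m]; last by exists q => //; exact: hq.
  by apply: Fdec; exists q => //; exact: hq.
- exists (Ordinal n0).
  by apply: nested_compact_nonempty => m; [exact: Fcompact|exact: F0|exact: Fdec].
- move=> i; apply: (subclosed_compact _ (Fcompact 0%N i)).
    by apply: closed_bigI => m _; exact: Fclosed.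
  by move=> x /(_ 0%N I).
Qed.

End Solutions.

(** * Iterated digit sets *)
Section IteratedDigits.
Context {R : realType} {d n : nat}.
Notation V := 'cV[R]_d.+1.
Variables (A : 'M[R]_d.+1) (D : 'I_n -> 'I_n -> {fset V}).

Lemma mem_big_cat (I X : eqType) (r : seq I) (P : pred I) (F : I -> seq X) x :
  x \in \big[cat/[::]]_(i <- r | P i) F i <->
  exists i, [/\ i \in r, P i & x \in F i].
Proof.
elim: r => [|i r IH]; first by rewrite big_nil; split => // -[i []].
rewrite big_cons; case: ifPn => Pi; last first.
  rewrite IH; split=> -[k [kr Pk xk]]; exists k; split => //.
    by rewrite inE kr orbT.
  by move: kr; rewrite inE => /orP[/eqP ki|//]; rewrite ki (negbTE Pi) in Pk.
rewrite mem_cat; split.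
  case/orP=> [xi|/IH[k [kr Pk xk]]]; first by exists i; rewrite mem_head.
  by exists k; rewrite inE kr orbT.
move=> [k [+ Pk xk]]; rewrite inE => /orP[/eqP <-|kr]; first by rewrite xk.
by apply/orP; right; apply/IH; exists k.
Qed.

Lemma mem_big_add (r : seq nat) (F : nat -> seq V) x : uniq r ->
  x \in \big[(fun s t => [seq x + y | x <- s, y <- t])/[:: 0]]_(k <- r) F k <->
  exists2 u : nat -> V, (forall k, k \in r -> u k \in F k) & x = \sum_(k <- r) u k.
Proof.
elim: r x => [|k r IH] x /=.
  rewrite big_nil inE; split=> [/eqP ->|[u _]]; last by rewrite big_nil => ->.
  by exists (fun=> 0) => //; rewrite big_nil.
move=> /andP[kr ur]; rewrite big_cons; split.
  move=> /allpairsP[[a b] /= [aF /IH-/(_ ur) [u uF ->] ->]].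
  exists (fun l => if l == k then a else u l).
    move=> l; rewrite inE; case: eqP => [-> //|_ /= lr]; exact: uF.
  rewrite big_cons eqxx; congr (_ + _); rewrite big_seq [RHS]big_seq.
  by apply: eq_bigr => l lr; case: eqP => // lk; rewrite -lk lr in kr.
move=> [u uF ->]; rewrite big_cons; apply/allpairsP.
exists (u k, \sum_(l <- r) u l); split => //=; first by apply: uF; rewrite mem_head.
by apply/IH => //; exists u => // l lr; apply: uF; rewrite inE lr orbT.
Qed.

(** The chains of types and digits that contribute to a digit of the N-th
    iterate, in a form suited to induction on N. *)
Definition digit_path N (i j : 'I_n) (x : V) :=
  exists (p : nat -> 'I_n) (u : nat -> V), [/\ p 0%N = i, p N = j,
    forall k, (k < N)%N -> u k \in D (p k) (p k.+1) &
    x = \sum_(k < N) A ^+ k *m u k].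

Lemma iter_digitsP N i j x : x \in iter_digits A D N i j <-> digit_path N i j x.
Proof.
pose F (p : nat -> 'I_n) k : seq V := [seq A ^+ k *m v | v <- (D (p k) (p k.+1) : seq V)].
have FE (f : {ffun 'I_N.+1 -> 'I_n}) :
  \big[(fun s t => [seq x + y | x <- s, y <- t])/[:: 0]]_(k < N)
     [seq A ^+ k *m x | x <- D (f (widen_ord (leqnSn N) k)) (f (lift ord0 k))] =
  \big[(fun s t => [seq x + y | x <- s, y <- t])/[:: 0]]_(k <- iota 0 N)
     F (fun k => f (inord k)) k.
  rewrite -[N in iota 0 N]subn0 -/(index_iota 0 N) big_mkord; apply: eq_bigr => k _.
  have -> : widen_ord (leqnSn N) k = inord k.
    by apply: val_inj; rewrite /= inordK// ltnS ltnW.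
  have -> : lift ord0 k = inord k.+1.
    by apply: val_inj; rewrite /= inordK// ltnS.
  by [].
have sumE (u : nat -> V) : \sum_(k <- iota 0 N) u k = \sum_(k < N) u k.
  by rewrite -[N in iota 0 N]subn0 -/(index_iota 0 N) big_mkord.
rewrite /iter_digits mem_big_cat; split.
  move=> [f [_ /andP[/eqP fi /eqP fj]]]; rewrite FE => /(mem_big_add _ _ (iota_uniq 0 N)).
  move=> [u uF ->]; rewrite sumE.
  have hu k : exists w, (k < N)%N ->
      w \in D (f (inord k)) (f (inord k.+1)) /\ u k = A ^+ k *m w.
    have [kN|_] := ltnP k N; last by exists 0.
    have /mapP[w wD wE] : u k \in F (fun k => f (inord k)) k.
      by apply: uF; rewrite mem_iota.
    by exists w.
  have [w hw] := choice hu.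
  exists (fun k => f (inord k)), w; split.
  - by rewrite -fi; congr (f _); apply: val_inj; rewrite /= inordK.
  - by rewrite -fj; congr (f _); apply: val_inj; rewrite /= inordK.
  - by move=> k /hw[].
  - by apply: eq_bigr => k _; have [] := hw k.
move=> [p [u [p0 pN pD ->]]]; exists [ffun k : 'I_N.+1 => p k]; split.
- by rewrite mem_index_enum.
- by rewrite !ffunE p0 pN !eqxx.
rewrite FE; apply/(mem_big_add _ _ (iota_uniq 0 N)).
exists (fun k => A ^+ k *m u k); last by rewrite sumE.
move=> k; rewrite mem_iota/= add0n => kN; apply: map_f.
by rewrite !ffunE !inordK ?pD// ltnS ltnW.
Qed.

(** The first type and digit of a path are those of the last substitution. *)
Lemma iter_substP N i j x :
  (i, x) \in iter N (subst A D) [:: (j, 0)] <-> digit_path N i j x.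
Proof.
elim: N i x => [|N IH] i x.
  rewrite inE; split=> [/eqP[-> ->]|[p [u [<- <- _ ->]]]]; last by rewrite big_ord0.
  by exists (fun=> j), (fun=> 0); split => //; rewrite big_ord0.
have recE (u : nat -> V) : \sum_(k < N.+1) A ^+ k *m u k =
    u 0%N + A *m \sum_(k < N) A ^+ k *m u k.+1.
  rewrite big_ord_recl expr0 mul1mx; congr (_ + _); rewrite mulmx_sumr.
  by apply: eq_bigr => k _; rewrite mulmxA exprS.
split.
  move=> /mem_subst[l [y [v [/IH[p [u [p0 pN pD ->]]] vD ->]]]].
  pose u' k : V := if k is k'.+1 return V then u k' else v.
  exists (fun k => if k is k'.+1 then p k' else i), u'; split => //.
  by case=> [|k] kN; [rewrite p0 | exact: pD].
move=> [p [u [p0 pN pD ->]]]; apply/mem_subst.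
exists (p 1%N), (\sum_(k < N) A ^+ k *m u k.+1), (u 0%N); split.
- by apply/IH; exists (fun k => p k.+1), (fun k => u k.+1); split => // k kN; exact: pD.
- by rewrite -p0; exact: pD.
- exact: recE.
Qed.

Lemma iter_digit_setsE N i j :
  iter_digit_sets A D N i j = [set x | (i, x) \in iter N (subst A D) [:: (j, 0)]].
Proof.
by apply/seteqP; split=> x /=; [move=> /iter_digitsP/iter_substP | move=> /iter_substP/iter_digitsP].
Qed.

(** Inflating a tile N times gives the equation of the N-th iterate, and the
    uniqueness criterion still applies to it because the powers of a primitive
    matrix are primitive. *)
Theorem iter_unique_compact_solution (G : contracting_gauge A) T N :
  A \in unitmx -> (0 < N)%N -> primitive (subdivision_matrix D) ->
  unique_compact_solution A (digit_sets D) T ->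
  unique_compact_solution (A ^+ N) (iter_digit_sets A D N) T.
Proof.
move=> uA N0 [S0 [k k0 Sk]] [[TE T0 cT] _].
have uAN : A ^+ N \in unitmx by rewrite unitrX.
have [GN] := gauge_power G uA N0.
apply: (compact_solution_unique (M := subdivision_matrix D ^+ N) GN uAN) => //.
- split=> [i j|]; first exact: exprmx_ge0.
  exists k => // i j; rewrite -exprM mulnC; exact: positive_power_mul.
- move=> i j Sij; rewrite iter_digit_setsE.
  by have [y] := iter_subst_reach A 0 Sij; exists y.
split => // i; have := patch_iter_subst N [:: (i, 0)] uA TE.
rewrite patch1 translate0.
move=> <-; apply/seteqP; split=> [x /patchP[[j v] js Tj]|x [j _ [y Ty [v]]]].
  exists j => //; exists (x - v) => //; exists v; last by rewrite subrK.
  by rewrite iter_digit_setsE.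
rewrite iter_digit_setsE => jv <-; apply/patchP; exists (j, v) => //=.
by rewrite addrK.
Qed.

End IteratedDigits.

(** * Real volumes and packings *)
Section RealVolume.
Context {R : realType} {d : nat}.
Notation V := 'cV[R]_d.+1.
Notation vol := (@lebesgue_vol R d.+1).
Implicit Types X Y : set V.

Definition norm_bounded X := exists r : R, forall x, X x -> `|x| <= r.

(** Meant for bounded sets: [fine] sends an infinite volume to 0. *)
Definition rvol X : R := fine (vol X).

Lemma rvolE X : norm_bounded X -> vol X = (rvol X)%:E.
Proof. by move=> [r Xr]; rewrite fineK// (bounded_vol_fin Xr). Qed.

Lemma rvol_ge0 X : 0 <= rvol X.
Proof. by apply: fine_ge0; exact: lebesgue_vol_ge0. Qed.

Lemma norm_boundedS X Y : X `<=` Y -> norm_bounded Y -> norm_bounded X.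
Proof. by move=> XY [r Yr]; exists r => x /XY; exact: Yr. Qed.

Lemma norm_boundedU X Y : norm_bounded X -> norm_bounded Y -> norm_bounded (X `|` Y).
Proof.
move=> [r Xr] [t Yt]; exists (Num.max r t) => x [/Xr|/Yt] h.
  by rewrite le_max h.
by rewrite le_max h orbT.
Qed.

Lemma norm_bounded_compact X : compact X -> norm_bounded X.
Proof. by move=> /compact_norm_bounded[r _ h]; exists r. Qed.

Lemma norm_bounded_translate X v : norm_bounded X -> norm_bounded (translate X v).
Proof.
move=> [r Xr]; exists (r + `|v|) => _ [x /Xr xr <-].
by apply: le_trans (ler_normD _ _) _; rewrite lerD2r.
Qed.

Lemma norm_bounded_cell s z : 0 < s -> norm_bounded (@cell R d s z).
Proof. by move=> s0; exists (s + `|s *: map_mx intr z : V|); exact: cell_bounded. Qed.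

Lemma le_rvol X Y : norm_bounded Y -> X `<=` Y -> rvol X <= rvol Y.
Proof.
move=> bY XY; rewrite -lee_fin -!rvolE//; last exact: norm_boundedS bY.
exact: le_outer_measure.
Qed.

Lemma rvolU_le X Y : norm_bounded X -> norm_bounded Y ->
  rvol (X `|` Y) <= rvol X + rvol Y.
Proof.
move=> bX bY; rewrite -lee_fin EFinD -!rvolE//; last exact: norm_boundedU.
exact: outer_measureU2.
Qed.

Lemma norm_bounded_bigU (I : Type) (s : seq I) (F : I -> set V) :
  (forall i, norm_bounded (F i)) -> norm_bounded (\big[setU/set0]_(i <- s) F i).
Proof.
by move=> bF; elim/big_ind : _ => //; [exists 0 | exact: norm_boundedU].
Qed.

Lemma rvol0 : rvol set0 = 0.
Proof. by rewrite /rvol lebesgue_vol0. Qed.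

Lemma rvol_bigU_le (I : Type) (s : seq I) (F : I -> set V) :
  (forall i, norm_bounded (F i)) ->
  rvol (\big[setU/set0]_(i <- s) F i) <= \sum_(i <- s) rvol (F i).
Proof.
move=> bF; elim: s => [|i s IH]; first by rewrite !big_nil rvol0.
rewrite !big_cons; apply: le_trans (rvolU_le _ _) _ => //.
  exact: norm_bounded_bigU.
by rewrite lerD2l.
Qed.

Lemma rvol_linear (M : 'M[R]_d.+1) X : M \in unitmx ->
  rvol [set M *m x | x in X] = `|\det M| * rvol X.
Proof.
move=> uM; rewrite /rvol lebesgue_vol_linear//.
have [h|/eqP h] := eqVneq (vol X) +oo%E; last first.
  by rewrite fineM// ge0_fin_numE ?lebesgue_vol_ge0// ltey; exact/eqP.
rewrite h gt0_muley ?lte_fin ?normr_gt0 ?mulr0//.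
by move: uM; rewrite unitmxE unitfE.
Qed.

Lemma rvol_translate X v : rvol (translate X v) = rvol X.
Proof. by rewrite /rvol lebesgue_vol_translate. Qed.

Lemma rvol_split X Y : norm_bounded X -> vol.-caratheodory Y ->
  rvol X = rvol (X `&` Y) + rvol (X `&` ~` Y).
Proof.
move=> bX mY; have bI Z : norm_bounded (X `&` Z) by apply: norm_boundedS bX => x [].
by apply: EFin_inj; rewrite EFinD -!rvolE//; exact: mY.
Qed.

(** The measurability of [X] cuts both the union and [Y] along [X]. *)
Lemma rvol_additive_null X Y : compact X -> norm_bounded Y ->
  rvol X + rvol Y <= rvol (X `|` Y) -> vol (X `&` Y) = 0%E.
Proof.
move=> cX bY le; have bX := norm_bounded_compact cX.
have mX := compact_caratheodory cX.
have E1 := rvol_split (norm_boundedU bX bY) mX.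
have E2 := rvol_split bY mX.
have s1 : (X `|` Y) `&` X = X by rewrite setIC; apply/setIidPl; exact: subsetUl.
have s2 : (X `|` Y) `&` ~` X = Y `&` ~` X.
  by rewrite setIUl setICr set0U.
rewrite s1 s2 in E1; rewrite setIC rvolE; last by apply: norm_boundedS bY => x [].
congr (_%:E); apply/le_anti; rewrite rvol_ge0 andbT; lra.
Qed.

Lemma cells_rvol_le s (Z : seq 'cV[int]_d.+1) X : 0 < s -> uniq Z -> norm_bounded X ->
  \sum_(z <- Z) rvol (X `&` cell s z) <= rvol X.
Proof.
move=> s0 uZ bX; have b z : norm_bounded (X `&` cell s z).
  by apply: norm_boundedS bX => x [].
rewrite -lee_fin -sumEFin; under eq_bigr do rewrite -rvolE//.
rewrite -cells_additive// -rvolE//.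
by apply: le_outer_measure => x [].
Qed.

Definition cell_rvol : R := fine (@unit_cell_vol R d).

Lemma cell_rvol_gt0 : 0 < cell_rvol.
Proof. by rewrite fine_gt0// unit_cell_vol_gt0 -ge0_fin_numE ?unit_cell_vol_fin ?lebesgue_vol_ge0. Qed.

Lemma rvol_cell s z : 0 < s -> rvol (cell s z) = s ^+ d.+1 * cell_rvol.
Proof. by move=> s0; rewrite /rvol cell_vol// fineM// unit_cell_vol_fin. Qed.

Lemma rvol_norm_ball_gt0 (x : V) (r : R) X : 0 < r -> norm_bounded X ->
  (forall y, `|y - x| <= r -> X y) -> r ^+ d.+1 * cell_rvol <= rvol X.
Proof.
move=> r0 bX h; rewrite -(rvol_cell 0 r0) -(rvol_translate _ x); apply: le_rvol => //.
move=> _ [y y0 <-]; apply: h; rewrite addrK -[y]subr0; apply: (cell_diam r0 y0).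
by move=> i; rewrite !mxE mulr0 lexx add0r mulr1.
Qed.

Lemma compact_rvol_neighborhood X c : compact X -> rvol X < c ->
  exists2 e, 0 < e & forall Y,
    (forall y, Y y -> exists2 x, X x & `|x - y| < e) -> rvol Y < c.
Proof.
move=> cX; rewrite -lte_fin -rvolE; last exact: norm_bounded_compact.
move=> /(compact_vol_neighborhood cX)[e e0 he]; exists e => // Y YX.
have [r Xr] := norm_bounded_compact cX.
rewrite -lte_fin -rvolE; first exact: he.
exists (r + e) => y /YX[x /Xr xr xy].
rewrite -[y](subrKC x) addrC; apply: le_trans (ler_normD _ _) _.
by rewrite addrC lerD// distrC ltW.
Qed.

Lemma compact_translate X v : compact X -> compact (translate X v).
Proof.
apply: continuous_compact; apply: continuous_subspaceT => x.
by apply: (@cvgD _ _ _ (nbhs x)); [exact: cvg_id | exact: cvg_cst].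
Qed.

End RealVolume.

Section Packing.
Context {R : realType} {d n : nat}.
Notation V := 'cV[R]_d.+1.
Notation tile := ('I_n * V)%type.
Notation vol := (@lebesgue_vol R d.+1).
Variables (A : 'M[R]_d.+1) (D : 'I_n -> 'I_n -> {fset V}) (T : 'I_n -> set V).
Hypothesis cT : forall i, compact (T i).
Implicit Types (s t : seq tile) (p q : tile).

Definition tile_volumes : 'rV[R]_n := \row_i rvol (T i).

Definition tile_set p : set V := translate (T p.1) p.2.

Lemma tile_set_compact p : compact (tile_set p).
Proof. exact: compact_translate. Qed.

Lemma tile_set_bounded p : norm_bounded (tile_set p).
Proof. exact/norm_bounded_compact/tile_set_compact. Qed.

Lemma patch_bounded s : norm_bounded (patch T s).
Proof. by apply: norm_bounded_bigU => p; exact: tile_set_bounded. Qed.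

Lemma patch_cat s t : patch T (s ++ t) = patch T s `|` patch T t.
Proof. by rewrite /patch big_cat. Qed.

Lemma weight_cat w s t : weight w (s ++ t) = weight w s + weight w t :> R.
Proof. by rewrite /weight big_cat. Qed.

Lemma weight_tile_volumes s : weight tile_volumes s = \sum_(p <- s) rvol (tile_set p).
Proof. by apply: eq_bigr => p _; rewrite mxE rvol_translate. Qed.

Lemma rvol_patch_le s : rvol (patch T s) <= weight tile_volumes s.
Proof. by rewrite weight_tile_volumes; apply: rvol_bigU_le => p; exact: tile_set_bounded. Qed.

(** A list of tiles is packed when no volume is lost in the union, that is,
    when its tiles overlap in null sets only. *)
Definition packed s := rvol (patch T s) = weight tile_volumes s.

Lemma packed1 p : packed [:: p].
Proof. by rewrite /packed weight_tile_volumes patch1 big_seq1. Qed.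

(** The volume of a union is at most the sum of the volumes, so a loss in a
    part of a list is a loss in the whole list. *)
Lemma packed_catl s t : packed (s ++ t) -> packed s.
Proof.
rewrite /packed patch_cat weight_cat => h.
apply/le_anti; rewrite rvol_patch_le/=.
have := rvolU_le (patch_bounded s) (patch_bounded t).
rewrite h; have := rvol_patch_le t; lra.
Qed.

Lemma patch_eq_mem s t : s =i t -> patch T s = patch T t.
Proof.
move=> st; apply/seteqP; split=> x /patchP[p ps Tp]; apply/patchP; exists p => //.
  by rewrite -st.
by rewrite st.
Qed.

Lemma packed_perm s t : perm_eq s t -> packed s -> packed t.
Proof.
move=> st; rewrite /packed (patch_eq_mem (perm_mem st)) => ->.
exact: perm_big.
Qed.

Lemma packed_filter (a : pred tile) s : packed s -> packed [seq p <- s | a p].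
Proof.
move=> ps; apply: (@packed_catl _ [seq p <- s | ~~ a p]).
by apply: packed_perm ps; rewrite perm_sym; exact/permPl/perm_filterC.
Qed.

Lemma packed_overlap p q s t : packed s -> perm_eq s (p :: q :: t) ->
  vol (tile_set p `&` tile_set q) = 0%E.
Proof.
move=> ps st; have /packed_catl h : packed ([:: p; q] ++ t) by exact: packed_perm ps.
apply: rvol_additive_null; [exact: tile_set_compact|exact: tile_set_bounded|].
by move: h; rewrite /packed weight_tile_volumes /patch !big_cons !big_nil addr0 setU0 => ->.
Qed.

Hypothesis T0 : forall i, 0 < rvol (T i).

Lemma tile_set_vol_gt0 p : (0 < vol (tile_set p))%E.
Proof. by rewrite rvolE ?lte_fin ?rvol_translate//; exact: tile_set_bounded. Qed.

(** A repeated tile would overlap itself in a set of positive volume. *)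
Lemma packed_uniq s : packed s -> uniq s.
Proof.
elim: s => [//|p s IH] ps; rewrite cons_uniq; apply/andP; split; last first.
  apply: IH; apply: (@packed_catl s [:: p]); apply: packed_perm ps.
  by rewrite -cat1s perm_catC.
apply/negP => p's; have := tile_set_vol_gt0 p.
rewrite -[tile_set p]setIid (packed_overlap (t := rem p s) ps) ?ltxx//.
by rewrite perm_cons perm_to_rem.
Qed.

Lemma packed_null s p q : packed s -> p \in s -> q \in s -> p != q ->
  vol (tile_set p `&` tile_set q) = 0%E.
Proof.
move=> ps pS qS pq; apply: (packed_overlap (s := s) (t := rem q (rem p s))) => //.
apply: perm_trans (perm_to_rem pS) _; rewrite perm_cons; apply: perm_to_rem.
by move: qS; rewrite (perm_mem (perm_to_rem pS)) inE eq_sym (negbTE pq).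
Qed.

Lemma packed_size_le s X (m : R) : packed s -> norm_bounded X ->
  (forall i, m <= rvol (T i)) -> (forall p, p \in s -> tile_set p `<=` X) ->
  (size s)%:R * m <= rvol X.
Proof.
move=> ps bX mT sX; apply: (@le_trans _ _ (weight tile_volumes s)).
  rewrite /weight -sum1_size natr_sum mulr_suml; apply: ler_sum => p _.
  by rewrite mul1r mxE.
rewrite -ps; apply: le_rvol => // x; rewrite /patch -bigcup_seq => -[p ps' Tp].
exact: sX Tp.
Qed.

Hypothesis (uA : A \in unitmx) (TE : multi_tile_equation A (digit_sets D) T).

(** The tiles of the inflated tile [A T_i] have total volume at least
    [|det A|] times that of [T_i]; pairing with a positive right eigenvector
    of the subdivision matrix turns these inequalities into equalities. *)
Lemma tile_volumes_eigen (v : 'cV[R]_n) : (forall i, 0 < v i 0) ->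
  subdivision_matrix D *m v = `|\det A| *: v ->
  tile_volumes *m subdivision_matrix D = `|\det A| *: tile_volumes.
Proof.
move=> v0 Sv; pose u := tile_volumes *m subdivision_matrix D - `|\det A| *: tile_volumes.
have u0 i : 0 <= u 0 i.
  have := rvol_patch_le (subst A D [:: (i, 0)]).
  rewrite (patch_subst _ uA TE) patch1 rvol_linear// rvol_translate weight_subst.
  by rewrite /weight big_seq1 /u !mxE subr_ge0.
have uv : \sum_i u 0 i * v i 0 = 0.
  have : (u *m v) 0 0 = 0 by rewrite mulmxBl -mulmxA Sv -scalemxAl -scalemxAr subrr mxE.
  by rewrite mxE.
apply/eqP; rewrite -subr_eq0; apply/eqP/rowP => i; rewrite [RHS]mxE.
have uv0 j : true -> 0 <= u 0 j * v j 0 by move=> _; rewrite mulr_ge0// ltW.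
have /eqP : u 0 i * v i 0 = 0 by exact: (psumr_eq0P uv0 uv).
by rewrite mulf_eq0 [v i 0 == 0]gt_eqF// orbF => /eqP.
Qed.

(** Inflation multiplies both the volume of a patch and its weight by
    [|det A|]. *)
Lemma packed_subst s :
  tile_volumes *m subdivision_matrix D = `|\det A| *: tile_volumes ->
  packed s -> packed (subst A D s).
Proof.
move=> TS ps; rewrite /packed (patch_subst _ uA TE) rvol_linear// ps.
by rewrite weight_subst TS weightZ.
Qed.

Lemma packed_iter_subst N s :
  tile_volumes *m subdivision_matrix D = `|\det A| *: tile_volumes ->
  packed s -> packed (iter N (subst A D) s).
Proof. by move=> TS ps; elim: N => //= N; exact: packed_subst. Qed.

End Packing.

(** * Weakly uniformly discrete fixed families *)
Section EuclideanNorm.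
Context {R : realType} {d : nat}.
Notation V := 'cV[R]_d.+1.

Lemma enorm_le (x : V) (r : R) : `|x| <= r -> enorm x <= d.+1%:R * r.
Proof.
move=> xr; have r0 : 0 <= r by exact: le_trans xr.
have -> : d.+1%:R * r = Num.sqrt ((d.+1%:R * r) ^+ 2).
  by rewrite sqrtr_sqr ger0_norm// mulr_ge0.
rewrite /enorm ler_wsqrtr//; apply: (@le_trans _ _ (\sum_(i < d.+1) r ^+ 2)).
  apply: ler_sum => i _; rewrite -real_normK ?num_real//.
  by rewrite lerXn2r ?nnegrE//; exact: le_trans (coord_le_norm _ _ _) xr.
rewrite sumr_const card_ord -[leLHS]mulr_natl exprMn ler_wpM2r ?sqr_ge0//.
by rewrite expr2 ler_peMl// ler1n.
Qed.

Lemma norm_le_enorm (x : V) : `|x| <= enorm x.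
Proof.
apply: norm_le_coord => [|i j]; first exact: sqrtr_ge0.
rewrite (ord1 j) -sqrtr_sqr ler_wsqrtr// (bigD1 i)//= lerDl.
by apply: sumr_ge0 => l _; exact: sqr_ge0.
Qed.

End EuclideanNorm.

Section PositiveVolume.
Context {R : realType} {d n : nat}.
Notation V := 'cV[R]_d.+1.
Notation tile := ('I_n * V)%type.
Variables (A : 'M[R]_d.+1) (G : contracting_gauge A).
Variables (D : 'I_n -> 'I_n -> {fset V}) (T : 'I_n -> set V).
Hypotheses (uA : A \in unitmx) (TE : multi_tile_equation A (digit_sets D) T).
Hypotheses (cT : forall i, compact (T i)) (nT : forall i, T i !=set0).
Hypothesis pS : primitive (subdivision_matrix D).

(** The tiles of type [i] in [B] are grouped by position; the positions form a
    finite subset of [B]. *)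
Lemma count_le_mcount (s : seq tile) (X : multiset R d.+1) i (B : set V) :
  (forall x, (count_family s i x <= X x)%N) ->
  ((count (fun p => (p.1 == i) && `[< B p.2 >]) s)%:R%:E <= mcount X B)%E.
Proof.
move=> sX; pose a (p : tile) := (p.1 == i) && `[< B p.2 >].
pose U := undup [seq p.2 | p <- s & a p].
apply: esum_ge; exists [set` U].
  split; first exact: finite_seq.
  by move=> x; rewrite /= mem_undup => /mapP[p]; rewrite mem_filter => /andP[/andP[_ /asboolP Bp] _] ->.
rewrite -fsbig_seq ?undup_uniq// sumEFin lee_fin -natr_sum ler_nat.
apply: (@leq_trans (\sum_(x <- U) \sum_(p <- s) (p == (i, x)))%N); last first.
  apply: leq_sum => x _; apply: leq_trans (sX x).
  rewrite /count_family -sum1_count [X in (_ <= X)%N]big_mkcond/= leq_eqVlt.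
  by apply/orP; left; apply/eqP/eq_bigr => p _; case: eqP.
rewrite exchange_big/= -sum1_count big_mkcond/= big_seq [X in (_ <= X)%N]big_seq.
apply: leq_sum => p ps; case: ifP => // ap.
have pU : p.2 \in U by rewrite mem_undup; apply/mapP; exists p => //; rewrite mem_filter /a ap.
rewrite (big_rem _ pU)/=; have /andP[/eqP <- _] := ap.
by rewrite -surjective_pairing eqxx.
Qed.

(** By primitivity each tile, inflated often enough, contains a translate of
    any other one. *)
Lemma tile_volumes_gt0 : (exists j, 0 < rvol (T j)) -> forall i, 0 < rvol (T i).
Proof.
move=> [j Tj] i; have [_ [k _ Sk]] := pS.
have [y] := iter_subst_reach A 0 (Sk j i).
move=> jy; have := patch_iter_subst k [:: (i, 0)] uA TE.
have uk : A ^+ k \in unitmx by rewrite unitrX.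
move=> /(congr1 rvol); rewrite rvol_linear// patch1 rvol_translate => E.
have : 0 < `|\det (A ^+ k)| * rvol (T i).
  rewrite -E; apply: lt_le_trans Tj _; rewrite -(rvol_translate _ y).
  apply: le_rvol; first exact: patch_bounded.
  by rewrite /patch -bigcup_seq => x Tx; exists (j, y).
by rewrite pmulr_rgt0// normr_gt0 -unitfE -unitmxE.
Qed.

(** The tiles of the iterated substitution of a point of a fixed family [X]
    all belong to [X].  There are [|det A| ^ k] of them up to a constant, so
    weak uniform discreteness forces them to meet about as many cells of a
    lattice.  Pulled back by [A ^- k], these cells keep a volume bounded
    below while they gather around a translate of a single tile, whose volume
    is therefore positive. *)
Theorem weakly_uniformly_discrete_vol_gt0 (w : 'rV[R]_n) N
    (X : multiset_family R d.+1 n) :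
  (forall i, 0 < w 0 i) -> w *m subdivision_matrix D = `|\det A| *: w ->
  (0 < N)%N -> nonempty_family X -> (forall i, weakly_uniformly_discrete (X i)) ->
  iter N (inflation A D) X = X -> forall i, 0 < rvol (T i).
Proof.
move=> w0 wS N0 [j [x0 /= Xj]] Xd XN; apply: tile_volumes_gt0; exists j.
pose q := `|\det A|.
have q0 : 0 < q by rewrite normr_gt0 -unitfE -unitmxE.
pose L k : seq tile := iter (k * N) (subst A D) [:: (j, x0)].
have LX k i x : (count_family (L k) i x <= X i x)%N.
  rewrite /L -iter_inflation_count_family//.
  have -> : X = iter (k * N) (inflation A D) X.
    by elim: k => // k IH; rewrite mulSn addnC iterD XN.
  apply: inflation_mono => {}i {}x; rewrite /count_family/= addn0.
  by case: eqP => // -[<- <-].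
have [r hr] := choice Xd; have [m hm] := choice hr.
(* Cells of mesh [s] lie in Euclidean balls of radius [r i] for all [i]. *)
pose s := \big[Num.min/1]_i (r i / d.+2%:R).
have s0 : 0 < s.
  by apply/bigmin_gtP; split => // i _; rewrite divr_gt0//; case: (hm i).
have sr i : d.+1%:R * s < r i.
  have si : s <= r i / d.+2%:R by apply: bigmin_le_cond.
  apply: (@lt_le_trans _ _ (d.+2%:R * s)); first by rewrite ltr_pM2r// ltr_nat.
  by rewrite mulrC -ler_pdivlMr.
have cell_count k i z :
    (count (fun p => (p.1 == i) && (cell_index s p.2 == z)) (L k) <= m i)%N.
  have [_ _ /(_ (s *: map_mx intr z)) le_m] := hm i.
  have := le_trans (count_le_mcount _ (LX k i)) le_m.
  rewrite lee_fin ler_nat; apply: leq_trans; apply: sub_count => p /andP[-> /eqP pz]/=.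
  apply/asboolP; apply: le_lt_trans (sr i); apply: enorm_le.
  apply: (@cell_diam _ _ s z) => //; first by apply/cellP.
  by move=> l; rewrite !mxE lexx ltr_pM2l// ltr_int ltrDl.
pose Z k := undup [seq cell_index s p.2 | p <- L k].
pose M := (\sum_i m i)%N.
have M0 : 0 < M%:R :> R.
  by rewrite ltr0n /M (bigD1 j)//= addn_gt0; case: (hm j) => _ ->.
have sizeZ k : (size (L k) <= size (Z k) * M)%N.
  apply: (@leq_trans (\sum_(p <- L k) \sum_(z <- Z k) \sum_i
      ((p.1 == i) && (cell_index s p.2 == z)))%N).
    rewrite -sum1_size big_seq [X in (_ <= X)%N]big_seq; apply: leq_sum => p pL.
    have pZ : cell_index s p.2 \in Z k by rewrite mem_undup; exact: map_f.
    by rewrite (big_rem _ pZ)/= (bigD1 p.1)//= !eqxx.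
  rewrite exchange_big/= -sum1_size big_distrl/=; apply: leq_sum => z _.
  rewrite mul1n exchange_big/=; apply: leq_sum => i _; apply: leq_trans (cell_count k i z).
  by rewrite -sum1_count [leqRHS]big_mkcond/= leq_eqVlt; apply/orP; left; apply/eqP/eq_bigr => p _; case: ifP.
pose ws := \sum_i w 0 i.
have wi i : w 0 i <= ws.
  by rewrite /ws (bigD1 i)//= lerDl sumr_ge0// => l _; exact: ltW.
have ws0 : 0 < ws by apply: lt_le_trans (wi j).
have sizeL k : q ^+ (k * N) * w 0 j <= (size (L k))%:R * ws.
  have <- : weight w (L k) = q ^+ (k * N) * w 0 j.
    by rewrite (weight_iter_subst _ _ _ wS) /weight big_seq1.
  rewrite /weight -sum1_size natr_sum mulr_suml; apply: ler_sum => p _.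
  by rewrite mul1r.
pose c := w 0 j / ws / M%:R * (s ^+ d.+1 * cell_rvol (R := R) (d := d)).
have kap0 : 0 < s ^+ d.+1 * cell_rvol (R := R) (d := d).
  by rewrite mulr_gt0 ?exprn_gt0// cell_rvol_gt0.
have c0 : 0 < c by rewrite mulr_gt0// !divr_gt0.
(* The cells that meet the k-th list, pulled back. *)
pose W k := [set invmx (A ^+ (k * N)) *m x | x in
  \big[setU/set0]_(z <- Z k) cell s z].
have Wc k : c <= rvol (W k).
  have uk : A ^+ (k * N) \in unitmx by rewrite unitrX.
  rewrite /W rvol_linear ?unitmx_inv// det_inv normfV.
  rewrite det_exprmx normrX -/q ler_pdivlMl ?exprn_gt0//.
  have bU : norm_bounded (\big[setU/set0]_(z <- Z k) cell s z : set V).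
    by apply: norm_bounded_bigU => z; exact: norm_bounded_cell.
  apply: le_trans (@cells_rvol_le _ _ s (Z k) _ s0 (undup_uniq _) bU).
  rewrite [leRHS]big_seq (eq_bigr (fun=> s ^+ d.+1 * cell_rvol (R := R) (d := d))); last first.
    move=> z zZ; rewrite -(rvol_cell z s0); congr rvol.
    by apply/setIidPr => x xz; rewrite -bigcup_seq; exists z.
  rewrite -big_seq big_const_seq count_predT iter_addr_0 -[leRHS]mulr_natl.
  rewrite /c [leLHS]mulrA; apply: ler_wpM2r; first exact: ltW.
  rewrite !mulrA ler_pdivrMr// ler_pdivrMr//.
  apply: le_trans (sizeL k) _; rewrite ler_pM2r// -natrM ler_nat.
  exact: sizeZ.
rewrite -(rvol_translate _ x0) ltNge; apply/negP => Tj0.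
have cK : compact (translate (T j) x0) by exact: compact_translate.
have [|e e0 hK] := compact_rvol_neighborhood (c := c) cK.
  exact: le_lt_trans c0.
have [rT rT0 Tr] := family_bounded cT.
have [|K hsmall] := inverse_iter_small G (r := rT + s) e0.
  by rewrite addr_ge0// ltW.
have KN : (K <= K * N)%N by rewrite leq_pmulr.
have := hK (W K); rewrite ltNge Wc => /(_ _)/wrap[]//.
move=> _ [u + <-]; rewrite -bigcup_seq => -[z /=]; rewrite mem_undup.
move=> /mapP[[i v] pL ->] uz; have [t Tt] := nT i.
have : patch T (L K) (t + v).
  by apply/patchP; exists (i, v) => //=; rewrite addrK.
rewrite /L (patch_iter_subst _ _ uA TE) patch1 => -[x Kx xE].
exists x => //; have uK : A ^+ (K * N) \in unitmx by rewrite unitrX.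
rewrite -[x in x - _](mulKmx uK) -mulmxBr xE invmxX//.
apply: (hsmall _ KN); rewrite -addrA; apply: le_trans (ler_normD _ _) _.
rewrite lerD ?(Tr i)//; apply: (cell_diam s0 (z := cell_index s v)) => //.
exact/cellP.
Qed.

End PositiveVolume.

(** * Interior of the tiles *)
Section Holes.
Context {R : realType} {d n : nat}.
Notation V := 'cV[R]_d.+1.
Notation tile := ('I_n * V)%type.

Definition has_interior_ball (X : set V) :=
  exists (x : V) (e : R), 0 < e /\ forall y, `|y - x| <= e -> X y.

(** By compactness finitely many holes serve all the balls near the set, while a
    ball far from the set is a hole itself. *)
Lemma compact_uniform_holes (X : set V) (r : R) : compact X -> ~ has_interior_ball X ->
  0 < r -> exists2 rho, 0 < rho & forall c, exists c', forall y, `|y - c'| <= rho ->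
    `|y - c| <= r /\ ~ X y.
Proof.
move=> cX nX r0; have [b b0 Xb] := compact_norm_bounded cX.
have clX : closed X by apply: compact_closed => //; exact: norm_hausdorff.
have r4 : 0 < r / 4 by rewrite divr_gt0.
pose K : set V := [set c | `|c| <= b + r].
have cK : compact K.
  apply: (@cV_bounded_closed_compact _ _ _ (b + r)) => //.
  apply: (@closed_comp _ _ (fun x : V => `|x|) [set t | t <= b + r]); last exact: closed_le.
  by move=> x _; exact: norm_continuous.
pose good (rho : R) (c : V) := exists c', forall y, `|y - c'| <= rho -> `|y - c| <= r /\ ~ X y.
have /compact_near_coveringP/(_ R (nbhs (0 : R)^'+) good) := cK.
case=> [c0 Kc0|e /= e0 he].
  have [c' [c'c0 Xc']] : exists c', `|c' - c0| <= r / 2 /\ ~ X c'.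
    apply/not_existsP => h; apply: nX; exists c0, (r / 2); split; first by rewrite divr_gt0.
    by move=> y yc; have /not_andP[//|/contrapT] := h y.
  have [t t0 tX] : exists2 t : R, 0 < t & forall y, `|y - c'| < t -> ~ X y.
    have : nbhs c' (~` X) by apply: open_nbhs_nbhs; split => //; exact: closed_openC.
    move=> /nbhs_ballP[t /= t0 tX]; exists t => // y yc; apply: tX.
    by rewrite -ball_normE /= distrC.
  exists (ball c0 (r / 4), [set rho | rho < Num.min t (r / 4)]).
    split; first exact: nbhsx_ballx.
    by apply: nbhs_right_lt; rewrite lt_min t0.
  move=> [c rho] [/= cc0]; rewrite lt_min => /andP[rt r4']; exists c' => y yc'; split.
    rewrite -ball_normE /= in cc0.
    rewrite (_ : y - c = (y - c') + (c' - c0) + (c0 - c)); last first.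
      by rewrite !addrA !subrK.
    apply: le_trans (ler_normD _ _) _; have := ler_normD (y - c') (c' - c0).
    by move: cc0 yc' c'c0 r4'; lra.
  by apply: tX; apply: le_lt_trans rt.
have e2 : `|0 - e / 2| < e.
  rewrite sub0r normrN ger0_norm ?divr_ge0 ?(ltW e0)//.
  by rewrite ltr_pdivrMr// ltr_pMr// ltr1n.
have e20 : 0 < e / 2 by rewrite divr_gt0.
exists (Num.min (e / 2) r); first by rewrite lt_min e20.
move=> c; have [Kc|nKc] := pselect (K c).
  have [c' hc'] : good (e / 2) c by apply: (he _ e2 e20).
  by exists c' => y; rewrite le_min => /andP[+ _]; exact: hc'.
exists c => y; rewrite le_min => /andP[_ yc]; split => // /Xb yb.
apply: nKc; rewrite /K /= -[c](subrK y); apply: le_trans (ler_normD _ _) _.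
by rewrite addrC lerD// distrC.
Qed.

Variable T : 'I_n -> set V.
Hypothesis cT : forall i, compact (T i).

(** A hole of each tile is found inside the hole left by the previous ones, so
    that the final radius depends on the number of tiles only. *)
Lemma tiles_uniform_holes : (forall i, ~ has_interior_ball (T i)) ->
  forall m (r : R), 0 < r -> exists2 rho, 0 < rho & forall s : seq tile, (size s <= m)%N ->
  forall c, exists c', forall y, `|y - c'| <= rho ->
    `|y - c| <= r /\ forall p, p \in s -> ~ tile_set T p y.
Proof.
move=> nT; elim=> [|m IH] r r0.
  exists r => // s; rewrite leqn0 size_eq0 => /eqP -> c; exists c => y yc.
  by split.
have h i : exists rho, 0 < rho /\ forall c, exists c', forall y, `|y - c'| <= rho ->
    `|y - c| <= r /\ ~ T i y.
  by have [rho rho0 hr] := compact_uniform_holes (@cT i) (nT i) r0; exists rho.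
have [rho hrho] := choice h.
pose r1 := \big[Num.min/r]_i rho i.
have r10 : 0 < r1 by apply/bigmin_gtP; split => // i _; case: (hrho i).
have [rho' rho'0 h'] := IH r1 r10; exists rho' => // -[|p s] ps c.
  have [c' hc'] := h' [::] isT c; exists c' => y /hc'[yc _]; split => //.
  by apply: le_trans yc _; exact: bigmin_le_id.
have [_ /(_ (c - p.2))[c1 hc1]] := hrho p.1.
have [c' hc'] := h' s ps (c1 + p.2); exists c' => y /hc'[yc ys].
have /hc1[yc1 nTy] : `|y - p.2 - c1| <= rho p.1.
  rewrite -addrA -opprD [p.2 + c1]addrC; apply: le_trans yc _; exact: bigmin_le_cond.
split; first by move: yc1; rewrite opprB addrA subrK.
move=> p'; rewrite inE => /orP[/eqP ->|/ys//] [z Tz zy].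
by apply: nTy; rewrite -zy addrK.
Qed.

(** The indices of the cells that meet a bounded set have bounded entries. *)
Lemma bounded_cells (X : set V) : norm_bounded X -> exists2 Z : seq 'cV[int]_d.+1, uniq Z &
  forall z, z \in Z <-> (X `&` cell 1 z !=set0).
Proof.
move=> [r Xr]; have [B rB] : exists B : nat, r + 1 < B%:R.
  by exists (Num.truncn (r + 1)).+1; rewrite truncnS_gt.
pose f (u : 'cV['I_(B + B).+1]_d.+1) : 'cV[int]_d.+1 :=
  \col_i ((u i 0 : nat)%:Z - B%:Z).
exists (undup [seq z <- [seq f u | u <- enum {: 'cV['I_(B + B).+1]_d.+1}] | `[< X `&` cell 1 z !=set0 >]]).
  exact: undup_uniq.
move=> z; rewrite mem_undup mem_filter; split=> [/andP[/asboolP//]|Xz].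
apply/andP; split; first exact/asboolP.
have [x [Xx xz]] := Xz.
have zB i : `|z i 0| <= B%:Z.
  have /andP[l u] := xz i; rewrite !mul1r intrD in l u.
  have := le_trans (coord_le_norm x i 0) (Xr _ Xx); rewrite ler_norml => /andP[l' u'].
  have h1 : (z i 0)%:~R <= B%:~R :> R by have : (B%:~R : R) = B%:R by []; move=> ->; lra.
  have h2 : - B%:~R <= (z i 0)%:~R :> R by have : (B%:~R : R) = B%:R by []; move=> ->; lra.
  by rewrite ler_norml -!(ler_int R) mulrNz h1 h2.
apply/mapP; exists (\col_i inord (absz (z i 0 + B%:Z))); first by rewrite mem_enum.
apply/colP => i; rewrite !mxE inordK.
  by have := zB i; rewrite ler_norml => /andP[? ?]; lia.
by have := zB i; rewrite ler_norml => /andP[? ?]; lia.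
Qed.

End Holes.

Section Interior.
Context {R : realType} {d n : nat}.
Notation V := 'cV[R]_d.+1.
Notation tile := ('I_n * V)%type.
Variables (A : 'M[R]_d.+1) (G : contracting_gauge A).
Variables (D : 'I_n -> 'I_n -> {fset V}) (T : 'I_n -> set V).
Hypotheses (uA : A \in unitmx) (TE : multi_tile_equation A (digit_sets D) T).
Hypotheses (cT : forall i, compact (T i)) (T0 : forall i, 0 < rvol (T i)).
Hypothesis pS : primitive (subdivision_matrix D).
Hypothesis TS :
  tile_volumes T *m subdivision_matrix D = `|\det A| *: tile_volumes T.

(** The tiles that meet a unit cell lie in a cube of fixed size, of which each
    occupies at least a fixed volume, without overlaps. *)
Lemma packed_cell_bound : exists C : nat, forall (s : seq tile) z, packed T s ->
  (size [seq p <- s | `[< tile_set T p `&` cell 1 z !=set0 >]] <= C)%N.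
Proof.
have [b b0 Tb] := family_bounded cT.
have [m m0 mT] : exists2 m : R, 0 < m & forall i, m <= rvol (T i).
  exists (\big[Num.min/1]_i rvol (T i)); first by apply/bigmin_gtP; split.
  by move=> i; exact: bigmin_le_cond.
pose X : set V := [set y | `|y| <= 1 + 2 * b].
have bX : norm_bounded X by exists (1 + 2 * b).
exists (Num.truncn (rvol X / m)) => s z ps.
set f := [seq p <- s | _].
have pf : packed T f by exact: packed_filter.
have : (size f)%:R * m <= rvol (translate X (map_mx intr z)).
  apply: (packed_size_le pf) => //; first exact: norm_bounded_translate.
  move=> p; rewrite mem_filter => /andP[/asboolP[x [[t Tt <-] xz]] _] _ [y Ty <-].
  exists (y + p.2 - map_mx intr z); last by rewrite /= subrK.
  rewrite /X /= (_ : _ - _ = (y - t) + (t + p.2 - map_mx intr z)); last first.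
    by rewrite !addrA subrK.
  apply: le_trans (ler_normD _ _) _; rewrite addrC lerD//.
    apply: (cell_diam _ xz) => // i.
    by rewrite !mxE !mul1r lexx ltr_int ltrDl.
  apply: le_trans (ler_normB _ _) _; rewrite mulr_natl mulr2n lerD//; exact: (Tb p.1).
rewrite rvol_translate -ler_pdivlMr// => h.
by rewrite truncn_ge_nat// (le_trans _ h).
Qed.

(** If no tile had interior, every unit cell would contain a hole of a fixed
    size left by the patch [A ^ M T_j], whose density in its cells would thus
    be bounded away from 1.  But the cells meeting the patch, pulled back by
    [A ^- M], form a thin neighbourhood of [T_j], of almost the same volume. *)
Lemma some_tile_has_interior : (0 < n)%N -> exists i, has_interior_ball (T i).
Proof.
move=> n0; apply: contrapT => /forallNP nT; pose j := Ordinal n0.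
have [C hC] := packed_cell_bound.
have [|rho rho0 hrho] := tiles_uniform_holes cT nT C (r := 4^-1); first by rewrite invr_gt0.
pose kap := cell_rvol (R := R) (d := d); pose eta := rho ^+ d.+1 * kap.
have kap0 : 0 < kap := cell_rvol_gt0.
have eta0 : 0 < eta by rewrite mulr_gt0// exprn_gt0.
pose q := `|\det A|.
have q0 : 0 < q by rewrite normr_gt0 -unitfE -unitmxE.
pose L M : seq tile := iter M (subst A D) [:: (j, 0)].
have pL M : packed T (L M).
  by apply: (packed_iter_subst uA TE _ TS); exact: packed1.
have PE M : patch T (L M) = [set A ^+ M *m x | x in T j].
  by rewrite /L (patch_iter_subst _ _ uA TE) patch1 translate0.
have bP M : norm_bounded (patch T (L M)) by exact: patch_bounded.
have detX M : `|\det (A ^+ M)| = q ^+ M.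
  by rewrite det_exprmx normrX.
have hole M z : rvol (patch T (L M) `&` cell 1 z) <= kap - eta.
  have mP : caratheodory_measurable (@lebesgue_vol R d.+1) (patch T (L M)).
    by apply: caratheodory_bigU => p; apply: compact_caratheodory; exact: tile_set_compact.
  have bc := @norm_bounded_cell R d 1 z ltr01.
  have := rvol_split bc mP; rewrite rvol_cell// expr1n mul1r -/kap => ->.
  rewrite -addrA [cell 1 z `&` _]setIC lerDl subr_ge0.
  pose c : V := \col_i ((z i 0)%:~R + 2^-1).
  have [c' hc'] := hrho _ (hC (L M) z (pL M)) c.
  apply: (@rvol_norm_ball_gt0 _ _ c' rho) => //; first by apply: norm_boundedS bc => x [].
  move=> y /hc'[yc ys].
  have yz : cell 1 z y.
    move=> i; have := le_trans (coord_le_norm _ i 0) yc; rewrite !mxE ler_norml.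
    by rewrite !mul1r intrD => /andP[? ?]; apply/andP; split; lra.
  split => // /patchP[p pL' Tp].
  have Tpy : tile_set T p y by exists (y - p.2) => //=; rewrite subrK.
  apply: (ys p) => //; rewrite mem_filter pL' andbT; apply/asboolP.
  by exists y.
have lower M (Z : seq 'cV[int]_d.+1) :
    (forall z, z \in Z <-> (patch T (L M) `&` cell 1 z !=set0)) ->
    q ^+ M * rvol (T j) <= (size Z)%:R * (kap - eta).
  move=> hZ; have uM : A ^+ M \in unitmx by rewrite unitrX.
  rewrite -detX -rvol_linear// -PE.
  apply: (@le_trans _ _ (rvol (\big[setU/set0]_(z <- Z) (patch T (L M) `&` cell 1 z)))).
    apply: le_rvol.
      by apply: norm_bounded_bigU => z; apply: norm_boundedS (bP M) => x [].
    move=> x Px; rewrite -bigcup_seq.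
    have xc : cell 1 (cell_index 1 x) x by apply/cellP.
    by exists (cell_index 1 x) => //; apply/hZ; exists x.
  apply: le_trans (rvol_bigU_le _ _) _.
    by move=> z; apply: norm_boundedS (bP M) => x [].
  apply: le_trans (ler_sum _ (fun z _ => hole M z)) _.
  by rewrite big_const_seq count_predT iter_addr_0 mulr_natl.
have [Z0 _ hZ0] := bounded_cells (bP 0%N).
have ke : 0 < kap - eta.
  have := lower _ _ hZ0; rewrite expr0 mul1r => h.
  have := lt_le_trans (T0 j) h; rewrite ltNge => h'; rewrite ltNge; apply/negP => h''.
  by move/negP: h'; apply; rewrite mulr_ge0_le0.
(* The patch fills at most the fraction (kap - eta) / kap of each cell, so the
   cells that it meets, pulled back, have a total volume of at least [c]. *)
pose c := rvol (T j) * kap / (kap - eta).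
have Tc : rvol (T j) < c.
  by rewrite /c ltr_pdivlMr// ltr_pM2l// gtrDl oppr_lt0.
have [e e0 he] := compact_rvol_neighborhood (@cT j) Tc.
have [M /(_ M (leqnn M)) hM] := inverse_iter_small G e0 ler01.
have [Z uZ hZ] := bounded_cells (bP M).
have uM : A ^+ M \in unitmx by rewrite unitrX.
pose U := \big[setU/set0]_(z <- Z) cell 1 z : set V.
have bU : norm_bounded U by apply: norm_bounded_bigU => z; exact: norm_bounded_cell.
have : rvol [set invmx (A ^+ M) *m x | x in U] < c.
  apply: he => _ [u + <-]; rewrite /U -bigcup_seq => -[z /= /hZ[x' [+ x'z]] uz].
  rewrite PE => -[x Tx xE]; exists x => //.
  rewrite -[x in x - _](mulKmx uM) -mulmxBr invmxX//; apply: hM.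
  by rewrite xE; exact: cell_diam x'z uz.
rewrite rvol_linear ?unitmx_inv// det_inv normfV detX ltr_pdivrMl ?exprn_gt0// ltNge.
move=> /negP; apply.
apply: (@le_trans _ _ ((size Z)%:R * kap)).
  rewrite /c !mulrA ler_pdivrMr// -[leRHS]mulrA [kap * _]mulrC mulrA ler_pM2r//.
  exact: lower.
apply: le_trans (cells_rvol_le ltr01 uZ bU).
rewrite big_seq (eq_bigr (fun=> kap)); last first.
  move=> z zZ; rewrite -[RHS]mul1r -[in RHS](expr1n R d.+1) -(rvol_cell z)//.
  by congr rvol; apply/setIidPr => x xz; rewrite /U -bigcup_seq; exists z.
by rewrite -big_seq big_const_seq count_predT iter_addr_0 mulr_natl.
Qed.

(** Each tile, inflated often enough, contains a translate of the one that has
    interior. *)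
Theorem tiles_have_interior : (0 < n)%N -> forall i, has_interior_ball (T i).
Proof.
move=> n0 i; have [j [x [e [e0 xe]]]] := some_tile_has_interior n0.
have [_ [k _ Sk]] := pS; have [y jy] := iter_subst_reach A 0 (Sk j i).
have uk : A ^+ k \in unitmx by rewrite unitrX.
have s0 : 0 < entry_sum (A ^+ k) + 1 by rewrite ltr_wpDl// entry_sum_ge0.
exists (invmx (A ^+ k) *m (x + y)), (e / (entry_sum (A ^+ k) + 1)).
split; first by rewrite divr_gt0.
move=> z zx; have : patch T (iter k (subst A D) [:: (i, 0)]) (A ^+ k *m z).
  apply/patchP; exists (j, y) => //=; apply: xe.
  rewrite (_ : _ - _ = A ^+ k *m (z - invmx (A ^+ k) *m (x + y))); last first.
    by rewrite mulmxBr mulKVmx// opprD addrA addrAC.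
  apply: le_trans (norm_mulmx_le _ _) _.
  apply: (@le_trans _ _ ((entry_sum (A ^+ k) + 1) * `|z - invmx (A ^+ k) *m (x + y)|)).
    by rewrite ler_wpM2r// lerDl.
  by rewrite mulrC -ler_pdivlMr.
rewrite (patch_iter_subst _ _ uA TE) patch1 => -[z' [t Tt tz'] /(can_inj (mulKmx uk)) <-].
by rewrite -tz' addr0.
Qed.

End Interior.

(** * Self-replicating multi-tilings *)
Section Tiling.
Context {R : realType} {d n : nat}.
Notation V := 'cV[R]_d.+1.
Notation tile := ('I_n * V)%type.
Variables (A : 'M[R]_d.+1) (G : contracting_gauge A).
Variables (D : 'I_n -> 'I_n -> {fset V}) (T : 'I_n -> set V).
Hypotheses (uA : A \in unitmx) (TE : multi_tile_equation A (digit_sets D) T).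
Hypotheses (cT : forall i, compact (T i)) (T0 : forall i, 0 < rvol (T i)).
Hypothesis pS : primitive (subdivision_matrix D).
Hypothesis n0 : (0 < n)%N.

(** A piece of [T_j] of type [j], inside a ball contained in [T_j], is the
    image of [T_j] under a contraction, whose fixed point is a periodic point
    in the interior of [T_j].  Its opposite is the position of a tile that
    surrounds the origin and recurs in its own iterated substitution. *)
Lemma exists_seed : (forall i, has_interior_ball (T i)) ->
  exists N j (x0 : V) (rho : R), [/\ (0 < N)%N, 0 < rho,
    (j, x0) \in iter N (subst A D) [:: (j, x0)] &
    forall y, `|y| <= rho -> tile_set T (j, x0) y].
Proof.
move=> iT; pose j := Ordinal n0; have [t [e [e0 te]]] := iT j.
have Tt : T j t by apply: te; rewrite subrr normr0 ltW.
have [b b0 Tb] := family_bounded cT.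
have [|M /(_ M (leqnn M)) hM] := inverse_iter_small G (r := 2 * b) e0.
  by rewrite mulr_ge0// ltW.
have uM : A ^+ M \in unitmx by rewrite unitrX.
have : patch T (iter M (subst A D) [:: (j, 0)]) (A ^+ M *m t).
  rewrite (patch_iter_subst _ _ uA TE) patch1; exists t => //.
  by exists t => //; rewrite addr0.
move=> /patchP[[i v] iv /= Ti]; have [_ [k k0 Sk]] := pS.
have [y /(iter_subst_shift v)] := iter_subst_reach A 0 (Sk j i).
rewrite add0r; set dd := (y + _) => jd.
pose N := (k + M)%N.
have jdN : (j, dd) \in iter N (subst A D) [:: (j, 0)].
  by rewrite /N iterD; apply/mem_iter_subst; exists (i, v).
have uk : A ^+ k \in unitmx by rewrite unitrX.
have uN : A ^+ N \in unitmx by rewrite unitrX.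
pose B := invmx (A ^+ N).
have piece u : T j u -> T j (B *m (u + dd)) /\ `|B *m (u + dd) - t| < e.
  move=> Tu; have : patch T (iter k (subst A D) [:: (i, v)]) (u + dd).
    by apply/patchP; exists (j, dd) => //=; rewrite addrK.
  rewrite (patch_iter_subst _ _ uA TE) patch1 => -[_ [u' Tu' <-] <-] /=.
  have -> : B *m (A ^+ k *m (u' + v)) = invmx (A ^+ M) *m (u' + v).
    apply: (can_inj (mulKmx uN)); rewrite /B mulKVmx// /N exprD.
    by rewrite -[A ^+ k * A ^+ M *m _]mulmxA mulKVmx.
  suff h : `|invmx (A ^+ M) *m (u' + v) - t| < e by split => //; apply: te; exact: ltW.
  rewrite -[t in _ - t](mulKmx uM) -mulmxBr invmxX//; apply: hM.
  rewrite -addrA -opprB; apply: le_trans (ler_normB _ _) _.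
  by rewrite mulr_natl mulr2n lerD//; [exact: (Tb i) | exact: (Tb i)].
have Bsmall (f r : R) : 0 < f -> 0 <= r -> exists m, forall x : V, `|x| <= r -> `|B ^+ m *m x| < f.
  move=> f0 r0; have [K hK] := inverse_iter_small G f0 r0.
  exists K => x xr; rewrite /B invmxX// -exprM; apply: hK => //.
  by rewrite leq_pmull// addn_gt0 k0.
have u1 : 1%:M - B \in unitmx.
  rewrite unitmxE unitfE -det_tr; apply/negP => /det0P[x x0 xB].
  have Bx : B *m x^T = x^T.
    apply/eqP; rewrite eq_sym -subr_eq0 -{1}[x^T]mul1mx -mulmxBl.
    by rewrite -[_ - _]trmxK -trmx_mul xB trmx0.
  have Bmx m : B ^+ m *m x^T = x^T.
    by elim: m => [|m IH]; rewrite ?mul1mx// exprSr -[_ *m x^T]mulmxA Bx.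
  have xn0 : 0 < `|x^T|.
    rewrite normr_gt0; apply: contra x0 => /eqP h.
    by rewrite -[x]trmxK h trmx0.
  have [m hm] := Bsmall _ _ xn0 (ltW xn0).
  by have := hm _ (lexx _); rewrite Bmx ltxx.
(* The fixed point of the contraction [z |-> B (z + dd)] of [T j]. *)
pose y0 := invmx (1%:M - B) *m (B *m dd).
have y0E : B *m (y0 + dd) = y0.
  rewrite mulmxDr; have : (1%:M - B) *m y0 = B *m dd by rewrite mulKVmx.
  by rewrite mulmxBl mul1mx => <-; rewrite addrC subrK.
pose u m := iter m (fun z => B *m (z + dd)) t.
have Tu m : T j (u m) by elim: m => //= m /piece[].
have uE m : u m - y0 = B ^+ m *m (t - y0).
  elim: m => [|m IH]; first by rewrite mul1mx.
  rewrite /= -[X in _ - X]y0E -mulmxBr opprD addrACA subrr addr0 IH.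
  by rewrite exprS mulmxA.
have Ty0 : T j y0.
  apply: closed_approx => [|f f0].
    by apply: compact_closed; [exact: norm_hausdorff | exact: cT].
  have [m hm] := Bsmall _ _ f0 (normr_ge0 (t - y0)).
  by exists (u m) => //; rewrite distrC uE; exact: hm.
have [_] := piece _ Ty0; rewrite y0E => y0t.
exists N, j, (- y0), (e - `|y0 - t|); split.
- by rewrite addn_gt0 k0.
- by rewrite subr_gt0.
- have := iter_subst_shift (- y0) jdN; rewrite add0r.
  suff -> : dd + A ^+ N *m - y0 = - y0 by [].
  by rewrite mulmxN -{1}y0E /B mulKVmx// opprD addrCA subrr addr0.
move=> z zr; exists (z + y0); last by rewrite /= addrK.
apply: te; rewrite -addrA; apply: le_trans (ler_normD _ _) _.
by rewrite -lerBrDr.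
Qed.

(** At most one term of the sum is nonzero. *)
Lemma mcount_le1 (X : multiset R d.+1) (B : set V) : (forall x, (X x <= 1)%N) ->
  (forall x y, B x -> B y -> (0 < X x)%N -> (0 < X y)%N -> x = y) ->
  (mcount X B <= 1)%E.
Proof.
move=> X1 BX; have [[x0 [Bx0 Xx0]]|nx] := pselect (exists x, B x /\ (0 < X x)%N); last first.
  rewrite /mcount esum1 ?lee01// => x Bx; have [->//|Xx] := posnP (X x).
  by exfalso; apply: nx; exists x.
have X0 x : (0%R <= (X x)%:R%:E :> \bar R)%E by rewrite lee_fin.
rewrite /mcount (esumID [set x0])//.
rewrite [X in (_ + X)%E]esum1 => [|x [Bx /= xx0]]; last first.
  by have [->//|Xx] := posnP (X x); exfalso; apply: xx0; exact: BX.
rewrite (_ : B `&` [set x0] = [set x0]); last first.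
  by apply/seteqP; split => [x []//|x ->].
by rewrite esum_set1// adde0 lee_fin lern1.
Qed.

(** Pointwise convergence of integer-valued functions: each value is
    eventually constant. *)
Definition converges (Y : nat -> multiset_family R d.+1 n) X :=
  forall i x, exists K, forall k, (K <= k)%N -> Y k i x = X i x.

(** A value of the inflation depends on finitely many values of the family. *)
Lemma converges_inflation Y X : converges Y X ->
  converges (fun k => inflation A D (Y k)) (inflation A D X).
Proof.
move=> YX i x.
have [K hK] := choice (fun jv : 'I_n * V => YX jv.1 (invmx A *m (x - jv.2))).
exists (\sum_j \sum_(v <- (D i j : seq V)) K (j, v))%N => k Kk.
apply: eq_bigr => j _; rewrite /mset_add_digits big_seq [RHS]big_seq.
apply: eq_bigr => v vD; apply: (hK (j, v)); apply: leq_trans Kk.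
by rewrite (bigD1 j)//= (big_rem _ vD)/= -addnA leq_addr.
Qed.

Lemma converges_iter_inflation N Y X : converges Y X ->
  converges (fun k => iter N (inflation A D) (Y k)) (iter N (inflation A D) X).
Proof. by move=> YX; elim: N => //= N; exact: converges_inflation. Qed.

Hypothesis TS :
  tile_volumes T *m subdivision_matrix D = `|\det A| *: tile_volumes T.
Hypothesis UT : unique_compact_solution A (digit_sets D) T.

Section Seed.
Variables (N : nat) (j : 'I_n) (x0 : V) (rho : R).
Hypotheses (N0 : (0 < N)%N) (rho0 : 0 < rho).
Hypothesis seed : (j, x0) \in iter N (subst A D) [:: (j, x0)].
Hypothesis origin : forall y, `|y| <= rho -> tile_set T (j, x0) y.

Definition generation k : seq tile := iter (k * N) (subst A D) [:: (j, x0)].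

(** The increasing union of the generations, as a family of sets. *)
Definition generated_family : multiset_family R d.+1 n :=
  fun i x => `[< exists k, (i, x) \in generation k >] : nat.

Lemma generationD k m : generation (k + m) = iter (k * N) (subst A D) (generation m).
Proof. by rewrite /generation mulnDl iterD. Qed.

Lemma generation_packed k : packed T (generation k).
Proof. by apply: (packed_iter_subst uA TE _ TS); exact: packed1. Qed.

(** The seed belongs to the first generation, and the substitution is
    monotone. *)
Lemma generation_le k m : (k <= m)%N -> {subset generation k <= generation m}.
Proof.
have step l : {subset generation l <= generation l.+1}.
  move=> p; rewrite -[l.+1]addn1 generationD => /mem_iter_subst[q]; rewrite inE => /eqP -> pq.
  by apply/mem_iter_subst; exists (j, x0) => //; rewrite /generation mul1n.
move=> km; rewrite -(subnKC km); elim: (m - k)%N => [|l IH]; first by rewrite addn0.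
by move=> p /IH; rewrite addnS; exact: step.
Qed.

Lemma generated_underlying i x :
  underlying (generated_family i) x <-> exists k, (i, x) \in generation k.
Proof.
rewrite /underlying /generated_family /= lt0b; split => [/asboolP//|h].
exact/asboolP.
Qed.

(** Generations have no repeated tiles since they are packed. *)
Lemma generation_converges :
  converges (fun k => count_family (generation k)) generated_family.
Proof.
move=> i x; rewrite /generated_family /count_family; case: asboolP => [[k ik]|nik].
  exists k => l kl; rewrite count_uniq_mem ?(generation_le kl ik)//.
  exact: packed_uniq cT T0 _ (generation_packed l).
exists 0%N => k _; apply/count_memPn/negP => ik; apply: nik; by exists k.
Qed.

(** The limit of the generations is also the limit of their inflations, which
    are the next generations. *)
Lemma generated_family_fixed : iter N (inflation A D) generated_family = generated_family.
Proof.
apply/funext => i; apply/funext => x.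
have [K hK] := converges_iter_inflation N generation_converges i x.
have [K' hK'] := generation_converges i x.
pose k := maxn K K'; rewrite -(hK k) ?leq_maxl// iter_inflation_count_family//.
have -> : iter N (subst A D) (generation k) = generation k.+1.
  by rewrite -[k.+1]add1n generationD mul1n.
by rewrite hK'// leqW// leq_maxr.
Qed.

(** The generations cover the images of a neighbourhood of the origin by the
    powers of [A], hence everything; two tiles belong to a common generation,
    which is packed. *)
Lemma generated_tiling : tiling T generated_family.
Proof.
split.
  apply/seteqP; split => // z _.
  have [K' /(_ (K' * N)%N) hK'] := inverse_iter_small G rho0 (normr_ge0 z).
  have uK : A ^+ (K' * N) \in unitmx by rewrite unitrX.
  have : patch T (generation K') z.
    rewrite /generation (patch_iter_subst _ _ uA TE) patch1.
    exists (invmx (A ^+ (K' * N)) *m z); last by rewrite mulKVmx.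
    by apply: origin; apply: ltW; rewrite invmxX//; apply: hK' => //; rewrite leq_pmulr.
  move=> /patchP[[i x] ix Ti]; exists i => //; exists x.
    by apply/generated_underlying; exists K'.
  by exists (z - x) => //=; rewrite subrK.
move=> i i' x y /generated_underlying[k ik] /generated_underlying[k' ik'] ne.
apply: (packed_null cT (generation_packed (maxn k k')) (p := (i, x)) (q := (i', y))).
- exact: generation_le (leq_maxl _ _) _ ik.
- exact: generation_le (leq_maxr _ _) _ ik'.
- exact/eqP.
Qed.

(** Two tiles of the same type with close positions would overlap in a ball. *)
Lemma generated_uniformly_discrete i : has_interior_ball (T i) ->
  uniformly_discrete (generated_family i).
Proof.
move=> [c [e [e0 ce]]]; exists (e / 2); first by rewrite divr_gt0.
move=> c0; apply: mcount_le1 => [x|x y Bx By Xx Xy].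
  by rewrite /generated_family; case: asboolP.
apply: contrapT => xy.
have xye : `|x - y| < e.
  rewrite -(subrKA c0) [e]splitr; apply: le_lt_trans (ler_normD _ _) _.
  rewrite ltrD//; first exact: le_lt_trans (norm_le_enorm _) Bx.
  by rewrite distrC; exact: le_lt_trans (norm_le_enorm _) By.
have [_ /(_ i i x y Xx Xy)] := generated_tiling.
have -> : ((i, x) <> (i, y)) = True by apply/propext; split => // _ [].
move=> /(_ I) vol0.
have s0 : 0 < e - `|x - y| by rewrite subr_gt0.
have bxy : norm_bounded (translate (T i) x `&` translate (T i) y).
  by apply: norm_boundedS (tile_set_bounded cT (i, x)) => z [].
have := @rvol_norm_ball_gt0 R d (c + x) _ _ s0 bxy.
rewrite /rvol vol0 /= leNgt mulr_gt0 ?exprn_gt0 ?cell_rvol_gt0// => h.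
suff : false by []; apply: h => z zc; split.
  exists (z - x); last by rewrite /= subrK.
  apply: ce; rewrite -addrA -opprD [x + c]addrC; apply: le_trans zc _.
  by rewrite gerDl oppr_le0.
exists (z - y); last by rewrite /= subrK.
apply: ce; rewrite (_ : _ - _ = (z - (c + x)) + (x - y)); last first.
  by rewrite addrA opprD !addrA subrK addrAC.
by apply: le_trans (ler_normD _ _) _; rewrite -lerBrDr.
Qed.

(** Every point lies in an inflated tile, which contains tiles of all types. *)
Lemma generated_relatively_dense i : relatively_dense (generated_family i).
Proof.
have [_ [k k0 Sk]] := pS.
have SkN := positive_power_mul N0 Sk.
have [y hy] := choice (fun l => iter_subst_reach A 0 (SkN i l)).
have [b b0 Tb] := family_bounded cT.
pose r := entry_sum (A ^+ (k * N)) * b + \sum_l `|y l|.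
have r0 : 0 <= r by rewrite addr_ge0 ?sumr_ge0// mulr_ge0 ?entry_sum_ge0// ltW.
exists (d.+1%:R * r + 1); first by rewrite ltr_wpDl// mulr_ge0.
move=> c; have uk : A ^+ (k * N) \in unitmx by rewrite unitrX.
have [cov _] := generated_tiling.
have : [set: V] (invmx (A ^+ (k * N)) *m c) by [].
rewrite -cov => -[l _ [x' /generated_underlying[m lm] [u Tu uE]]].
exists (y l + A ^+ (k * N) *m x'); split.
  apply/generated_underlying; exists (k + m)%N; rewrite generationD.
  apply/mem_iter_subst; exists (l, x') => //.
  by have := iter_subst_shift x' (hy l); rewrite add0r.
rewrite /eclosed_ball/=; apply: (@le_trans _ _ (d.+1%:R * r)); last by rewrite lerDl.
apply: enorm_le; have -> : c = A ^+ (k * N) *m (u + x') by rewrite uE mulKVmx.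
rewrite mulmxDr opprD addrACA subrr addr0 distrC.
apply: le_trans (ler_normB _ _) _; rewrite /r lerD//.
  apply: le_trans (norm_mulmx_le _ _) _.
  by rewrite ler_wpM2l ?entry_sum_ge0//; exact: Tb Tu.
by rewrite (bigD1 l)//= lerDl sumr_ge0.
Qed.

End Seed.

Theorem exists_self_replicating_multi_tiling :
  exists2 N, (0 < N)%N & exists X, self_replicating_multi_tiling A D N X.
Proof.
have iT := tiles_have_interior G uA TE cT T0 pS TS n0.
have [N [j [x0 [rho [N0 rho0 seed origin]]]]] := exists_seed iT.
exists N => //; exists (generated_family N j x0); split.
- exact: generated_family_fixed.
- move=> i; split; last exact: (generated_relatively_dense N0 rho0).
  exact: (generated_uniformly_discrete N0 rho0).
exists T; split.
- exact: iter_unique_compact_solution.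
- move=> i; rewrite rvolE ?lte_fin//; exact: norm_bounded_compact.
- exact: (generated_tiling N0 rho0).
Qed.

End Tiling.

(** * The equivalence *)

Theorem theorem6p1 (R : realType) (d n : nat) (hd : (0 < d)%N) (hn : (0 < n)%N)
    (A : 'M[R]_d) (hA : expanding A) (D : 'I_n -> 'I_n -> {fset 'cV[R]_d})
    (hS : primitive (subdivision_matrix D))
    (hPerron : is_perron_eigenvalue (subdivision_matrix D) `|\det A|) :
  [<->
    (* (i) *)
    exists2 N, (0 < N)%N & exists X : multiset_family R d n,
      [/\ nonempty_family X, forall i, weakly_uniformly_discrete (X i) &
          iter N (inflation A D) X = X];
    (* (ii) *)
    exists2 N, (0 < N)%N & exists X : multiset_family R d n,
      [/\ nonempty_family X, forall i, uniformly_discrete (X i) &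
          iter N (inflation A D) X = X];
    (* (iii) *)
    exists2 N, (0 < N)%N & exists X : multiset_family R d n,
      self_replicating_multi_tiling A D N X;
    (* (iv) *)
    exists2 T : 'I_n -> set 'cV[R]_d,
      unique_compact_solution A (digit_sets D) T &
      forall i, (0 < lebesgue_vol (T i))%E ].
Proof.
case: d hd A hA D hS hPerron => // d _ A hA D hS hPerron.
have uA := expanding_unitmx hA.
have [G] := expanding_contracting_gauge hA.
have [[w w0 wS] [v v0 Sv]] := perron_eigenvectors hn hS hPerron.
set P1 := (X in [<-> X; _; _; _]); set P2 := (X in [<-> _; X; _; _]).
set P3 := (X in [<-> _; _; X; _]); set P4 := (X in [<-> _; _; _; X]).
have P14 : P1 -> P4.
  move=> [N N0 [X [X0 Xd XN]]].
  have [T UT] := compact_solution_exists G uA hn hS; exists T => //.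
  have [[TE T0 cT] _] := UT.
  have nT := multi_tile_solution_nonempty uA TE hS
    (fun i j h => let: ex_intro v vD := subdivision_gt0 h in ex_intro _ v vD) T0.
  move=> i; rewrite rvolE ?lte_fin; last exact: norm_bounded_compact.
  exact: (weakly_uniformly_discrete_vol_gt0 G uA TE cT nT hS w0 wS N0 X0 Xd XN).
have P43 : P4 -> P3.
  move=> [T UT T0]; have [[TE _ cT] _] := UT.
  have T0' i : 0 < rvol (T i).
    by rewrite -lte_fin -rvolE ?T0//; exact: norm_bounded_compact.
  have TS := tile_volumes_eigen cT uA TE v0 Sv.
  exact: (exists_self_replicating_multi_tiling G uA TE cT T0' hS hn TS UT).
have P32 : P3 -> P2.
  move=> [N N0 [X [XN Xdel _]]]; exists N => //; exists X; split => //.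
    exists (Ordinal hn); have [_ [r r0 /(_ 0)[x [Xx _]]]] := Xdel (Ordinal hn).
    by exists x.
  by move=> i; case: (Xdel i).
have P21 : P2 -> P1.
  move=> [N N0 [X [X0 Xd XN]]]; exists N => //; exists X; split => // i.
  by have [r r0 h] := Xd i; exists r, 1%N; split.
split; first by move=> /P14/P43/P32.
split; first by move=> /P21/P14/P43.
split; first by move=> /P32/P21/P14.
by move=> /P43/P32/P21.
Qed.
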